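(* Let $(\lambda_n)_{n\ge1}$ be an enumeration of the rational numbers in $[0,1]$. For every $\varepsilon>0$ there exists $\delta>0$ such that the following holds. Let $G$ be a random probability measure supported on the Cartesian product of the unit balls of two arbitrary Hilbert spaces; let $\langle\cdot\rangle$ denote expectation under $G^{\otimes\mathbb N}$, with canonical random variables $(\sigma^\ell=(\sigma^\ell_1,\sigma^\ell_2))_{\ell\ge1}$; for $a\in\{1,2\}$ and $\ell,\ell',n\ge1$ let $R_a^{\ell,\ell'}:=\sigma_a^\ell\cdot\sigma_a^{\ell'}$ and $R^{\le n}:=(R_a^{\ell,\ell'})_{a\in\{1,2\},1\le\ell,\ell'\le n}$; and let $\mathbb E$ denote expectation with respect to the randomness of $G$. Assume that for every $n,h_1,h_2,p\in\{1,\dots,\lfloor\delta^{-1}\rfloor\}$ and every $f\in C(\mathbb{R}^{2\times n\times n})$ with $\|f\|_{L^\infty}\le1$, \[ \Big|\mathbb E\big\langle f(R^{\le n})(\lambda_{h_1}R_1^{1,n+1}+\lambda_{h_2}R_2^{1,n+1})^p\big\rangle-\frac1n\mathbb E\langle f(R^{\le n})\rangle\,\mathbb E\big\langle(\lambda_{h_1}R_1^{1,2}+\lambda_{h_2}R_2^{1,2})^p\big\rangle-\frac1n\sum_{\ell=2}^n\mathbb E\big\langle f(R^{\le n})(\lambda_{h_1}R_1^{1,\ell}+\lambda_{h_2}R_2^{1,\ell})^p\big\rangle\Big|\le\delta. \] Then for every $f\in C^\infty(\mathbb{R}^2)$, \[ \Big|\mathbb E\big\langle f(R_1^{1,2},R_2^{1,2})\big\rangle-\mathbb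 E\big[f(F_1^{-1}(U),F_2^{-1}(U))\big]\Big|\le\varepsilon\big(\|f\|_{L^\infty}+\|\nabla f\|_{L^\infty}\big), \] where $U$ is uniform on $[0,1]$ and, for $a\in\{1,2\}$ and $r\in[0,1]$, $F_a^{-1}(r):=\inf\{s\in\mathbb{R}:\mathbb E\langle\mathbf 1_{\{R_a^{1,2}\le s\}}\rangle\ge r\}$. *)

(* Defs.v *)
From HB Require Import structures.
From mathcomp Require Import all_boot all_order all_algebra.
From mathcomp Require Import all_classical all_reals all_analysis.
Set Implicit Arguments. Unset Strict Implicit. Unset Printing Implicit Defensive.
Import Order.TTheory GRing.Theory Num.Theory.
Import numFieldNormedType.Exports.
Local Open Scope classical_set_scope.
Local Open Scope ring_scope.

Definition is_hilbert_ip {R : realType} (V : normedModType R)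
  (ip : V -> V -> R) : Prop :=
  [/\ (forall x y, ip x y = ip y x),
      (forall (a : R) (x y z : V), ip (a *: x + y) z = a * ip x z + ip y z) &
      (forall x, ip x x = `|x| ^+ 2)].

(* Overlap sigma_a^l . sigma_a^l' of replicas l and l' of a configuration
   c : nat -> X (replicas indexed from 1), where s : X -> V is the a-th
   coordinate. *)
Definition overlap {R : realType} {X : Type} {V : Type} (ip : V -> V -> R)
  (s : X -> V) (c : nat -> X) (l l' : nat) : R := ip (s (c l)) (s (c l')).

Definition Rle {R : realType} {X V1 V2 : Type} (ip1 : V1 -> V1 -> R)
  (ip2 : V2 -> V2 -> R) (s1 : X -> V1) (s2 : X -> V2) (n : nat)
  (c : nat -> X) : 'M[R]_(n, n) * 'M[R]_(n, n) :=
  (\matrix_(i < n, j < n) overlap ip1 s1 c i.+1 j.+1,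
   \matrix_(i < n, j < n) overlap ip2 s2 c i.+1 j.+1).

Definition upd {X : Type} (c : nat -> X) (k : nat) (x : X) : nat -> X :=
  fun j => if j == k then x else c j.

Local Open Scope ereal_scope.

(* Integration of replicas 1..k against G_omega (the Gibbs average
   < . > under G^{(x) N} restricted to the first k replicas), written as an
   iterated integral. *)
Fixpoint rint {R : realType} {dO dX} {O : measurableType dO}
  {X : measurableType dX} (G : R.-pker O ~> X) (w : O) (k : nat)
  (g : (nat -> X) -> \bar R) : (nat -> X) -> \bar R :=
  match k with
  | 0 => g
  | k'.+1 => fun c => \int[G w]_x rint G w k' g (upd c k'.+1 x)
  end.

Definition EG {R : realType} {dO dX} {O : measurableType dO}
  {X : measurableType dX} (P : probability O R) (G : R.-pker O ~> X)
  (k : nat) (g : (nat -> X) -> \bar R) : \bar R :=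
  \int[P]_w rint G w k g (fun _ => point).

Definition Finv {R : realType} {dO dX} {O : measurableType dO}
  {X : measurableType dX} {V : Type} (P : probability O R)
  (G : R.-pker O ~> X) (ip : V -> V -> R) (s : X -> V) (r : R) : R :=
  inf [set t : R | r%:E <= EG P G 2
        (fun c => (if overlap ip s c 1 2 <= t then 1 else 0)%R%:E)].

Local Close Scope ereal_scope.

Definition pd1 {R : realType} (f : R -> R -> R) : R -> R -> R :=
  fun x y => derive1 (fun t => f t y) x.
Definition pd2 {R : realType} (f : R -> R -> R) : R -> R -> R :=
  fun x y => derive1 (fun t => f x t) y.

Fixpoint Ck2 {R : realType} (k : nat) (f : R -> R -> R) : Prop :=
  match k with
  | 0 => continuous (fun p : R * R => f p.1 p.2)
  | k'.+1 => continuous (fun p : R * R => f p.1 p.2) /\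
      (forall x y, derivable (fun t => f t y) x 1 /\
                   derivable (fun t => f x t) y 1) /\
      Ck2 k' (pd1 f) /\ Ck2 k' (pd2 f)
  end.

Definition smooth2 {R : realType} (f : R -> R -> R) : Prop :=
  forall k, Ck2 k f.

Definition supnorm2 {R : realType} (f : R -> R -> R) : \bar R :=
  ereal_sup (range (fun p : R * R => (`|f p.1 p.2|)%:E)).
Definition gradnorm2 {R : realType} (f : R -> R -> R) : \bar R :=
  ereal_sup (range (fun p : R * R =>
    (Num.sqrt (pd1 f p.1 p.2 ^+ 2 + pd2 f p.1 p.2 ^+ 2))%:E)).

(* Main.v *)
(** The proof is finitary: every step produces constants depending only on [eps].

    Polynomial approximation turns the hypothesis into approximate
    Ghirlanda-Guerra identities for all Lipschitz functions of the pair of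
    overlaps (monomials [x ^ a * y ^ b] are combinations of powers of
    [x + s * y] by inverting a Vandermonde matrix).

    Ultrametricity of [rho = R_1], [R_2] and [R_1 + R_2] comes from a duplication
    property: if a configuration of [n] replicas in which the overlaps of replica 1
    are at most [C] has positive probability, then so has the configuration with a
    further replica playing the same role as replica 1 and at overlap at most
    [C + w] from it. Otherwise the fresh replicas playing the role of replica 1
    would all be at overlap above [C] from it; by the identities the event that
    none of [k] fresh replicas is has probability at least of order [1 / k],
    whereas exchangeability turns these events into the disjoint events that
    the first fresh replica in that role is the [k]-th one. Repeated duplication of
    the two closest points of a non-ultrametric triple yields two clusters with
    almost equal barycentres, at different overlaps from the third point.

    If [R^{1,2}] could be both to the upper left and to the lower right, a triple
    with [R^{1,2}] in one region and [R^{1,3}] in the other would be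
    non-ultrametric for one of the three combinations. Hence
    [P(R_1 <= s, R_2 <= t)] is close to the minimum of the marginal distribution
    functions, which is the joint distribution function of the quantile
    coupling, and summation by parts over a grid concludes. *)
Require Import Defs.
From HB Require Import structures.
From mathcomp Require Import all_boot all_order all_algebra.
From mathcomp Require Import all_classical all_reals all_analysis.
From mathcomp Require Import measurable_realfun.
From mathcomp Require Import ring lra zify.
Set Implicit Arguments. Unset Strict Implicit. Unset Printing Implicit Defensive.
Import Order.TTheory GRing.Theory Num.Theory.
Import numFieldNormedType.Exports.
Local Open Scope classical_set_scope.
Local Open Scope ring_scope.

(** * Piecewise linear cutoffs and Lipschitz test functions *)

Section Ramp.
Variable R : realType.
Implicit Types (w t x y : R).

(** The hypothesis sees only continuous functions, so events become weights: products of continuous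
    functions of overlaps with values in [0, 1]. An event of probability at least [kappa] is a
    weight [W] with [kappa <= E W], and what holds on the event is asserted wherever [W c != 0]. No
    modulus of continuity of a weight is recorded: the hypothesis is uniform over all continuous [f]
    bounded by 1, so only the function of the fresh overlap needs a Lipschitz constant. Weights can
    therefore be multiplied, relabelled and duplicated many times; the only costs are a smaller
    [E W] and a larger threshold for [M]. This single integer [M] bounds the number of replicas, the
    Lipschitz constants and the inverse of the error, and its thresholds are chosen before the
    spaces, the measure and the weight. Duplication is quantitative because the harmonic series
    diverges: lower bounds of order 1 / k for disjoint events exceed the total mass 1 after a number
    of terms that depends on [kappa] only. *)

Definition ramp w t x : R := Num.min 1 (Num.max 0 ((t - x) / w)).

Lemma ramp01 w t x : 0 <= ramp w t x <= 1.
Proof. by rewrite /ramp /Num.min /Num.max; repeat case: ifPn; rewrite -?leNgt => *; lra. Qed.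

Lemma ramp_eq1 w t x : 0 < w -> x <= t - w -> ramp w t x = 1.
Proof.
move=> w0 xt; have h : 1 <= (t - x) / w by rewrite ler_pdivlMr//; lra.
by rewrite /ramp /Num.min /Num.max; repeat case: ifPn; rewrite -?leNgt => *; lra.
Qed.

Lemma ramp_eq0 w t x : 0 < w -> t <= x -> ramp w t x = 0.
Proof.
move=> w0 xt; have h : (t - x) / w <= 0 by rewrite ler_pdivrMr//; lra.
by rewrite /ramp /Num.min /Num.max; repeat case: ifPn; rewrite -?leNgt => *; lra.
Qed.

Lemma ramp_neq0 w t x : 0 < w -> ramp w t x != 0 -> x < t.
Proof. by move=> w0; apply: contraNT; rewrite -leNgt => /(ramp_eq0 w0) ->. Qed.

Lemma ramp_le w s t x : 0 < w -> s <= t -> ramp w s x <= ramp w t x.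
Proof.
move=> w0 st; have h : (s - x) / w <= (t - x) / w by rewrite ler_pM2r ?invr_gt0//; lra.
rewrite /ramp /Num.min /Num.max.
by repeat case: ifPn; rewrite -?leNgt => *; lra.
Qed.

Lemma ramp_lip w t x y : 0 < w -> `|ramp w t x - ramp w t y| <= w^-1 * `|x - y|.
Proof.
move=> w0.
have h : `|(t - x) / w - (t - y) / w| <= w^-1 * `|x - y|.
  rewrite (_ : _ - _ = - (w^-1 * (x - y))); last by ring.
  by rewrite normrN normrM gtr0_norm ?invr_gt0.
move: h; rewrite /ramp !ler_norml => /andP[h1 h2].
rewrite /Num.min /Num.max.
by repeat case: ifPn; rewrite -?leNgt => *; apply/andP; split; lra.
Qed.

Definition lip (M : nat) (u : R -> R) :=
  (forall x, 0 <= u x <= 1) /\ (forall x y, `|u x - u y| <= M%:R * `|x - y|).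

Lemma ramp_is_lip w t M : 0 < w -> w^-1 <= M%:R -> lip M (ramp w t).
Proof.
move=> w0 wM; split=> [x|x y]; first exact: ramp01.
by apply: le_trans (ramp_lip _ _ _ w0) _; rewrite ler_wpM2r.
Qed.

Lemma lipC M u : lip M u -> lip M (fun x => 1 - u x).
Proof.
move=> [u01 ul]; split=> [x|x y]; first by have := u01 x; lra.
have -> : 1 - u x - (1 - u y) = - (u x - u y) by ring.
by rewrite normrN; exact: ul.
Qed.

Lemma lip_continuous M u : lip M u -> continuous u.
Proof.
move=> [_ ul] x; apply/cvgrPdist_le => /= e e0.
have M1 : 0 < M.+1%:R :> R by [].
near=> y; apply: le_trans (ul x y) _.
apply: (@le_trans _ _ (M.+1%:R * `|x - y|)).
  by rewrite ler_wpM2r// ler_nat.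
rewrite mulrC -ler_pdivlMr//.
near: y; apply: cvgr_dist_le => //; exact: divr_gt0.
Unshelve. all: by end_near.
Qed.

Lemma lip1 M : lip M (fun=> 1).
Proof. by split=> [x|x y]; [rewrite ler01 lexx|rewrite subrr normr0 mulr_ge0]. Qed.

End Ramp.

(** * Weights of replica configurations *)

Section Weights.
Variables (R : realType) (X : Type) (r : X -> X -> R * R).
Local Notation cfg := (nat -> X).

(** Generated by factors, so that products and relabellings of replicas stay in the class by
    construction. Each weight is a continuous function of the array of the first [n] replicas, which
    is the form the hypothesis can test. *)
Inductive weight (n : nat) : (cfg -> R) -> Prop :=
| weight1 : weight n (fun=> 1)
| weightM i j (u : R * R -> R) g : (0 < i <= n)%N -> (0 < j <= n)%N ->
    continuous u -> (forall x, 0 <= u x <= 1) -> weight n g ->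
    weight n (fun c => u (r (c i) (c j)) * g c).

Definition sw (i j : nat) (c : cfg) : cfg :=
  fun k => c (if k == i then j else if k == j then i else k).

Lemma swK i j : involutive (sw i j).
Proof.
move=> c; apply/funext => k; rewrite /sw.
have [->|ki] := eqVneq k i; last have [->|kj] := eqVneq k j.
- by case: eqVneq => [->//|_]; rewrite eqxx.
- by rewrite eqxx.
- by rewrite (negbTE ki) (negbTE kj).
Qed.

Lemma swE1 i j c : sw i j c i = c j. Proof. by rewrite /sw eqxx. Qed.
Lemma swE2 i j c : sw i j c j = c i.
Proof. by rewrite /sw eqxx; case: eqVneq => [->|]. Qed.
Lemma swE i j c k : k != i -> k != j -> sw i j c k = c k.
Proof. by rewrite /sw => /negbTE -> /negbTE ->. Qed.
Lemma swii i c : sw i i c = c.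
Proof. by apply/funext => k; rewrite /sw; case: eqVneq => [->|]. Qed.

Lemma weight01 n g : weight n g -> forall c, 0 <= g c <= 1.
Proof.
elim=> [c|i j u g' _ _ _ u01 _ IH c]; first by rewrite ler01 lexx.
have /andP[a b] := u01 (r (c i) (c j)); have /andP[a' b'] := IH c.
by rewrite mulr_ge0//= mulr_ile1.
Qed.

Lemma weight_le n m g : (n <= m)%N -> weight n g -> weight m g.
Proof.
move=> nm; elim=> [|i j u g' hi hj uc u01 _ IH]; first exact: weight1.
by apply: weightM => //; lia.
Qed.

Lemma weight_mul n g h : weight n g -> weight n h -> weight n (fun c => g c * h c).
Proof.
move=> + hh; elim=> [|i j u g' hi hj uc u01 _ IH].
  by rewrite (_ : (fun c => _) = h)//; apply/funext => c; rewrite mul1r.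
rewrite (_ : (fun c => _) = fun c => u (r (c i) (c j)) * (g' c * h c)).
  exact: weightM.
by apply/funext => c; rewrite mulrA.
Qed.

Lemma weight_ov n i j (u : R * R -> R) : (0 < i <= n)%N -> (0 < j <= n)%N ->
    continuous u -> (forall x, 0 <= u x <= 1) ->
  weight n (fun c => u (r (c i) (c j))).
Proof.
move=> hi hj uc u01.
rewrite (_ : (fun c => _) = fun c => u (r (c i) (c j)) * 1).
  by apply: weightM => //; exact: weight1.
by apply/funext => c; rewrite mulr1.
Qed.

Lemma weight_sw n i j g : (0 < i <= n)%N -> (0 < j <= n)%N -> weight n g ->
  weight n (g \o sw i j).
Proof.
move=> hi hj; elim=> [|k l u g' hk hl uc u01 _ IH]; first exact: weight1.
have h m : (0 < m <= n)%N -> (0 < (if m == i then j else if m == j then i else m) <= n)%N.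
  by case: ifP => // _; case: ifP.
exact: (weightM (h k hk) (h l hl)).
Qed.

Lemma weight_loc n g : weight n g -> forall c c' : cfg,
  (forall k, (0 < k <= n)%N -> c k = c' k) -> g c = g c'.
Proof.
elim=> [//|i j u g' hi hj _ _ _ IH] c c' cc'.
by rewrite (cc' i)// (cc' j)// (IH c c').
Qed.

(** The two shapes used later: cutoffs of [R_1], [R_2] and [R_1 + R_2] for ultrametricity, and
    products of one cutoff per coordinate for the corner regions of the plane. *)
Definition gg_test (M : nat) (phi : R * R -> R) : Prop :=
  exists u v : R -> R, [/\ lip M u, lip M v &
    phi = (fun x => u x.1 * v x.2) \/ phi = (fun x => u (x.1 + x.2))].

Definition comb (l : R * R -> R) : Prop :=
  [\/ l = fst, l = snd | l = (fun x => x.1 + x.2)].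

Lemma comb_continuous l : comb l -> continuous l.
Proof.
case=> ->.
- by move=> x; exact: cvg_fst.
- by move=> x; exact: cvg_snd.
- by move=> x; apply: cvgD; [exact: cvg_fst|exact: cvg_snd].
Qed.

Lemma comb_test M u l : comb l -> lip M u -> gg_test M (u \o l).
Proof.
case=> -> ul.
- exists u, (fun=> 1); split => //; first exact: lip1.
  by left; apply/funext => x; rewrite /= mulr1.
- exists (fun=> 1), u; split => //; first exact: lip1.
  by left; apply/funext => x; rewrite /= mul1r.
- by exists u, u; split => //; right.
Qed.

Variable E : (cfg -> R) -> R.

(** Defect in the Ghirlanda-Guerra identity: given [n] replicas, the overlap of replica 1 with a
    fresh one should be a mixture, with equal weights, of an independent overlap and of the [n - 1]
    overlaps of replica 1 already present. *)
Definition gerr n (g : cfg -> R) (phi : R * R -> R) : R :=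
  E (fun c => g c * phi (r (c 1) (c n.+1)))
  - n%:R^-1 * E g * E (fun c => phi (r (c 1) (c 2)))
  - n%:R^-1 * \sum_(2 <= l < n.+1) E (fun c => g c * phi (r (c 1) (c l))).

Definition GG (M : nat) := forall n g phi, (0 < n < M)%N -> weight n g ->
  gg_test M phi -> `|gerr n g phi| <= M%:R^-1.

(** Powers are unbounded on the plane; the square here contains every pair of overlaps. *)
Definition box_bounded (u : R * R -> R) := exists B : R,
  forall x : R * R, `|x.1| <= 1 -> `|x.2| <= 1 -> `|u x| <= B.

(** The interface through which the combinatorial part sees the random measure: a positive
    normalised functional [E], linear on a class [bm] and invariant under transpositions of the
    replicas 1 to [N]. The last two fields expand [|t z + sum x - sum y|^2 >= 0] in each Hilbert
    space. *)
Record replicas (N : nat) (bm : (cfg -> R) -> Prop) : Prop := Replicas {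
  bm_cst : forall a, bm (fun=> a);
  bmD : forall g h, bm g -> bm h -> bm (fun c => g c + h c);
  bmM : forall g h, bm g -> bm h -> bm (fun c => g c * h c);
  bm_ov : forall u i j, continuous u -> box_bounded u ->
    bm (fun c => u (r (c i) (c j)));
  bm_sw : forall g i j, bm g -> bm (g \o sw i j);
  E_cst : forall a, E (fun=> a) = a;
  ED : forall g h, bm g -> bm h -> E (fun c => g c + h c) = E g + E h;
  EZ : forall a g, bm g -> E (fun c => a * g c) = a * E g;
  E_le : forall g h, bm g -> bm h -> (forall c, g c <= h c) -> E g <= E h;
  E_sw : forall g i j, bm g -> (0 < i <= N)%N -> (0 < j <= N)%N ->
    E (g \o sw i j) = E g;
  r_sym : forall x y, r x y = r y x;
  r_bnd : forall x y, `|(r x y).1| <= 1 /\ `|(r x y).2| <= 1;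
  r_psd1 : forall m (z : X) (x y : nat -> X) (t : R),
    let p a b := (r a b).1 in
    0 <= t ^+ 2 * p z z + 2 * t * \sum_(i < m) (p z (x i) - p z (y i))
       + (\sum_(i < m) \sum_(j < m) p (x i) (x j)
       + \sum_(i < m) \sum_(j < m) p (y i) (y j)
       - 2 * \sum_(i < m) \sum_(j < m) p (x i) (y j));
  r_psd2 : forall m (z : X) (x y : nat -> X) (t : R),
    let p a b := (r a b).2 in
    0 <= t ^+ 2 * p z z + 2 * t * \sum_(i < m) (p z (x i) - p z (y i))
       + (\sum_(i < m) \sum_(j < m) p (x i) (x j)
       + \sum_(i < m) \sum_(j < m) p (y i) (y j)
       - 2 * \sum_(i < m) \sum_(j < m) p (x i) (y j))
}.

End Weights.

(** * Calculus with the expectation functional *)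

Section Consequences.
Variables (R : realType) (X : Type) (r : X -> X -> R * R).
Local Notation cfg := (nat -> X).
Variables (E : (cfg -> R) -> R) (N : nat) (bm : (cfg -> R) -> Prop).
Hypothesis S : replicas r E N bm.

Lemma unit_box (u : R * R -> R) : (forall x, 0 <= u x <= 1) -> box_bounded u.
Proof. by move=> h; exists 1 => x _ _; rewrite ler_norml; have := h x; lra. Qed.

Lemma weight_bm n g : weight r n g -> bm g.
Proof.
elim=> [|i j u g' hi hj uc u01 _ IH]; first exact: (bm_cst S).
by apply: (bmM S) => //; apply: (bm_ov S) => //; exact: unit_box.
Qed.

Lemma bm_sum I (s : seq I) (F : I -> cfg -> R) : (forall i, bm (F i)) ->
  bm (fun c => \sum_(i <- s) F i c).
Proof.
move=> bF; elim: s => [|i s IH].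
  by under eq_fun do rewrite big_nil; exact: (bm_cst S).
by under eq_fun do rewrite big_cons; exact: (bmD S).
Qed.

Lemma bm_prod I (s : seq I) (F : I -> cfg -> R) : (forall i, bm (F i)) ->
  bm (fun c => \prod_(i <- s) F i c).
Proof.
move=> bF; elim: s => [|i s IH].
  by under eq_fun do rewrite big_nil; exact: (bm_cst S).
by under eq_fun do rewrite big_cons; exact: (bmM S).
Qed.

Lemma bmN g : bm g -> bm (fun c => - g c).
Proof.
move=> bg; rewrite (_ : (fun c => _) = fun c => -1 * g c).
  by apply: (bmM S) => //; exact: (bm_cst S).
by apply/funext => c; rewrite mulN1r.
Qed.

Lemma bmB g h : bm g -> bm h -> bm (fun c => g c - h c).
Proof. by move=> bg bh; apply: (bmD S) => //; exact: bmN. Qed.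

Lemma E_sum I (s : seq I) (F : I -> cfg -> R) : (forall i, bm (F i)) ->
  E (fun c => \sum_(i <- s) F i c) = \sum_(i <- s) E (F i).
Proof.
move=> bF; elim: s => [|i s IH].
  by rewrite big_nil; under eq_fun do rewrite big_nil; exact: (E_cst S).
rewrite big_cons -IH -(ED S)//; last exact: bm_sum.
by under eq_fun do rewrite big_cons.
Qed.

Lemma E_ge0 g : bm g -> (forall c, 0 <= g c) -> 0 <= E g.
Proof.
move=> bg g0; rewrite -(E_cst S 0); apply: (E_le S) => //; exact: (bm_cst S).
Qed.

Lemma E_le1 g : bm g -> (forall c, g c <= 1) -> E g <= 1.
Proof.
move=> bg g0; rewrite -(E_cst S 1); apply: (E_le S) => //; exact: (bm_cst S).
Qed.

Lemma E_gt0_witness g : bm g -> (forall c, 0 <= g c) -> 0 < E g ->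
  exists c, g c != 0.
Proof.
move=> bg g0 Eg; apply/not_existsP => h; move: Eg; rewrite ltNge => /negP; apply.
rewrite -(E_cst S 0); apply: (E_le S) => //; first exact: (bm_cst S).
by move=> c; have /negP := h c; rewrite negbK => /eqP ->.
Qed.

Lemma comb_bnd l x y : comb l -> `|l (r x y)| <= 2.
Proof.
have [a b] := r_bnd S x y.
by case=> -> /=; move: a b; rewrite !ler_norml; lra.
Qed.

Lemma comb_psd l : comb l -> forall m (z : X) (x y : nat -> X) (t : R),
    let p a b := l (r a b) in
    0 <= t ^+ 2 * p z z + 2 * t * \sum_(i < m) (p z (x i) - p z (y i))
       + (\sum_(i < m) \sum_(j < m) p (x i) (x j)
       + \sum_(i < m) \sum_(j < m) p (y i) (y j)
       - 2 * \sum_(i < m) \sum_(j < m) p (x i) (y j)).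
Proof.
case=> -> m z x y t; [exact: (r_psd1 S)|exact: (r_psd2 S)|].
have := r_psd1 S m z x y t; have := r_psd2 S m z x y t => /=.
have e (a b : nat -> X) : \sum_(i < m) \sum_(j < m) ((r (a i) (b j)).1 + (r (a i) (b j)).2)
  = \sum_(i < m) \sum_(j < m) (r (a i) (b j)).1 + \sum_(i < m) \sum_(j < m) (r (a i) (b j)).2.
  by rewrite -big_split/=; apply: eq_bigr => i _; rewrite -big_split.
rewrite !e => h1 h2.
have -> : \sum_(i < m) ((r z (x i)).1 + (r z (x i)).2 - ((r z (y i)).1 + (r z (y i)).2)) =
  \sum_(i < m) ((r z (x i)).1 - (r z (y i)).1) + \sum_(i < m) ((r z (x i)).2 - (r z (y i)).2).
  by rewrite -big_split/=; apply: eq_bigr => i _; ring.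
lra.
Qed.

End Consequences.

(** * Duplication *)

Section Duplication.
Variable R : realType.

Lemma harmonic_unbounded (B : R) : exists K, B <= \sum_(k < K) k.+1%:R^-1.
Proof.
apply/not_existsP => h; apply: (@dvg_harmonic R).
apply: nondecreasing_is_cvgn.
  by apply/nondecreasing_seqP => n; rewrite /series/= big_nat_recr//= lerDl invr_ge0.
exists B => _ [n _ <-]; rewrite /series/= big_mkord.
by have /negP := h n; rewrite -ltNge => /ltW.
Qed.

Definition gg_system (X : Type) (r : X -> X -> R * R) (E : ((nat -> X) -> R) -> R)
    (M : nat) := exists2 bm, replicas r E M bm & GG r E M.

(** Union bound for [0, 1]-valued weights: if all [p i] hold, then either no [b i] holds or some
    index has both. In use, [p i] says that a fresh replica has small overlap with replica 1, and
    [b i] that it plays the role of replica 1. *)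
Lemma prod_le_prod1B (k : nat) (p b : nat -> R) :
  (forall i, 0 <= p i <= 1) -> (forall i, 0 <= b i <= 1) ->
  \prod_(i < k) p i <= \prod_(i < k) (1 - b i) + \sum_(i < k) p i * b i.
Proof.
move=> p01 b01; elim: k => [|k IH]; first by rewrite !big_ord0 addr0.
rewrite !big_ord_recr/=; move: IH.
have P1 : 0 <= \prod_(i < k) (1 - b i) <= 1.
  apply/andP; split; first by apply: prodr_ge0 => i _; have := b01 i; lra.
  by apply: prodr_ile1 => i _; have := b01 i; lra.
have S0 : 0 <= \sum_(i < k) p i * b i.
  by apply: sumr_ge0 => i _; have := b01 i; have := p01 i; nra.
set P := \prod_(i < k) (1 - b i) in P1 *; set Q := \prod_(i < k) p i.
set s := \sum_(i < k) p i * b i in S0 *.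
move: (p01 k) (b01 k) P1 S0; move: (p k) (b k) P Q s => x y P Q s.
move=> /andP[x0 x1] /andP[y0 y1] /andP[P0 P1] s0 QPs.
have h1 : Q * x <= (P + s) * x by rewrite ler_wpM2r.
have h2 : s * x <= s by rewrite ler_piMr.
have h3 : 0 <= P * ((1 - x) * (1 - y)) by rewrite mulr_ge0// mulr_ge0// subr_ge0.
have h4 : 0 <= (1 - P) * (x * y) by rewrite mulr_ge0 ?mulr_ge0// subr_ge0.
by rewrite mulrDl in h1; lra.
Qed.

Lemma telescope_first_hit (K : nat) (b : nat -> R) :
  \sum_(k < K) b k * \prod_(i < k) (1 - b i) = 1 - \prod_(i < K) (1 - b i).
Proof.
elim: K => [|K IH]; first by rewrite !big_ord0 subrr.
by rewrite !big_ord_recr/= IH; ring.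
Qed.

Section Step.
Variables (X : Type) (r : X -> X -> R * R) (E : ((nat -> X) -> R) -> R).
Variables (M : nat) (bm : ((nat -> X) -> R) -> Prop).
Hypotheses (S : replicas r E M bm) (G : GG r E M).
Variables (n K : nat) (w C : R) (W : (nat -> X) -> R) (l : R * R -> R).
Hypotheses (n1 : (1 < n)%N) (K0 : (0 < K)%N) (w0 : 0 < w).
Hypotheses (nKM : (n + K < M)%N) (KM : K%:R / w <= M%:R).
Hypotheses (wW : weight r n W) (cl : comb l).
Hypothesis WC : forall c, W c != 0 ->
  forall k, (1 < k <= n)%N -> l (r (c 1%N) (c k)) <= C.

(** The margin [w] is shared among the [K] nested cutoffs, so that the last one still vanishes from
    [C + w] on. *)
Let v := w / K%:R.
Let v0 : 0 < v. Proof. by rewrite divr_gt0// ltr0n. Qed.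
(* [psi k] equals 1 wherever [psi i] does not vanish for some [i < k], so that
   applying the identities to [T k] and [psi k] gives back [T k] and no square. *)
Let psi i := ramp v (C + i.+1%:R * v).
Let ov (c : nat -> X) k := l (r (c 1%N) (c k)).
(** [hit i] says that replica [n + i] can stand in for replica 1 in [W], and [hit 0] that replica 1
    itself does. With this numbering the transposition of 1 and [n + k] exchanges [hit 0] and
    [hit k]. *)
Let hit i (c : nat -> X) := if i is i'.+1 then W (sw 1 (n + i'.+1) c) else W c.
Let T k c := W c * \prod_(i < k) psi i (ov c (n + i.+1)).
Let W' c := W c * (W (sw 1 n.+1 c) * psi K.-1 (ov c n.+1)).

Let psi_lip i : lip M (psi i).
Proof. by apply: ramp_is_lip => //; rewrite /v invfM invrK mulrC. Qed.

Let psiov_cont i : continuous (psi i \o l).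
Proof.
move=> x; apply: continuous_comp; first exact: comb_continuous.
exact: (lip_continuous (psi_lip i)).
Qed.

Let weight_psi m i a b : (0 < a <= m)%N -> (0 < b <= m)%N ->
  weight r m (fun c => psi i (l (r (c a) (c b)))).
Proof.
move=> ha hb; apply: (weight_ov r ha hb (@psiov_cont i)) => x; exact: ramp01.
Qed.

Let weight_T k : weight r (n + k) (T k).
Proof.
elim: k => [|k IH].
  rewrite /T; under eq_fun do rewrite big_ord0 mulr1.
  by rewrite addn0.
rewrite /T; under eq_fun do rewrite big_ord_recr/= mulrA.
apply: weight_mul; first by apply: weight_le IH; lia.
by apply: weight_psi; lia.
Qed.

Let weight_hit i m : (n + i <= m)%N -> weight r m (hit i).
Proof.
case: i => [|i] h /=; first by apply: weight_le wW; lia.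
by apply: (@weight_sw _ _ _ m 1 (n + i.+1) W); [lia|lia|apply: weight_le wW; lia].
Qed.

Let hit01 i c : 0 <= hit i c <= 1.
Proof. exact: (weight01 (weight_hit (leqnn _))). Qed.

Let bm_hit i : bm (hit i). Proof. exact: (weight_bm S (weight_hit (leqnn _))). Qed.

(** In the identity for [n + k] replicas, each of the [n + k - 1] old overlaps returns all of
    [E (T k)], since [psi k] is 1 on the support of [T k]. The product term is nonnegative and is
    dropped. *)
Let T_rec k : (k < K)%N ->
  (n + k).-1%:R / (n + k)%:R * E (T k) - M%:R^-1 <= E (T k.+1).
Proof.
move=> kK.
have := @G (n + k)%N (T k) (psi k \o l) _ (weight_T k) (comb_test cl (psi_lip k)).
move/(_ ltac:(lia)); rewrite /gerr ler_norml => /andP[+ _].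
rewrite (_ : (fun c => T k c * _) = T k.+1); last first.
  by apply/funext => c; rewrite /T big_ord_recr/= mulrA addnS.
have -> : \sum_(2 <= i < (n + k).+1) E (fun c => T k c * (psi k \o l) (r (c 1%N) (c i)))
   = (n + k).-1%:R * E (T k).
  rewrite (eq_big_nat _ _ (F2 := fun=> E (T k))); last first.
    move=> i /andP[i2 ink]; congr E; apply/funext => c.
    have [->|] := eqVneq (T k c) 0; first by rewrite mul0r.
    rewrite mulf_eq0 negb_or => /andP[Wc /prodf_neq0 pc].
    rewrite /= /psi (@ramp_eq1 _ v) ?mulr1// mulrSr mulrDl mul1r addrA addrK.
    have [ile|nlt] := leqP i n.
      apply: le_trans (WC Wc _) _; first by rewrite i2.
      by rewrite lerDl mulr_ge0// ltW.
    have ik : (i - n.+1 < k)%N by lia.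
    have := pc (Ordinal ik) isT => /= /(ramp_neq0 v0) /ltW.
    rewrite /ov (_ : (n + (i - n.+1).+1 = i)%N); last by lia.
    move/le_trans; apply; rewrite lerD2l ler_pM2r// ler_nat; lia.
  by rewrite sumr_const_nat mulr_natl; congr (_ *+ _); lia.
have p0 : 0 <= (n + k)%:R^-1 * E (T k) * E (fun c => (psi k \o l) (r (c 1%N) (c 2%N))).
  rewrite mulr_ge0// ?mulr_ge0 ?invr_ge0//.
    apply: (E_ge0 S); first exact: (weight_bm S (weight_T k)).
    by move=> c; have /andP[] := weight01 (weight_T k) c.
  have wp : weight r 2 (fun c => psi k (l (r (c 1%N) (c 2%N)))) by apply: weight_psi.
  apply: (E_ge0 S); first exact: (weight_bm S wp).
  by move=> c; have /andP[] := weight01 wp c.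
move: p0; set A := _ * _ * E _; set B := E (T k); set D := E (T k.+1).
by rewrite (_ : _^-1 * _ = (n + k).-1%:R / (n + k)%:R * B); [lra|ring].
Qed.

(** The factors [(n + j - 1) / (n + j)] telescope to [(n - 1) / (n + k - 1)], which is at least
    [1 / (k + 1)] because [n >= 2]. Since they are at most 1, the errors merely add up. *)
Let T_lower kappa k : 0 <= kappa -> kappa <= E W -> (k <= K)%N ->
  kappa * k.+1%:R^-1 - k%:R * M%:R^-1 <= E (T k).
Proof.
move=> k0 kW kK.
have e1 m : (n + m).-1 = (n.-1 + m)%N by clear -n1; lia.
have e2 m : (n + m)%N = (n.-1 + m.+1)%N by clear -n1; lia.
have e3 m : (n.-1 + m)%:R != 0 :> R by rewrite pnatr_eq0; clear -n1; lia.
suff : kappa * (n.-1%:R / (n.-1 + k)%:R) - k%:R * M%:R^-1 <= E (T k).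
  apply: le_trans; rewrite lerD2r ler_wpM2l//.
  rewrite ler_pdivlMr ?ltr0n; last by lia.
  rewrite ler_pdivrMl ?ltr0n// -natrM ler_nat; nia.
elim: k kK => [|k IH] kK.
  rewrite addn0 divff ?pnatr_eq0; last by lia.
  rewrite mulr1 mul0r subr0 /T; under [X in E X]eq_fun do rewrite big_ord0 mulr1.
  exact: kW.
apply: le_trans (T_rec kK); have {}IH := IH (ltnW kK).
have M0 : 0 <= M%:R^-1 :> R by rewrite invr_ge0.
set q : R := (n + k).-1%:R / (n + k)%:R.
have q1 : 0 <= q <= 1.
  rewrite /q divr_ge0//= ler_pdivrMr ?ltr0n ?mul1r ?ler_nat; lia.
have h1 : q * (kappa * (n.-1%:R / (n.-1 + k)%:R) - k%:R / M%:R) <= q * E (T k).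
  by rewrite ler_wpM2l//; have /andP[] := q1.
have h2 : q * (kappa * (n.-1%:R / (n.-1 + k)%:R)) = kappa * (n.-1%:R / (n.-1 + k.+1)%:R).
  rewrite /q e1 e2; move: (e3 k) (e3 k.+1).
  move: (n.-1 + k)%:R (n.-1 + k.+1)%:R (n.-1%:R) => a b d a0 b0.
  by field; rewrite a0 b0.
have h3 : q * (k%:R / M%:R) <= k%:R / M%:R.
  by rewrite ler_piMl ?mulr_ge0//; have /andP[] := q1.
rewrite mulrBr h2 in h1.
by rewrite (mulrSr _ k) mulrDl mul1r; lra.
Qed.

Let weight_W' : weight r n.+1 W'.
Proof.
apply: weight_mul; first exact: weight_le (leqnSn n) wW.
apply: weight_mul; last by apply: weight_psi; lia.
apply: weight_sw; [lia|lia|exact: weight_le (leqnSn n) wW].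
Qed.

(** By exchangeability the fresh replica [n + i.+1] may be taken to be [n.+1], and the widest cutoff
    [psi K.-1] dominates all the others. *)
Let hit_psi_le i : (i < K)%N ->
  E (fun c => W c * (psi i (ov c (n + i.+1)) * hit i.+1 c)) <= E W'.
Proof.
move=> iK; have bmW' := weight_bm S weight_W'.
rewrite -(E_sw S (i := n.+1) (j := n + i.+1) bmW'); [|lia|lia].
apply: (E_le S).
- apply: (bmM S); first exact: (weight_bm S wW).
  apply: (bmM S); last exact: bm_hit.
  have wp : weight r (n + i.+1) (fun c => psi i (ov c (n + i.+1))).
    by apply: weight_psi; lia.
  exact: (weight_bm S wp).
- exact: (bm_sw S).
move=> c /=; rewrite /W'.
have -> : W (sw n.+1 (n + i.+1) c) = W c.
  by apply: (weight_loc wW) => k hk; rewrite swE//; lia.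
have -> : W (sw 1 n.+1 (sw n.+1 (n + i.+1) c)) = hit i.+1 c.
  apply: (weight_loc wW) => k hk.
  have [->|k1] := eqVneq k 1%N; first by rewrite !swE1.
  by rewrite !swE//; lia.
have W0 : 0 <= W c by have /andP[] := weight01 wW c.
rewrite ler_wpM2l// mulrC ler_wpM2l//; first by have /andP[] := hit01 i.+1 c.
rewrite /ov swE1 swE; [|lia|lia].
by apply: ramp_le => //; rewrite lerD2l ler_pM2r// ler_nat; lia.
Qed.

Let bm_prod_hit (f : nat -> nat) k :
  bm (fun c => \prod_(i < k) (1 - hit (f i) c)).
Proof.
apply: (bm_prod S) => i; apply: (bmB S) => //; exact: (bm_cst S).
Qed.

(** Transposing 1 and [n + k] exchanges [hit 0] with [hit k] and fixes [hit 1] to [hit k.-1]: having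
    no hit among [k] fresh replicas becomes having the first hit at index [k]. *)
Let first_hit_sw k : (k < K)%N ->
  E (fun c => W c * \prod_(i < k) (1 - hit i.+1 c)) =
  E (fun c => hit k c * \prod_(i < k) (1 - hit i c)).
Proof.
case: k => [|k] kK; first by congr E; apply/funext => c; rewrite !big_ord0.
rewrite -(E_sw S (i := 1) (j := n + k.+1)); first last.
- by lia.
- by lia.
- by apply: (bmM S); [exact: (weight_bm S wW)|exact: (bm_prod_hit succn)].
congr E; apply/funext => c /=; congr (_ * _).
rewrite big_ord_recr big_ord_recl/= mulrC; congr (_ * _).
  by rewrite swK.
apply: eq_bigr => i _; rewrite /bump/=; congr (1 - _).
apply: (weight_loc wW) => m hm.
have ik := ltn_ord i.
have [->|m1] := eqVneq m 1%N; last by rewrite !swE//; lia.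
by rewrite !swE1 swE//; lia.
Qed.

Lemma duplicate_step kappa : 0 < kappa -> kappa <= E W ->
  2 <= kappa * \sum_(k < K) k.+1%:R^-1 -> 2 * K%:R ^+ 2 <= M%:R :> R ->
  exists W'', [/\ weight r n.+1 W'', (2 * K%:R ^+ 2)^-1 <= E W'' &
   forall c, W'' c != 0 -> [/\ W c != 0, W (sw 1 n.+1 c) != 0 &
      l (r (c 1%N) (c n.+1)) <= C + w]].
Proof.
move=> kappa0 kW Hh HM; exists W'; split; first exact: weight_W'; last first.
  move=> c; rewrite /W' !mulf_eq0 !negb_or => /and3P[-> -> /(ramp_neq0 v0) /ltW h].
  split => //; apply: le_trans h _; rewrite lerD2l prednK// /v mulrCA divff ?mulr1//.
  by rewrite pnatr_eq0 -lt0n.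
have K2 : 0 < K%:R :> R by rewrite ltr0n.
have step k : (k < K)%N -> E (T k) <=
    E (fun c => hit k c * \prod_(i < k) (1 - hit i c)) + K%:R * E W'.
  move=> kK; rewrite -first_hit_sw//.
  have bm1 : bm (fun c => W c * \prod_(i < k) (1 - hit i.+1 c)).
    by apply: (bmM S); [exact: (weight_bm S wW)|exact: (bm_prod_hit succn)].
  have bm2 (i : nat) : bm (fun c => W c * (psi i (ov c (n + i.+1)) * hit i.+1 c)).
    apply: (bmM S); first exact: (weight_bm S wW).
    apply: (bmM S); last exact: bm_hit.
    have wp : weight r (n + i.+1) (fun c => psi i (ov c (n + i.+1))).
      by apply: weight_psi; lia.
    exact: (weight_bm S wp).
  have bm3 := bm_sum S (index_enum 'I_k) (fun i : 'I_k => bm2 i).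
  apply: (@le_trans _ _ (E (fun c => W c * \prod_(i < k) (1 - hit i.+1 c) +
     \sum_(i < k) W c * (psi i (ov c (n + i.+1)) * hit i.+1 c)))).
    apply: (E_le S); first exact: (weight_bm S (weight_T k)).
      exact: (bmD S).
    move=> c; rewrite /T -mulr_sumr -mulrDr ler_wpM2l//.
      by have /andP[] := weight01 wW c.
    apply: (prod_le_prod1B k (p := fun i => psi i (ov c (n + i.+1)))
      (b := fun i => hit i.+1 c)) => i; [exact: ramp01|exact: hit01].
  rewrite (ED S)// lerD2l (E_sum S)//.
  have W'0 : 0 <= E W'.
    apply: (E_ge0 S); first exact: (weight_bm S weight_W').
    by move=> c; have /andP[] := weight01 weight_W' c.
  apply: (@le_trans _ _ (\sum_(i < k) E W')).
    by apply: ler_sum => i _; apply: hit_psi_le; apply: ltn_trans kK.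
  rewrite sumr_const card_ord -[_ *+ _]mulr_natl ler_wpM2r// ler_nat; lia.
(* The sum of the [E (T k)] is at least 2 - 1/2. The first-hit terms account for at most 1 of it,
   which leaves [1/2 <= K ^ 2 * E W']. *)
have low : kappa * \sum_(k < K) k.+1%:R^-1 - K%:R ^+ 2 / M%:R <= \sum_(k < K) E (T k).
  rewrite mulr_sumr.
  have -> : K%:R ^+ 2 / M%:R = \sum_(k < K) K%:R / M%:R :> R.
    by rewrite sumr_const card_ord -[_ *+ _]mulr_natl; ring.
  rewrite -sumrB; apply: ler_sum => k _.
  apply: le_trans (T_lower (ltW kappa0) kW (ltnW (ltn_ord k))).
  by rewrite lerD2l lerN2 ler_wpM2r ?invr_ge0// ler_nat ltnW.
have up : \sum_(k < K) E (T k) <= 1 + K%:R ^+ 2 * E W'.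
  apply: le_trans; first by apply: ler_sum => k _; exact: step (ltn_ord k).
  rewrite big_split/= sumr_const card_ord -[_ *+ _]mulr_natl mulrA -expr2 lerD2r.
  have bmk (k : 'I_K) : bm (fun c => hit k c * \prod_(i < k) (1 - hit i c)).
    by apply: (bmM S) => //; exact: (bm_prod_hit id).
  rewrite -(E_sum S)//; apply: (E_le1 S); first exact: (bm_sum S).
  move=> c; rewrite (telescope_first_hit K (fun i => hit i c)) lerBlDr lerDl.
  by apply: prodr_ge0 => i _; have := hit01 i c; lra.
have hM : K%:R ^+ 2 / M%:R <= 2^-1 :> R.
  have M0 : 0 < M%:R :> R by rewrite ltr0n; lia.
  by rewrite ler_pdivrMr//; lra.
rewrite -div1r ler_pdivrMr ?mulr_gt0 ?exprn_gt0//.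
lra.
Qed.

End Step.

Lemma duplicate (kappa w : R) n : 0 < kappa -> 0 < w -> (1 < n)%N ->
  exists M0 : nat, exists2 q : R, 0 < q & forall X r E M,
  (M0 <= M)%N -> @gg_system X r E M -> forall W l C, weight r n W -> kappa <= E W ->
  comb l -> (forall c, W c != 0 ->
    forall k, (1 < k <= n)%N -> l (r (c 1%N) (c k)) <= C) ->
  exists W', [/\ weight r n.+1 W', q <= E W' & forall c, W' c != 0 ->
    [/\ W c != 0, W (sw 1 n.+1 c) != 0 & l (r (c 1%N) (c n.+1)) <= C + w]].
Proof.
move=> kappa0 w0 n1; have [K HK] := harmonic_unbounded (2 / kappa).
have K0 : (0 < K)%N.
  rewrite lt0n; apply: contraTneq HK => ->; rewrite big_ord0 -ltNge.
  exact: divr_gt0.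
(* The summands serve in turn [n + K < M], the error bound [2 * K ^ 2 <= M], and the Lipschitz
   constant [K / w] of the cutoffs. *)
exists (n + K + 1 + 2 * K ^ 2 + Num.bound (K%:R / w))%N, (2 * K%:R ^+ 2)^-1.
  by rewrite invr_gt0 mulr_gt0// exprn_gt0// ltr0n.
move=> X r E M hM [bm S G] W l C wW kW cl WC.
have bnd : K%:R / w <= (Num.bound (K%:R / w))%:R.
  by apply/ltW/archi_boundP; rewrite divr_ge0// ltW.
apply: (duplicate_step S G n1 K0 w0 _ _ wW cl WC kappa0 kW).
- by lia.
- by apply: le_trans bnd _; rewrite ler_nat; lia.
- by rewrite mulrC -ler_pdivrMr.
- by rewrite -natrX -natrM ler_nat; lia.
Qed.

End Duplication.

(** * Ultrametricity *)

Section Clusters.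
Variable R : realType.

(** Replica 1 together with its [m] copies, which are numbered after the [n] original replicas. *)
Definition in_cluster (n m p : nat) := (p == 1%N) || (n < p <= n + m)%N.

Lemma in_clusterS n m p :
  in_cluster n m.+1 p -> in_cluster n m p \/ p = (n + m).+1.
Proof. by rewrite /in_cluster; case: eqP => //= _; [left|lia]. Qed.

Lemma in_cluster_neq n m p : (1 < n)%N -> in_cluster n m p -> p != (n + m).+1.
Proof. by rewrite /in_cluster; lia. Qed.

(** The width is quantified inside the induction: [w / 2] is spent on the first [m] copies and
    [w / 2] on the last one. The overlap bound that [duplicate] requires persists, because a member
    of the cluster inherits from [W] its overlaps with the original replicas and from the previous
    weight those with the earlier copies. *)
Lemma cluster_extension m : forall (kappa w : R) n, 0 < kappa -> 0 < w -> (1 < n)%N ->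
  exists M0 : nat, exists2 q : R, 0 < q & forall X r E M,
  (M0 <= M)%N -> @gg_system R X r E M ->
  forall W l C, weight r n W -> kappa <= E W ->
  comb l -> (forall c, W c != 0 ->
    forall k, (1 < k <= n)%N -> l (r (c 1%N) (c k)) <= C) ->
  exists W', [/\ weight r (n + m) W', q <= E W' & forall c, W' c != 0 ->
    (forall p : nat, in_cluster n m p -> W (sw 1 p c) != 0) /\
    (forall p p' : nat, in_cluster n m p -> in_cluster n m p' -> p != p' ->
      l (r (c p) (c p')) <= C + w)].
Proof.
elim: m => [|m IH] kappa w n kappa0 w0 n1.
  exists 0%N, kappa => // X r E M _ _ W l C wW kW cl WC.
  exists W; rewrite addn0; split => // c Wc.
  have one p : in_cluster n 0 p -> p = 1%N.
    by rewrite /in_cluster addn0 => /orP[/eqP//|]; lia.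
  split=> [p /one ->|p p' /one -> /one ->]; last by rewrite eqxx.
  by rewrite swii.
have w20 : 0 < w / 2 by rewrite divr_gt0.
have [M1 [q1 q10 H1]] := IH kappa (w / 2) n kappa0 w20 n1.
have [|M2 [q2 q20 H2]] := @duplicate R q1 (w / 2) (n + m) q10 w20.
  by rewrite ltn_addr.
exists (maxn M1 M2), q2 => // X r E M; rewrite geq_max => /andP[M1M M2M] sys.
move=> W l C wW kW cl WC.
have [W1 [wW1 kW1 W1c]] := H1 X r E M M1M sys W l C wW kW cl WC.
have [|W2 [wW2 kW2 W2c]] := H2 X r E M M2M sys W1 l (C + w / 2) wW1 kW1 cl.
  move=> c /W1c [h1 h2] k /andP[k1 knm].
  have [kn|nk] := leqP k n.
    have := WC _ (h1 1%N isT); rewrite swii => /(_ k).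
    by rewrite k1 kn => /(_ isT); lra.
  by apply: h2; rewrite /in_cluster ?eqxx//=; lia.
exists W2; rewrite addnS; split => // c /W2c [W1a W1b rn].
have [h1 h2] := W1c _ W1a; have [h3 h4] := W1c _ W1b.
have cas p := @in_clusterS n m p.
split=> [p /cas[/h1//|->]|p p' /cas pc /cas p'c pp'].
  by have := h3 1%N isT; rewrite swii.
case: sys => bm S _.
have new a : in_cluster n m a -> l (r (c a) (c (n + m).+1)) <= C + w.
  move=> ha; have [->|a1] := eqVneq a 1%N; first by apply: le_trans rn _; lra.
  have an := in_cluster_neq n1 ha.
  have := h4 a 1%N ha isT a1; rewrite swE1 swE// (r_sym S); lra.
case: pc p'c pp' => [hp|->] [hp'|->] pp'.
- by have := h2 p p' hp hp' pp'; lra.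
- exact: new.
- by rewrite (r_sym S); exact: new.
- by move: pp'; rewrite eqxx.
Qed.

(* The barycentres of the clusters [x] and [y] are close, so the point [z]
   cannot see them at overlaps differing by [eta]. *)
Lemma barycentre_absurd (X : Type) (p : X -> X -> R) m (z : X) (x y : nat -> X)
    (a b d eta tau : R) :
  (forall t, 0 <= t ^+ 2 * p z z + 2 * t * \sum_(i < m) (p z (x i) - p z (y i))
       + (\sum_(i < m) \sum_(j < m) p (x i) (x j)
       + \sum_(i < m) \sum_(j < m) p (y i) (y j)
       - 2 * \sum_(i < m) \sum_(j < m) p (x i) (y j))) ->
  (forall u v, `|p u v| <= 2) ->
  0 < eta <= 1 -> 0 < tau -> 56 * tau <= eta ^+ 2 -> 64 < m%:R * eta ^+ 2 ->
  `|d| <= 3 -> a < b - eta ->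
  (forall i, (i < m)%N -> p z (x i) <= a + tau) ->
  (forall i, (i < m)%N -> b - tau <= p z (y i)) ->
  (forall i j, (i < m)%N -> (j < m)%N -> i != j -> p (x i) (x j) <= d + 2 * tau) ->
  (forall i j, (i < m)%N -> (j < m)%N -> i != j -> p (y i) (y j) <= d + 2 * tau) ->
  (forall i j, (i < m)%N -> (j < m)%N -> d - tau <= p (x i) (y j)) ->
  False.
Proof.
move=> psd p2 /andP[eta0 eta1] tau0 taue me d3 ab zx zy xx yy xy.
have m0 : 0 < m%:R :> R.
  by rewrite ltr0n lt0n; apply: contraTneq me => ->; rewrite mul0r -leNgt.
have diag (u : nat -> X) : (forall i j, (i < m)%N -> (j < m)%N -> i != j -> p (u i) (u j) <= d + 2 * tau) ->
  \sum_(i < m) \sum_(j < m) p (u i) (u j) <= m%:R ^+ 2 * (d + 2 * tau) + m%:R * 5.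
  move=> uu; rewrite expr2 -mulrA -mulrDr.
  apply: (@le_trans _ _ (\sum_(i < m) (m%:R * (d + 2 * tau) + 5))); last first.
    by rewrite sumr_const card_ord -[_ *+ _]mulr_natl.
  apply: ler_sum => i _; rewrite (bigD1 i)//=.
  have h : \sum_(j < m | j != i) p (u i) (u j) <= \sum_(j < m | j != i) (d + 2 * tau).
    by apply: ler_sum => j ji; apply: uu => //; rewrite eq_sym.
  have h' : \sum_(j < m | j != i) (d + 2 * tau) = m%:R * (d + 2 * tau) - (d + 2 * tau).
    have : \sum_(j < m) (d + 2 * tau) = m%:R * (d + 2 * tau).
      by rewrite sumr_const card_ord -[_ *+ _]mulr_natl.
    by rewrite (bigD1 i)//= => <-; ring.
  (* A diagonal entry is at most 2 and [d + 2 * tau] exceeds -3, hence the excess 5 per row. *)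
  have := p2 (u i) (u i); move: d3; rewrite !ler_norml; lra.
have cross : m%:R ^+ 2 * (d - tau) <= \sum_(i < m) \sum_(j < m) p (x i) (y j).
  apply: (@le_trans _ _ (\sum_(i < m) \sum_(j < m) (d - tau))).
    rewrite (eq_bigr (fun=> m%:R * (d - tau))) => [|i _].
      by rewrite sumr_const card_ord -[leRHS]mulr_natl mulrA -expr2.
    by rewrite sumr_const card_ord -[_ *+ _]mulr_natl.
  by apply: ler_sum => i _; apply: ler_sum => j _; exact: xy.
have dif : \sum_(i < m) (p z (x i) - p z (y i)) <= m%:R * (2 * tau - eta).
  apply: (@le_trans _ _ (\sum_(i < m) (2 * tau - eta))).
    by apply: ler_sum => i _; have := zx i (ltn_ord i); have := zy i (ltn_ord i); lra.
  by rewrite sumr_const card_ord -[_ *+ _]mulr_natl.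
(* For means instead of sums, [s = eta / 2] minimises [2 * s ^ 2 - 2 * s * eta]: here 2 bounds
   [p z z], and up to [2 * tau] the point [z] sees the two barycentres at overlaps differing by at
   least [eta]. The factor [m] passes back to sums. *)
have := psd (m%:R * (eta / 2)); have := diag x xx; have := diag y yy.
have := p2 z z; rewrite ler_norml => /andP[_ zz].
move: dif cross; set S1 := \sum_(i < m) (_ - _); set S2 := \sum_(i < m) \sum_(j < m) p (x i) (y j).
set S3 := \sum_(i < m) \sum_(j < m) p (x i) (x j).
set S4 := \sum_(i < m) \sum_(j < m) p (y i) (y j) => dif cross h3 h2.
set k := m%:R in m0 me dif cross h3 h2 *.
have k2 : 0 < k ^+ 2 by rewrite exprn_gt0.
have g1 : (k * (eta / 2)) ^+ 2 * p z z <= k ^+ 2 * (eta ^+ 2 / 2).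
  apply: (@le_trans _ _ ((k * (eta / 2)) ^+ 2 * 2)).
    by rewrite ler_wpM2l// sqr_ge0.
  by rewrite le_eqVlt; apply/orP; left; apply/eqP; field.
have g2 : 2 * (k * (eta / 2)) * S1 <= k ^+ 2 * (eta * (2 * tau - eta)).
  apply: (@le_trans _ _ (2 * (k * (eta / 2)) * (k * (2 * tau - eta)))).
    by rewrite ler_wpM2l// mulr_ge0// mulr_ge0// ltW// divr_gt0.
  by rewrite le_eqVlt; apply/orP; left; apply/eqP; field.
have g3 : k * 10 < k ^+ 2 * (eta ^+ 2 / 4).
  by rewrite expr2 -mulrA ltr_pM2l//; lra.
have g4 : k ^+ 2 * (56 * tau) <= k ^+ 2 * eta ^+ 2 by rewrite ler_pM2l.
have g5 : k ^+ 2 * (eta * tau) <= k ^+ 2 * tau.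
  by rewrite ler_pM2l// ler_piMl// ltW.
move=> h; suff : k ^+ 2 * (eta ^+ 2 / 2) + k ^+ 2 * (eta * (2 * tau - eta)) +
    (k ^+ 2 * (d + 2 * tau) + k * 5 + (k ^+ 2 * (d + 2 * tau) + k * 5) -
     2 * (k ^+ 2 * (d - tau))) < 0 by lra.
have -> : k ^+ 2 * (eta ^+ 2 / 2) + k ^+ 2 * (eta * (2 * tau - eta)) +
    (k ^+ 2 * (d + 2 * tau) + k * 5 + (k ^+ 2 * (d + 2 * tau) + k * 5) -
     2 * (k ^+ 2 * (d - tau))) = - (k ^+ 2 * eta ^+ 2) / 2 + 2 * (k ^+ 2 * (eta * tau))
     + 6 * (k ^+ 2 * tau) + k * 10 by field.
lra.
Qed.

End Clusters.

Section Ultrametricity.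
Variable R : realType.

Definition near_triple (X : Type) (r : X -> X -> R * R) (l : R * R -> R) tau
    (W : (nat -> X) -> R) (A12 A13 A23 : R) := forall c, W c != 0 ->
  [/\ `|l (r (c 1%N) (c 2%N)) - A12| <= tau,
      `|l (r (c 1%N) (c 3%N)) - A13| <= tau &
      `|l (r (c 2%N) (c 3%N)) - A23| <= tau].

(** Positions of the two clusters. [ix 1] lists replica 1 and its copies before replicas 1 and 2 are
    transposed, and [ix 2] lists them after it, when replica 1 sits at position 2. [iy m] lists
    position 1 and the copies made from it afterwards. *)
Let ix (k i : nat) := if i is i'.+1 then (3 + i)%N else k.
Let iy (m i : nat) := if i is i'.+1 then (3 + m + i)%N else 1%N.

Let ix_cluster m i : (i < m.+1)%N -> in_cluster 3 m (ix 1 i).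
Proof. by case: i => //= i; rewrite /in_cluster; lia. Qed.

Let iy_cluster m i : (i < m.+1)%N -> in_cluster (3 + m) m (iy m i).
Proof. by case: i => //= i; rewrite /in_cluster; lia. Qed.

Let ix_inj i j : i != j -> ix 1 i != ix 1 j.
Proof. by case: i => [|i]; case: j => [|j] //=; lia. Qed.

Let iy_inj m i j : i != j -> iy m i != iy m j.
Proof. by case: i => [|i]; case: j => [|j] //=; lia. Qed.

Let iy_neq m i k : (1 < k <= 3 + m)%N -> k != iy m i.
Proof. by case: i => [|i] /=; lia. Qed.

Let large_index m k : (1 < k <= 3 + m)%N ->
  [\/ k = 2%N, k = 3%N | [/\ k != 1%N, k != 2%N, k != 3%N & in_cluster 3 m k]].
Proof.
rewrite /in_cluster; case: k => [|[|[|[|k]]]]//= h; first by constructor 1.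
  by constructor 2.
by constructor 3; split => //; rewrite orFb; lia.
Qed.

(** Replicas 1 and 2 are the closest pair, and each is replaced by a cluster. Since [a < b <= d],
    all overlaps in the triple are at most [d + tau], the bound that duplication of either replica
    requires. Every choice of one point in each cluster, with replica 3, is again a near triple. *)
Lemma ultrametric_ordered (kappa eta tau : R) :
  0 < kappa -> 0 < eta <= 1 -> 0 < tau -> 56 * tau <= eta ^+ 2 ->
  exists M0 : nat, forall X r E M, (M0 <= M)%N -> @gg_system R X r E M ->
  forall W l a b d, weight r 3 W -> kappa <= E W -> comb l ->
  `|d| <= 3 -> a < b - eta -> b <= d -> near_triple r l tau W d a b -> False.
Proof.
move=> kappa0 /andP[eta0 eta1] tau0 taue.
have eta20 : 0 < eta ^+ 2 by rewrite exprn_gt0.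
pose m := Num.bound (64 / eta ^+ 2).
have hm : 64 < m.+1%:R * eta ^+ 2.
  rewrite -ltr_pdivrMr//; apply: lt_trans (_ : m%:R < _); last by rewrite ltr_nat.
  by apply: archi_boundP; rewrite divr_ge0// ltW.
have [M1 [q1 q10 H1]] := @cluster_extension R m kappa tau 3 kappa0 tau0 isT.
have [//|M2 [q2 q20 H2]] := @cluster_extension R m q1 tau (3 + m) q10 tau0.
exists (maxn 2 (maxn M1 M2)) => X r E M; rewrite !geq_max => /and3P[M_2 M1M M2M] sys.
move=> W l a b d wW kW cl d3 ab bd near.
have nearW c : W c != 0 -> [/\ l (r (c 1%N) (c 2%N)) <= d + tau,
    d - tau <= l (r (c 1%N) (c 2%N)), l (r (c 1%N) (c 3%N)) <= a + tau,
    l (r (c 2%N) (c 3%N)) <= b + tau & b - tau <= l (r (c 2%N) (c 3%N))].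
  by move=> /near[]; rewrite !ler_norml => h1 h2 h3; split; lra.
have [W1 [wW1 kW1 W1c]] : exists W1, [/\ weight r (3 + m) W1, q1 <= E W1 &
    forall c, W1 c != 0 ->
    (forall p : nat, in_cluster 3 m p -> W (sw 1 p c) != 0) /\
    (forall p p' : nat, in_cluster 3 m p -> in_cluster 3 m p' -> p != p' ->
      l (r (c p) (c p')) <= d + tau + tau)].
  apply: (H1 X r E M M1M sys W l (d + tau) wW kW cl) => c /nearW[h1 _ h2 _ _] k.
  case: k => [|[|[|[|k]]]]// _; lra.
have [bm S G] := sys.
(* Only position 1 can be duplicated, so replica 2 is moved there. *)
pose W2 := W1 \o sw 1 2.
have wW2 : weight r (3 + m) W2 by apply: weight_sw.
have kW2 : q1 <= E W2.
  by rewrite (E_sw S)//; [exact: (weight_bm S wW1)|exact: ltnW].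
have W2c c : W2 c != 0 -> forall p, in_cluster 3 m p ->
    W (sw 1 p (sw 1 2 c)) != 0.
  by move=> /W1c[].
have [|W3 [wW3 kW3 W3c]] := H2 X r E M M2M sys W2 l (d + tau) wW2 kW2 cl.
  move=> c W2c0 k /large_index[->|->|[k1 k2 k3 kc]].
  - have /nearW[h _ _ _ _] := W2c c W2c0 1%N isT; move: h.
    by rewrite swii swE1 swE2 (r_sym S).
  - have /nearW[_ _ _ h _] := W2c c W2c0 1%N isT; move: h.
    by rewrite swii swE2 swE//; lra.
  - have /nearW[h _ _ _ _] := W2c c W2c0 k kc; move: h.
    by rewrite swE1 swE// (swE _ (k := 2%N))// 1?eq_sym// swE2 (r_sym S).
have [c Wc] : exists c, W3 c != 0.
  apply: (E_gt0_witness S (weight_bm S wW3)); last exact: lt_le_trans kW3.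
  by move=> c; have /andP[] := weight01 wW3 c.
have [A B] := W3c c Wc.
(* [W2 (sw 1 q c)] is [W1 (cq q)]: the configuration in which the point [c q] of the second cluster
   takes the role of replica 2 for the first duplication. *)
pose cq q := sw 1 2 (sw 1 q c).
have cq1 i : cq (iy m i) 1%N = c 2%N.
  by rewrite /cq swE1 swE//; exact: (@iy_neq m i 2).
have cq2 q : cq q 2%N = c q by rewrite /cq swE2 swE1.
have cqE i k : (2 < k <= 3 + m)%N -> cq (iy m i) k = c k.
  move=> hk; rewrite /cq swE; [|clear -hk; lia|clear -hk; lia].
  by rewrite swE//; [clear -hk; lia|apply: (@iy_neq m i k); clear -hk; lia].
have cqx i j : (i < m.+1)%N -> cq (iy m j) (ix 1 i) = c (ix 2 i).
  by case: i => [|i] im /=; [exact: cq1|rewrite cqE//; clear -im; lia].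
have facts i j : (i < m.+1)%N -> (j < m.+1)%N ->
   [/\ d - tau <= l (r (c (ix 2 i)) (c (iy m j))),
      l (r (c (ix 2 i)) (c 3%N)) <= a + tau &
      b - tau <= l (r (c (iy m j)) (c 3%N))].
  move=> im jm; have Wq := A _ (iy_cluster jm).
  have /nearW[_] := (W1c _ Wq).1 _ (ix_cluster im).
  rewrite swE1 -/(cq _) cqx//.
  have n2 : 2%N != ix 1 i by case: (i) => [|i'] //=; clear; lia.
  have n3 : 3%N != ix 1 i by case: (i) => [|i'] //=; clear; lia.
  by rewrite !swE// cq2 cqE//; split.
apply: (@barycentre_absurd R X (fun u v => l (r u v)) m.+1 (c 3%N)
  (fun i => c (ix 2 i)) (fun i => c (iy m i)) a b d eta tau) => //.
- by move=> t; exact: (comb_psd S cl m.+1 (c 3%N) (fun i => c (ix 2 i)) (fun i => c (iy m i)) t).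
- by move=> u v; exact: (comb_bnd S _ _ cl).
- by rewrite eta0.
- by move=> i im; rewrite (r_sym S); have [] := facts i i im im.
- by move=> i im; rewrite (r_sym S); have [] := facts i i im im.
- move=> i j im jm ij.
  have Wq := A _ (iy_cluster im).
  have := (W1c _ Wq).2 _ _ (ix_cluster im) (ix_cluster jm) (ix_inj ij).
  by rewrite -/(cq _) !cqx//; lra.
- move=> i j im jm ij.
  have := B _ _ (iy_cluster im) (iy_cluster jm) (iy_inj m ij).
  by lra.
- by move=> i j im jm; have [] := facts i j im jm.
Qed.

(** Violation means that one overlap is isolated as the smallest. A relabelling makes it the one
    between 1 and 3, and a further one puts the other two in order. *)
Lemma ultrametric (kappa eta tau : R) :
  0 < kappa -> 0 < eta <= 1 -> 0 < tau -> 56 * tau <= eta ^+ 2 ->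
  exists M0 : nat, forall X r E M, (M0 <= M)%N -> @gg_system R X r E M ->
  forall W l A12 A13 A23, weight r 3 W -> kappa <= E W -> comb l ->
  near_triple r l tau W A12 A13 A23 ->
  `|A12| <= 3 -> `|A13| <= 3 -> `|A23| <= 3 ->
  [\/ A12 < A13 - eta /\ A12 < A23 - eta,
      A13 < A12 - eta /\ A13 < A23 - eta |
      A23 < A12 - eta /\ A23 < A13 - eta] -> False.
Proof.
move=> kappa0 eta01 tau0 taue.
have [M0 H] := ultrametric_ordered kappa0 eta01 tau0 taue.
exists (maxn 3 M0) => X r E M; rewrite geq_max => /andP[M3 MM] sys.
have {}H := H X r E M MM sys; have [bm S _] := sys.
have sM k : (0 < k <= 3)%N -> (0 < k <= M)%N.
  by move=> /andP[-> /leq_trans]; exact.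
have min13 W l A12 A13 A23 : weight r 3 W -> kappa <= E W -> comb l ->
    near_triple r l tau W A12 A13 A23 -> `|A12| <= 3 -> `|A23| <= 3 ->
    A13 < A12 - eta -> A13 < A23 - eta -> False.
  move=> wW kW cl near a12 a23 h1 h2; have [le|/ltW le] := leP A23 A12.
    exact: (H W l A13 A23 A12).
  apply: (H (W \o sw 1 3) l A13 A12 A23) => //.
  - by apply: weight_sw.
  - by rewrite (E_sw S (weight_bm S wW)) ?sM.
  - move=> c /near; rewrite swE1 swE2 swE// => -[h3 h4 h5].
    by rewrite (r_sym S (c 1%N)) (r_sym S (c 1%N) (c 3%N)) (r_sym S (c 2%N) (c 3%N)).
move=> W l A12 A13 A23 wW kW cl near a12 a13 a23 [[h1 h2]|[h1 h2]|[h1 h2]].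
- apply: (min13 (W \o sw 2 3) l A13 A12 A23) => //.
  + by apply: weight_sw.
  + by rewrite (E_sw S (weight_bm S wW)) ?sM.
  + move=> c /near; rewrite swE1 swE2 swE// => -[h3 h4 h5].
    by rewrite (r_sym S (c 2%N)).
- exact: (min13 W l A12 A13 A23).
- apply: (min13 (W \o sw 1 2) l A12 A23 A13) => //.
  + by apply: weight_sw.
  + by rewrite (E_sw S (weight_bm S wW)) ?sM.
  + move=> c /near; rewrite swE1 swE2 swE// => -[h3 h4 h5].
    by rewrite (r_sym S (c 1%N) (c 2%N)).
Qed.

End Ultrametricity.

(** * Synchronization *)

Section Synchronization.
Variable R : realType.

Lemma ramp_continuous (w t : R) : 0 < w -> continuous (ramp w t).
Proof.
move=> w0; apply: (@lip_continuous R (Num.bound w^-1)).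
by apply: ramp_is_lip => //; apply/ltW/archi_boundP; rewrite invr_ge0 ltW.
Qed.

(** Pigeonhole over a partition of unity: the hats, differences of consecutive ramps, sum to 1 on
    [-2, 2], so one of the [K] hats keeps a share [1 / K] of the mass. *)
Lemma pin_overlap (tau : R) : 0 < tau -> exists2 J : R, 0 < J &
  forall X r E M, @gg_system R X r E M -> forall n W kappa l i j,
  weight r n W -> kappa <= E W -> 0 <= kappa -> comb l -> (0 < i <= n)%N -> (0 < j <= n)%N ->
  exists a, exists W', [/\ weight r n W', kappa * J <= E W' & forall c, W' c != 0 ->
    W c != 0 /\ `|l (r (c i) (c j)) - a| <= tau].
Proof.
(* The interval [-2, 2] has length 4, and the last ramp needs one more [tau] to equal 1 on all of
   it. *)
move=> tau0; pose K := Num.bound ((4 + tau) / tau).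
have HK : 4 + tau < K%:R * tau.
  by rewrite -ltr_pdivrMr//; apply: archi_boundP; rewrite divr_ge0 ?addr_ge0// ltW.
have K0 : 0 < K%:R :> R.
  rewrite ltr0n lt0n; apply: contraTneq HK => ->.
  by rewrite mul0r -leNgt addr_ge0// ltW.
exists K%:R^-1; first by rewrite invr_gt0.
move=> X r E M [bm S _] n W kappa l i j wW kW kappa0 cl hi hj.
pose t k : R := -2 + k%:R * tau.
pose hat k x := ramp tau (t k.+1) x - ramp tau (t k) x.
have tS k : t k <= t k.+1 by rewrite lerD2l ler_pM2r// ler_nat.
have hat01 k x : 0 <= hat k x <= 1.
  have := ramp_le x tau0 (tS k); have := ramp01 tau (t k) x; have := ramp01 tau (t k.+1) x.
  by rewrite /hat; lra.
have hatc k : continuous (fun x => hat k (l x)).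
  move=> x; apply: cvgB; apply: continuous_comp; try exact: comb_continuous;
    exact: ramp_continuous.
have wh k : weight r n (fun c => W c * hat k (l (r (c i) (c j)))).
  apply: weight_mul => //; apply: (weight_ov r hi hj (@hatc k)) => x; exact: hat01.
have sumE : E W = \sum_(k < K) E (fun c => W c * hat k (l (r (c i) (c j)))).
  rewrite -(E_sum S); last by move=> k; exact: (weight_bm S (wh k)).
  congr E; apply/funext => c; rewrite -mulr_sumr.
  rewrite -(big_mkord xpredT (fun k => hat k (l (r (c i) (c j))))) telescope_sumr//.
  have := comb_bnd S (c i) (c j) cl; rewrite ler_norml => /andP[h1 h2].
  rewrite (@ramp_eq1 _ tau)// ?(@ramp_eq0 _ tau (t 0%N))// ?subr0 ?mulr1//.
    by rewrite /t mul0r addr0.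
  by rewrite /t; lra.
have [k hk] : exists k : 'I_K, kappa / K%:R <= E (fun c => W c * hat k (l (r (c i) (c j)))).
  apply/not_existsP => h; move: kW; rewrite sumE leNgt => /negP; apply.
  have -> : kappa = \sum_(k < K) kappa / K%:R.
    rewrite sumr_const card_ord -[RHS]mulr_natl; field.
    by rewrite gt_eqF.
  apply: ltr_sum; last by move=> k _; rewrite ltNge; apply/negP/h.
  by apply/hasP; exists (Ordinal (ltac:(by rewrite -(ltr0n R)) : (0 < K)%N)); rewrite ?mem_index_enum.
exists (t k), (fun c => W c * hat k (l (r (c i) (c j)))); split => //.
move=> c; rewrite mulf_eq0 negb_or => /andP[-> hc]; split => //.
set x := l _ in hc *.
have x1 : x < t k.+1.
  rewrite ltNge; apply: contra hc => h.
  by rewrite /hat !(@ramp_eq0 _ tau)// ?subrr//; apply: le_trans h.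
have x2 : t k - tau < x.
  rewrite ltNge; apply: contra hc => h; have h' := tS k.
  by rewrite /hat !(@ramp_eq1 _ tau)// ?subrr//; lra.
rewrite ler_norml; apply/andP; split; first by lra.
by move: x1; rewrite /t -(natr1 k) mulrDl mul1r; lra.
Qed.

(** Here [x], [y], [z] stand for [R^{1,2}], [R^{1,3}], [R^{2,3}]. If neither coordinate has an
    isolated minimum, then [z.1] is within [w / 4] of [x.1] and [z.2] within [w / 4] of [y.2], the
    smaller value in each coordinate. Then the sum of the coordinates is smallest at [z], by at
    least [w / 2]. *)
Lemma crossing_not_ultrametric (w : R) (x y z : R * R) : 0 < w ->
  x.1 + w <= y.1 -> y.2 + w <= x.2 -> exists2 l : R * R -> R, comb l &
  [\/ l x < l y - w / 4 /\ l x < l z - w / 4,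
      l y < l x - w / 4 /\ l y < l z - w / 4 |
      l z < l x - w / 4 /\ l z < l y - w / 4].
Proof.
move=> w0 xy1 yx2.
have [h1|h1] := ltP z.1 (x.1 - w / 4).
  by exists fst; [constructor 1|constructor 3; split; lra].
have [h2|h2] := ltP x.1 (z.1 - w / 4).
  by exists fst; [constructor 1|constructor 1; split; lra].
have [h3|h3] := ltP z.2 (y.2 - w / 4).
  by exists snd; [constructor 2|constructor 3; split; lra].
have [h4|h4] := ltP y.2 (z.2 - w / 4).
  by exists snd; [constructor 2|constructor 2; split; lra].
by exists (fun x => x.1 + x.2); [constructor 3|constructor 3; split; lra].
Qed.

(** Equal to 1 where [x.1 <= s] and [t + 3 * w <= x.2], and supported where [x.1 < s + w] and
    [t + 2 * w < x.2]. The support of [lower_right] is thus at distance at least [w] in each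
    coordinate. *)
Definition upper_left (w s t : R) (x : R * R) :=
  ramp w (s + w) x.1 * (1 - ramp w (t + 3 * w) x.2).
Definition lower_right (w s t : R) (x : R * R) :=
  (1 - ramp w (s + 3 * w) x.1) * ramp w (t + w) x.2.

Lemma upper_left_test w s t M : 0 < w -> w^-1 <= M%:R -> gg_test M (upper_left w s t).
Proof.
move=> w0 wM; exists (ramp w (s + w)), (fun x => 1 - ramp w (t + 3 * w) x).
by split; [exact: ramp_is_lip|apply: lipC; exact: ramp_is_lip|left].
Qed.

Lemma lower_right_test w s t M : 0 < w -> w^-1 <= M%:R -> gg_test M (lower_right w s t).
Proof.
move=> w0 wM; exists (fun x => 1 - ramp w (s + 3 * w) x), (ramp w (t + w)).
by split; [apply: lipC; exact: ramp_is_lip|exact: ramp_is_lip|left].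
Qed.

Lemma gg_test_continuous M (phi : R * R -> R) : gg_test M phi -> continuous phi.
Proof.
move=> [u [v [/lip_continuous uc /lip_continuous vc [|] ->]]] x.
  by apply: cvgM; apply: continuous_comp; [exact: cvg_fst|exact: uc|exact: cvg_snd|exact: vc].
apply: (@continuous_comp _ _ _ (fun x : R * R => x.1 + x.2) u); last exact: uc.
by apply: cvgD; [exact: cvg_fst|exact: cvg_snd].
Qed.

Lemma gg_test01 M (phi : R * R -> R) : gg_test M phi -> forall x, 0 <= phi x <= 1.
Proof.
move=> [u [v [[u01 _] [v01 _] [|] ->]]] x; last exact: u01.
have /andP[a b] := u01 x.1; have /andP[a' b'] := v01 x.2.
by rewrite mulr_ge0//= mulr_ile1.
Qed.

Lemma synchronization (kappa w : R) : 0 < kappa -> 0 < w <= 1 ->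
  exists M0 : nat, forall X r E M, (M0 <= M)%N -> @gg_system R X r E M ->
  forall s t, E (fun c => upper_left w s t (r (c 1%N) (c 2%N))) *
              E (fun c => lower_right w s t (r (c 1%N) (c 2%N))) <= kappa.
Proof.
move=> kappa0 /andP[w0 w1].
(* 224 is 56 times 4: two configurations in the support differ by at most [2 * tau] in each overlap,
   hence by at most [4 * tau] in the sum of the two. *)
pose tau : R := (w / 4) ^+ 2 / 224.
have tau0 : 0 < tau by rewrite divr_gt0// exprn_gt0// divr_gt0.
have [J J0 HJ] := pin_overlap tau0.
have eta01 : 0 < w / 4 <= 1 by apply/andP; split; lra.
have tau40 : 0 < 4 * tau by rewrite mulr_gt0.
have taue : 56 * (4 * tau) <= (w / 4) ^+ 2 by rewrite /tau; lra.
have k6 : 0 < kappa / 4 * J * J * J * J * J * J by rewrite !mulr_gt0.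
have [M1 H1] := ultrametric k6 eta01 tau40 taue.
exists (maxn M1 (maxn 3 (Num.bound (w^-1) + Num.bound (4 / kappa)))%N).
move=> X r E M; rewrite !geq_max => /and3P[M1M M3 MB] sys s t.
have wM : w^-1 <= M%:R.
  apply: (@le_trans _ _ (Num.bound (w^-1))%:R).
    by apply/ltW/archi_boundP; rewrite invr_ge0 ltW.
  by rewrite ler_nat; apply: leq_trans MB; exact: leq_addr.
have M0 : 0 < M%:R :> R by rewrite ltr0n (leq_trans _ M3).
have kM : M%:R^-1 <= kappa / 4.
  rewrite -[_ / _]invrK lef_pV2 ?posrE ?invr_gt0 ?divr_gt0//.
  rewrite invf_div; apply: (@le_trans _ _ (Num.bound (4 / kappa))%:R).
    by apply/ltW/archi_boundP; rewrite divr_ge0// ltW.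
  by rewrite ler_nat; apply: leq_trans MB; exact: leq_addl.
rewrite leNgt; apply/negP => big.
have tu := upper_left_test s t w0 wM; have tl := lower_right_test s t w0 wM.
pose g c := upper_left w s t (r (c 1%N) (c 2%N)).
pose W0 c := g c * lower_right w s t (r (c 1%N) (c 3%N)).
have wg : weight r 2 g.
  by apply: weight_ov => //; [exact: (gg_test_continuous tu)|exact: (gg_test01 tu)].
have wW0 : weight r 3 W0.
  apply: weight_mul; first by apply: weight_le wg.
  by apply: weight_ov => //; [exact: (gg_test_continuous tl)|exact: (gg_test01 tl)].
have [bm S G] := sys.
(* For [n = 2] the product term of the identity is more than [kappa / 2], and the error is at most
   [kappa / 4]. *)
have kW0 : kappa / 4 <= E W0.
  have := G 2 g (lower_right w s t) M3 wg tl; rewrite /gerr ler_norml => /andP[+ _].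
  rewrite big_nat1.
  have wgl : weight r 2 (fun c => g c * lower_right w s t (r (c 1%N) (c 2%N))).
    apply: weight_mul => //.
    by apply: weight_ov => //; [exact: (gg_test_continuous tl)|exact: (gg_test01 tl)].
  have : 0 <= E (fun c => g c * lower_right w s t (r (c 1%N) (c 2%N))).
    apply: (E_ge0 S); first exact: (weight_bm S wgl).
    by move=> c; have /andP[] := weight01 wgl c.
  move: big; rewrite -/W0 -/g; set a := E g * _; rewrite -(mulrA _ (E g)) -/a.
  set b := E _; set d := E W0; lra.
have k40 : 0 <= kappa / 4 by lra.
have f1 : comb (@fst R R) by constructor 1.
have f2 : comb (@snd R R) by constructor 2.
(* Each of the six pinnings costs a factor [J]. Afterwards all overlaps are almost constant on the
   support, so a violation of ultrametricity at one configuration extends to the whole weight. *)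
have [a1 [V1 [wV1 kV1 S1]]] := HJ X r E M sys 3 W0 _ fst 1%N 2%N wW0 kW0 k40 f1 isT isT.
have k41 := mulr_ge0 k40 (ltW J0).
have [a2 [V2 [wV2 kV2 S2]]] := HJ X r E M sys 3 V1 _ snd 1%N 2%N wV1 kV1 k41 f2 isT isT.
have k42 := mulr_ge0 k41 (ltW J0).
have [a3 [V3 [wV3 kV3 S3]]] := HJ X r E M sys 3 V2 _ fst 1%N 3%N wV2 kV2 k42 f1 isT isT.
have k43 := mulr_ge0 k42 (ltW J0).
have [a4 [V4 [wV4 kV4 S4]]] := HJ X r E M sys 3 V3 _ snd 1%N 3%N wV3 kV3 k43 f2 isT isT.
have k44 := mulr_ge0 k43 (ltW J0).
have [a5 [V5 [wV5 kV5 S5]]] := HJ X r E M sys 3 V4 _ fst 2%N 3%N wV4 kV4 k44 f1 isT isT.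
have k45 := mulr_ge0 k44 (ltW J0).
have [a6 [V6 [wV6 kV6 S6]]] := HJ X r E M sys 3 V5 _ snd 2%N 3%N wV5 kV5 k45 f2 isT isT.
have supp c : V6 c != 0 -> [/\ W0 c != 0,
    `|(r (c 1%N) (c 2%N)).1 - a1| <= tau /\ `|(r (c 1%N) (c 2%N)).2 - a2| <= tau,
    `|(r (c 1%N) (c 3%N)).1 - a3| <= tau /\ `|(r (c 1%N) (c 3%N)).2 - a4| <= tau &
    `|(r (c 2%N) (c 3%N)).1 - a5| <= tau /\ `|(r (c 2%N) (c 3%N)).2 - a6| <= tau].
  by move=> /S6[/S5[/S4[/S3[/S2[/S1[]]]]]].
have [c0 V6c0] : exists c, V6 c != 0.
  apply: (E_gt0_witness S (weight_bm S wV6)); last exact: lt_le_trans kV6.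
  by move=> c; have /andP[] := weight01 wV6 c.
have [W0c0 A1 A2 A3] := supp _ V6c0.
move: W0c0; rewrite !mulf_eq0 !negb_or => /andP[/andP[/(ramp_neq0 w0) x1 x2]].
move=> /andP[y1 /(ramp_neq0 w0) y2].
have {}x2 : t + 2 * w < (r (c0 1%N) (c0 2%N)).2.
  by rewrite ltNge; apply: contra x2 => h; rewrite (@ramp_eq1 _ w) ?subrr//; clear -h; lra.
have {}y1 : s + 2 * w < (r (c0 1%N) (c0 3%N)).1.
  by rewrite ltNge; apply: contra y1 => h; rewrite (@ramp_eq1 _ w) ?subrr//; clear -h; lra.
have xy1 : (r (c0 1%N) (c0 2%N)).1 + w <= (r (c0 1%N) (c0 3%N)).1 by clear -x1 y1; lra.
have yx2 : (r (c0 1%N) (c0 3%N)).2 + w <= (r (c0 1%N) (c0 2%N)).2 by clear -x2 y2; lra.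
have [l cl viol] := crossing_not_ultrametric (r (c0 2%N) (c0 3%N)) w0 xy1 yx2.
have b3 x y : `|l (r x y)| <= 3 by apply: le_trans (comb_bnd S x y cl) _; rewrite ler_nat.
apply: (H1 X r E M M1M sys V6 l _ _ _ wV6 kV6 cl _ _ _ _ viol) => // c /supp[_ B1 B2 B3].
move: A1 A2 A3 B1 B2 B3; rewrite !ler_norml => A1 A2 A3 B1 B2 B3.
by case: cl => -> /=; split; clear -A1 A2 A3 B1 B2 B3 tau0; lra.
Qed.

End Synchronization.

(** * From powers to Lipschitz test functions *)

Section Bernstein.
Variable R : realType.
Implicit Types (f : nat -> R) (x y : R).

(* The expectation of [f] under the binomial law with [m] trials, as a polynomial in
   the point [x] of [-2, 2] whose success probability is [(x + 2) / 4]. *)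
Fixpoint bernstein (m : nat) f : {poly R} :=
  if m is m'.+1 then
    ((4^-1)%:P * 'X + (2^-1)%:P) * bernstein m' (f \o succn)
    + (1 - ((4^-1)%:P * 'X + (2^-1)%:P)) * bernstein m' f
  else (f 0%N)%:P.

Let prob x := (x + 2) / 4.

Lemma bernsteinS m f x : (bernstein m.+1 f).[x] =
  prob x * (bernstein m (f \o succn)).[x] + (1 - prob x) * (bernstein m f).[x].
Proof. by rewrite /= !hornerE /prob; field. Qed.

Lemma bernstein_le m f g x : -2 <= x <= 2 -> (forall k, (k <= m)%N -> f k <= g k) ->
  (bernstein m f).[x] <= (bernstein m g).[x].
Proof.
move=> x2; have /andP[p0 p1] : 0 <= prob x <= 1 by rewrite /prob; lra.
elim: m f g => [|m IH] f g fg; first by rewrite !hornerE fg.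
rewrite !bernsteinS lerD//.
  by rewrite ler_wpM2l// IH// => k km; apply: fg.
by rewrite ler_wpM2l ?subr_ge0// IH// => k km; apply: fg; apply: leqW.
Qed.

Lemma bernsteinD m f g x : (bernstein m (fun k => f k + g k)).[x] =
  (bernstein m f).[x] + (bernstein m g).[x].
Proof.
elim: m f g => [|m IH] f g; first by rewrite !hornerE.
rewrite !bernsteinS IH (_ : _ \o succn = fun k => (f \o succn) k + (g \o succn) k)//.
by rewrite IH; ring.
Qed.

Lemma bernsteinZ m a f x : (bernstein m (fun k => a * f k)).[x] =
  a * (bernstein m f).[x].
Proof.
elim: m f => [|m IH] f; first by rewrite !hornerE.
rewrite !bernsteinS IH (_ : _ \o succn = fun k => a * (f \o succn) k)//.
by rewrite IH; ring.
Qed.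

Lemma bernstein_cst m a x : (bernstein m (fun=> a)).[x] = a.
Proof.
elim: m => [|m IH]; first by rewrite hornerE.
by rewrite bernsteinS (_ : _ \o succn = fun=> a)// !IH; ring.
Qed.

Lemma bernstein_sqr m c x : (bernstein m (fun k => (k%:R - c) ^+ 2)).[x] =
  m%:R * (prob x * (1 - prob x)) + (m%:R * prob x - c) ^+ 2.
Proof.
elim: m c => [|m IH] c; first by rewrite hornerE; ring.
rewrite bernsteinS IH (_ : _ \o succn = fun k => (k%:R - (c - 1)) ^+ 2).
  by rewrite IH -(natr1 m); ring.
by apply/funext => k /=; rewrite -(natr1 k); ring.
Qed.

Lemma bernstein_sum m (I : Type) (s : seq I) (F : I -> nat -> R) x :
  (bernstein m (fun k => \sum_(i <- s) F i k)).[x] =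
  \sum_(i <- s) (bernstein m (F i)).[x].
Proof.
elim: s => [|i s IH].
  by rewrite big_nil; under eq_fun do rewrite big_nil; exact: bernstein_cst.
by rewrite big_cons -IH -bernsteinD; under eq_fun do rewrite big_cons.
Qed.

Lemma eq_bernstein m f g x : (forall k, (k <= m)%N -> f k = g k) ->
  (bernstein m f).[x] = (bernstein m g).[x].
Proof.
elim: m f g => [|m IH] f g fg; first by rewrite !hornerE fg.
rewrite !bernsteinS; congr (_ * _ + _ * _); apply: IH => k km; apply: fg => //.
exact: leqW.
Qed.

Definition bernstein_basis m k := bernstein m (fun i => (i == k)%:R).

(** The approximants of degree [m] of all test functions are combinations of one fixed finite
    family, with coefficients the values of the function. This makes [delta] uniform in the test
    function. *)
Lemma bernstein_basisE m f x :
  (bernstein m f).[x] = \sum_(k < m.+1) f k * (bernstein_basis m k).[x].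
Proof.
under eq_bigr do rewrite -bernsteinZ; rewrite -bernstein_sum.
apply: eq_bernstein => k km; rewrite (bigD1 (Ordinal (km : (k < m.+1)%N)))//=.
rewrite eqxx mulr1 big1 ?addr0// => i ik.
rewrite (_ : (k == i) = false) ?mulr0//.
by apply: contraNF ik => /eqP e; apply/eqP/val_inj.
Qed.

Definition node (m k : nat) : R := 4 * (k%:R / m%:R) - 2.

(** Bernstein's argument. By the inequality of means [|z| <= a / 2 + z ^ 2 / (2 * a)], the deviation
    is controlled by the binomial variance, and [m * a ^ 2 >= 1] balances the two terms. The degree
    does not depend on [u]; [M.+1] avoids dividing by zero. *)
Lemma bernstein_approx (M : nat) (e : R) : 0 < e -> exists m : nat,
  forall u : R -> R, lip M u -> forall x, -2 <= x <= 2 ->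
    `|(bernstein m (fun k => u (node m k))).[x] - u x| <= e.
Proof.
move=> e0; pose a : R := e / (4 * M.+1%:R).
have M0 : 0 < M.+1%:R :> R by [].
have a0 : 0 < a by rewrite /a divr_gt0// mulr_gt0.
pose m := (Num.bound (a ^- 2)).+1; exists m => u [u01 ul] x x2.
have m0 : 0 < m%:R :> R by [].
have ma : 1 <= m%:R * a ^+ 2.
  rewrite -ler_pdivrMr ?exprn_gt0// div1r; apply/ltW.
  apply: lt_trans (_ : (Num.bound (a ^- 2))%:R < _); last by rewrite ltr_nat.
  by apply: archi_boundP; rewrite invr_ge0 exprn_ge0// ltW.
have /andP[p0 p1] : 0 <= prob x <= 1 by rewrite /prob; lra.
pose dev k : R := (k%:R - m%:R * prob x) ^+ 2.
pose bound k := 2 * M.+1%:R * a + 2 * M.+1%:R / (a * m%:R ^+ 2) * dev k.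
have near k : `|u (node m k) - u x| <= bound k.
  apply: le_trans (ul _ _) _.
  apply: (@le_trans _ _ (M.+1%:R * `|node m k - x|)).
    by rewrite ler_wpM2r// ler_nat.
  rewrite (_ : node m k - x = 4 * (k%:R / m%:R - prob x)); last by rewrite /node /prob; lra.
  rewrite normrM (ger0_norm (_ : 0 <= 4))//.
  rewrite (_ : bound k = M.+1%:R * (4 * (a / 2 + (k%:R / m%:R - prob x) ^+ 2 / (2 * a)))).
    rewrite ler_pM2l// ler_pM2l//; set z := _ - prob x.
    have : 0 <= (`|z| - a) ^+ 2 / (2 * a) by rewrite divr_ge0 ?sqr_ge0// mulr_ge0// ltW.
    rewrite (_ : (`|z| - a) ^+ 2 / (2 * a) = a / 2 + z ^+ 2 / (2 * a) - `|z|); first by lra.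
    rewrite -(real_normK (num_real z)); field.
    by rewrite gt_eqF.
  by rewrite /bound /dev; field; rewrite !gt_eqF.
have Bb : (bernstein m bound).[x] <= e.
  rewrite /bound bernsteinD bernstein_cst bernsteinZ /dev bernstein_sqr subrr expr0n addr0.
  have h : m%:R * (prob x * (1 - prob x)) <= m%:R.
    have q0 := mulr_ge0 p0 p0.
    by rewrite ler_piMr ?(ltW m0)//; move: p1 q0; set q := prob x; lra.
  apply: (@le_trans _ _ (2 * M.+1%:R * a + 2 * M.+1%:R * a)); last first.
    by rewrite /a le_eqVlt; apply/orP; left; apply/eqP; field.
  rewrite lerD2l; apply: (@le_trans _ _ (2 * M.+1%:R / (a * m%:R ^+ 2) * m%:R)).
    by rewrite ler_wpM2l// divr_ge0// mulr_ge0 ?exprn_ge0// ltW.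
  rewrite (_ : _ / _ * _ = 2 * M.+1%:R * (a * m%:R)^-1); last by field; rewrite !gt_eqF.
  rewrite ler_wpM2l ?mulr_ge0// -div1r ler_pdivrMr ?mulr_gt0//.
  by rewrite mulrA -expr2 mulrC.
have h1 : u x <= (bernstein m (fun k => u (node m k))).[x] + (bernstein m bound).[x].
  rewrite -bernsteinD -[leLHS](bernstein_cst m _ x).
  by apply: bernstein_le => // k _; have := near k; rewrite ler_norml; lra.
have h2 : (bernstein m (fun k => u (node m k))).[x] <= u x + (bernstein m bound).[x].
  rewrite -[in leRHS](bernstein_cst m (u x) x) -bernsteinD.
  by apply: bernstein_le => // k _; have := near k; rewrite ler_norml; lra.
by rewrite ler_norml; move: h1 h2 Bb; clear; lra.
Qed.

End Bernstein.

(** * Linear space of tests that satisfy the identities approximately *)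

Section PolynomialTests.
Variable R : realType.
Implicit Types (phi psi : R * R -> R).

Definition tame phi := continuous phi /\ box_bounded phi.

Lemma tameZ a phi : tame phi -> tame (fun x => a * phi x).
Proof.
move=> [c [B b]]; split; first by move=> x; apply: cvgM; [exact: cvg_cst|exact: c].
exists (`|a| * B) => x h1 h2; rewrite normrM ler_wpM2l//; exact: b.
Qed.

Lemma tameD phi psi : tame phi -> tame psi -> tame (fun x => phi x + psi x).
Proof.
move=> [c [B b]] [c' [B' b']]; split; first by move=> x; apply: cvgD; [exact: c|exact: c'].
exists (B + B') => x h1 h2; apply: le_trans (ler_normD _ _) _.
by rewrite lerD ?b ?b'.
Qed.

Lemma tameM phi psi : tame phi -> tame psi -> tame (fun x => phi x * psi x).
Proof.
move=> [c [B b]] [c' [B' b']]; split; first by move=> x; apply: cvgM; [exact: c|exact: c'].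
by exists (B * B') => x h1 h2; rewrite normrM ler_pM ?b ?b'.
Qed.

Lemma tame_cst a : tame (fun=> a).
Proof. by split; [move=> x; exact: cvg_cst|exists `|a|]. Qed.

Lemma tame_comb l : comb l -> tame l.
Proof.
move=> cl; split; first exact: comb_continuous.
exists 2 => x; rewrite !ler_norml => h1 h2.
by case: cl => ->; lra.
Qed.

Lemma tameX phi n : tame phi -> tame (fun x => phi x ^+ n).
Proof.
move=> tphi; elim: n => [|n IH]; first exact: tame_cst.
by under eq_fun do rewrite exprS; exact: tameM.
Qed.

Lemma tame_horner (q : {poly R}) phi : tame phi -> tame (fun x => q.[phi x]).
Proof.
move=> tphi; elim/poly_ind: q => [|q a IH].
  by under eq_fun do rewrite horner0; exact: tame_cst.
under eq_fun do rewrite hornerMXaddC.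
by apply: tameD; [exact: tameM|exact: tame_cst].
Qed.

Lemma gg_test_tame M phi : gg_test M phi -> tame phi.
Proof.
move=> [u [v [ul vl e]]]; have uc := lip_continuous ul; have vc := lip_continuous vl.
have lipb M' f : lip M' f -> forall x : R, `|f x| <= 1.
  by move=> [f01 _] x; rewrite ler_norml; have := f01 x; lra.
have key f l : lip M f -> comb l -> tame (f \o l).
  move=> fl cl; split; last by exists 1 => x _ _; exact: (lipb _ _ fl).
  by move=> x; apply: continuous_comp;
    [exact: comb_continuous|exact: (lip_continuous fl)].
case: e => ->; last by apply: (key u) => //; constructor 3.
by apply: tameM; [apply: (key u)|apply: (key v)] => //;
  [constructor 1|constructor 2].
Qed.

Section Linearity.
Variables (X : Type) (r : X -> X -> R * R) (E : ((nat -> X) -> R) -> R).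
Variables (N : nat) (bm : ((nat -> X) -> R) -> Prop).
Hypothesis S : replicas r E N bm.
Variables (n : nat) (g : (nat -> X) -> R).
Hypotheses (n0 : (0 < n)%N) (wg : weight r n g).

Let bmg : bm g. Proof. exact: (weight_bm S wg). Qed.

Let bmt phi i j : tame phi -> bm (fun c => phi (r (c i) (c j))).
Proof. by move=> [c b]; exact: (bm_ov S). Qed.

Let bmgt phi i j : tame phi -> bm (fun c => g c * phi (r (c i) (c j))).
Proof. by move=> t; apply: (bmM S) => //; exact: bmt. Qed.

Lemma gerrD phi psi : tame phi -> tame psi ->
  gerr r E n g (fun x => phi x + psi x) = gerr r E n g phi + gerr r E n g psi.
Proof.
move=> tp tq; rewrite /gerr (ED S (bmt 1%N 2%N tp) (bmt 1%N 2%N tq)).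
have e l : E (fun c => g c * (phi (r (c 1%N) (c l)) + psi (r (c 1%N) (c l)))) =
   E (fun c => g c * phi (r (c 1%N) (c l))) + E (fun c => g c * psi (r (c 1%N) (c l))).
  by rewrite -(ED S (bmgt _ _ tp) (bmgt _ _ tq)); under eq_fun do rewrite mulrDr.
by rewrite e (eq_bigr _ (fun l _ => e l)) big_split/=; ring.
Qed.

Lemma gerrZ a phi : tame phi ->
  gerr r E n g (fun x => a * phi x) = a * gerr r E n g phi.
Proof.
move=> tp; rewrite /gerr (EZ S _ (bmt 1%N 2%N tp)).
have e l : E (fun c => g c * (a * phi (r (c 1%N) (c l)))) =
   a * E (fun c => g c * phi (r (c 1%N) (c l))).
  by rewrite -(EZ S _ (bmgt _ _ tp)); under eq_fun do rewrite mulrCA.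
by rewrite e (eq_bigr _ (fun l _ => e l)) -mulr_sumr; ring.
Qed.

(** Here [1 / n + (n - 1) / n = 1]. Constants are treated apart because the hypothesis starts at
    exponent 1. *)
Lemma gerr_cst1 : gerr r E n g (fun=> 1) = 0.
Proof.
rewrite /gerr (E_cst S).
have -> : (fun c => g c * 1) = g by apply/funext => c; rewrite mulr1.
rewrite sumr_const_nat subSS -[E g *+ _]mulr_natl natrB// .
by field; rewrite pnatr_eq0 -lt0n.
Qed.

Lemma E_norm_le h B : bm h -> (forall c, `|h c| <= B) -> `|E h| <= B.
Proof.
move=> bh hB; rewrite ler_norml; apply/andP; split.
  rewrite -(E_cst S (- B)); apply: (E_le S) => //; first exact: (bm_cst S).
  by move=> c; have := hB c; rewrite ler_norml => /andP[].
rewrite -[leRHS](E_cst S B); apply: (E_le S) => //; first exact: (bm_cst S).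
by move=> c; have := hB c; rewrite ler_norml => /andP[].
Qed.

Lemma gerr_bound phi B : tame phi -> 0 <= B ->
  (forall x y, `|phi (r x y)| <= B) -> `|gerr r E n g phi| <= 3 * B.
Proof.
move=> tp B0 pB.
have g1 c : `|g c| <= 1 by have := weight01 wg c; rewrite ler_norml; lra.
have Eg1 : `|E g| <= 1 by apply: E_norm_le.
have gp l : `|E (fun c => g c * phi (r (c 1%N) (c l)))| <= B.
  apply: E_norm_le; first exact: bmgt.
  by move=> c; rewrite normrM -[B]mul1r ler_pM.
have p12 : `|E (fun c => phi (r (c 1%N) (c 2%N)))| <= B by apply: E_norm_le => //; exact: bmt.
have n1 : `|n%:R^-1| <= 1 :> R.
  by rewrite ger0_norm ?invr_ge0// invf_le1 ?ltr0n// ler1n.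
rewrite /gerr; apply: le_trans (ler_normB _ _) _.
have a1 : `|n%:R^-1 * E g * E (fun c => phi (r (c 1%N) (c 2%N)))| <= B.
  rewrite !normrM -[leRHS]mul1r ler_pM// -[leRHS]mul1r ler_pM//.
have a2 : `|n%:R^-1 * \sum_(2 <= l < n.+1) E (fun c => g c * phi (r (c 1%N) (c l)))| <= B.
  rewrite normrM ger0_norm ?invr_ge0// ler_pdivrMl ?ltr0n//.
  apply: le_trans (ler_norm_sum _ _ _) _.
  apply: (@le_trans _ _ (\sum_(2 <= l < n.+1) B)); first exact: ler_sum.
  rewrite sumr_const_nat subSS -[leLHS]mulr_natl ler_wpM2r// ler_nat; exact: leq_subr.
have := ler_normB (E (fun c => g c * phi (r (c 1%N) (c n.+1))))
   (n%:R^-1 * E g * E (fun c => phi (r (c 1%N) (c 2%N)))).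
have := gp n.+1; move: a1 a2; lra.
Qed.

End Linearity.

Variable lam : nat -> rat.
Hypothesis lam_onto :
  forall q : rat, 0 <= q <= 1 -> exists2 n, (0 < n)%N & lam n = q.

Definition approx_gg (delta : R) (X : Type) (r : X -> X -> R * R)
    (E : ((nat -> X) -> R) -> R) :=
  forall n h1 h2 p : nat, (0 < n)%N -> n%:R <= delta^-1 ->
  (0 < h1)%N -> h1%:R <= delta^-1 -> (0 < h2)%N -> h2%:R <= delta^-1 ->
  (0 < p)%N -> p%:R <= delta^-1 -> forall g, weight r n g ->
  `|gerr r E n g (fun x => (ratr (lam h1) * x.1 + ratr (lam h2) * x.2) ^+ p)| <= delta.

(** The threshold [delta0] precedes the system and the weight, so closure under finite linear
    combinations preserves uniformity. *)
Definition good (M : nat) phi := tame phi /\ forall e : R, 0 < e -> exists2 delta0 : R,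
  0 < delta0 & forall X r E N bm delta, 0 < delta <= delta0 ->
  replicas r E N bm -> @approx_gg delta X r E ->
  forall n g, (0 < n < M)%N -> weight r n g -> `|gerr r E n g phi| <= e.

Variable M : nat.

Lemma goodD phi psi : good M phi -> good M psi -> good M (fun x => phi x + psi x).
Proof.
move=> [t1 H1] [t2 H2]; split; first exact: tameD.
move=> e e0; have e20 : 0 < e / 2 by rewrite divr_gt0.
have [d1 d10 {}H1] := H1 _ e20; have [d2 d20 {}H2] := H2 _ e20.
exists (Num.min d1 d2); first by rewrite lt_min d10.
move=> X r E N bm d; rewrite le_min => /and3P[d0 dd1 dd2] S G n g nM wg.
rewrite (gerrD S wg t1 t2); apply: le_trans (ler_normD _ _) _.
have := H1 X r E N bm d _ S G n g nM wg; have := H2 X r E N bm d _ S G n g nM wg.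
by rewrite d0 => /(_ dd2) h2 /(_ dd1) h1; lra.
Qed.

Lemma goodZ a phi : good M phi -> good M (fun x => a * phi x).
Proof.
move=> [t1 H1]; split; first exact: tameZ.
move=> e e0; have a0 : 0 < `|a| + 1 by rewrite ltr_wpDl.
have [|d d0 {}H1] := H1 (e / (`|a| + 1)); first by rewrite divr_gt0.
exists d => // X r E N bm d' dd S G n g nM wg.
rewrite (gerrZ S wg)// normrM.
apply: (@le_trans _ _ ((`|a| + 1) * (e / (`|a| + 1)))).
  apply: ler_pM => //; first by rewrite lerDl.
  exact: (H1 X r E N bm d').
by rewrite mulrC divfK// gt_eqF.
Qed.

Lemma good_cst a : good M (fun=> a).
Proof.
rewrite (_ : (fun=> a) = fun x : R * R => a * 1); last by apply/funext => x; rewrite mulr1.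
apply: goodZ; split; first exact: tame_cst.
move=> e e0; exists 1 => // X r E N bm d _ S _ n g /andP[n0 _] wg.
by rewrite (gerr_cst1 S)// normr0 ltW.
Qed.

Lemma good_sum (I : Type) (s : seq I) (F : I -> R * R -> R) :
  (forall i, good M (F i)) -> good M (fun x => \sum_(i <- s) F i x).
Proof.
move=> gF; elim: s => [|i s IH].
  by under eq_fun do rewrite big_nil; exact: good_cst.
by under eq_fun do rewrite big_cons; exact: goodD.
Qed.

Lemma good_power (q1 q2 : rat) p : 0 <= q1 <= 1 -> 0 <= q2 <= 1 -> (0 < p)%N ->
  good M (fun x => (ratr q1 * x.1 + ratr q2 * x.2) ^+ p).
Proof.
move=> /lam_onto[h1 h10 <-] /lam_onto[h2 h20 <-] p0; split.
  apply: tameX; apply: tameD; apply: tameZ; apply: tame_comb.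
    by constructor 1.
  by constructor 2.
(* [delta <= B^-1] admits every index of the hypothesis that is used: [n < M], [h1], [h2] and
   [p]. *)
move=> e e0; pose B : R := (M + h1 + h2 + p)%:R.
have B0 : 0 < B by rewrite /B ltr0n; lia.
exists (Num.min e B^-1); first by rewrite lt_min e0 invr_gt0.
move=> X r E N bm d; rewrite le_min => /and3P[d0 de dB] S G n g /andP[n0 nM] wg.
have inv k : (k <= M + h1 + h2 + p)%N -> k%:R <= d^-1.
  move=> k0; apply: (@le_trans _ _ B); first by rewrite ler_nat.
  by rewrite -[B]invrK lef_pV2 ?posrE ?invr_gt0.
by apply: le_trans (G n h1 h2 p _ _ _ _ _ _ _ _ _ _) de => //; apply: inv; lia.
Qed.

(** Weights that read off the coefficient of degree [b] of a polynomial of degree at most [p] from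
    its values at distinct nodes. The nodes are rationals in [0, 1], so they occur among the
    [lam n]. *)
Lemma vandermonde_weights (p b : nat) : (b <= p)%N -> exists w : 'I_p.+1 -> R,
  forall j, (j <= p)%N -> \sum_i w i * (i%:R / p.+1%:R) ^+ j = (j == b)%:R.
Proof.
move=> bp; pose a : 'rV[R]_p.+1 := \row_i (i%:R / p.+1%:R).
have V : Vandermonde p.+1 a \in unitmx.
  rewrite unitmxE det_Vandermonde unitfE; apply/prodf_neq0 => i _.
  apply/prodf_neq0 => j ij; rewrite !mxE -mulrBl mulf_neq0 ?invr_eq0 ?pnatr_eq0//.
  by rewrite subr_eq0 eqr_nat gtn_eqF.
pose w := invmx (Vandermonde p.+1 a) *m \col_i ((i : nat) == b)%:R.
exists (fun i => w i 0) => j jp.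
have := congr1 (fun A : 'cV[R]_p.+1 => A (Ordinal (jp : (j < p.+1)%N)) 0)
  (mulKVmx V (\col_i ((i : nat) == b)%:R)).
rewrite -/w !mxE /= => <-; apply: eq_bigr => i _.
by rewrite !mxE mulrC.
Qed.

(** With [p = a + b], the coefficient of [s ^ b] in [(x + s * y) ^ p] is the monomial times a
    binomial coefficient. *)
Lemma good_monomial a b : good M (fun x => x.1 ^+ a * x.2 ^+ b).
Proof.
have [ab0|ab0] := eqVneq (a + b)%N 0%N.
  have [-> ->] : a = 0%N /\ b = 0%N by clear -ab0; lia.
  by under eq_fun do rewrite !expr0 mulr1; exact: good_cst.
have [w Hw] := @vandermonde_weights (a + b) b (leq_addl _ _).
pose p := (a + b)%N.
rewrite (_ : (fun x => _) = fun x : R * R => ('C(p, b)%:R)^-1 *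
  \sum_(i < p.+1) w i * (ratr 1 * x.1 + ratr (i%:R / p.+1%:R) * x.2) ^+ p); last first.
  apply/funext => x.
  have e (i : 'I_p.+1) : w i * (ratr 1 * x.1 + ratr (i%:R / p.+1%:R) * x.2) ^+ p =
    \sum_(j < p.+1) (x.1 ^+ (p - j) * x.2 ^+ j *+ 'C(p, j)) * (w i * (i%:R / p.+1%:R) ^+ j).
    rewrite rmorph1 mul1r exprDn mulr_sumr; apply: eq_bigr => j _.
    by rewrite fmorph_div/= !ratr_nat exprMn; ring.
  rewrite (eq_bigr _ (fun i _ => e i)) exchange_big/=.
  under eq_bigr do rewrite -mulr_sumr.
  have bp : (b < p.+1)%N by rewrite ltnS leq_addl.
  rewrite (bigD1 (Ordinal bp))//= Hw ?leq_addl// eqxx mulr1 big1 ?addr0.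
    rewrite addnK; field; rewrite pnatr_eq0 -lt0n bin_gt0; exact: leq_addl.
  move=> j jb; have jp : (j <= p)%N by rewrite -ltnS.
  have jb' : (nat_of_ord j == b) = false.
    by apply: contraNF jb => /eqP e'; apply/eqP/val_inj.
  by rewrite (Hw _ jp) jb' mulr0.
apply: goodZ; apply: good_sum => i; apply: goodZ; apply: good_power.
- by rewrite ler01 lexx.
- by rewrite divr_ge0//= ler_pdivrMr// mul1r ler_nat ltnW.
- by rewrite lt0n.
Qed.

Lemma good_horner2 (q1 q2 : {poly R}) : good M (fun x => q1.[x.1] * q2.[x.2]).
Proof.
rewrite (_ : (fun x => _) = fun x : R * R => \sum_(i < size q1) \sum_(j < size q2)
   (q1`_i * q2`_j) * (x.1 ^+ i * x.2 ^+ j)).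
  by apply: good_sum => i; apply: good_sum => j; apply: goodZ; exact: good_monomial.
apply/funext => x; rewrite !horner_coef mulr_suml; apply: eq_bigr => i _.
by rewrite mulr_sumr; apply: eq_bigr => j _; ring.
Qed.

Lemma good_horner_sum (q : {poly R}) : good M (fun x => q.[x.1 + x.2]).
Proof.
rewrite (_ : (fun x => _) = fun x : R * R => \sum_(i < size q)
   q`_i * (x.1 + x.2) ^+ i).
  apply: good_sum => -[[|i] im]; apply: goodZ => /=.
    by under eq_fun do rewrite expr0; exact: good_cst.
  rewrite (_ : (fun x => _) = fun x : R * R => (ratr 1 * x.1 + ratr 1 * x.2) ^+ i.+1).
    by apply: good_power => //; rewrite ler01 lexx.
  by apply/funext => x; rewrite rmorph1 !mul1r.
by apply/funext => x; rewrite horner_coef.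
Qed.

(** Finitely many thresholds have a positive minimum, and it serves all coefficient vectors bounded
    by 1 at once: test functions range over an infinite set, their approximants over these
    combinations. *)
Lemma good_unif (I : finType) (F : I -> R * R -> R) : (forall i, good M (F i)) ->
  forall e : R, 0 < e -> exists2 delta0 : R, 0 < delta0 &
  forall X r E N bm delta, 0 < delta <= delta0 ->
  replicas r E N bm -> @approx_gg delta X r E ->
  forall n g, (0 < n < M)%N -> weight r n g ->
  forall a : I -> R, (forall i, `|a i| <= 1) ->
  `|gerr r E n g (fun x => \sum_i a i * F i x)| <= e.
Proof.
move=> gF e e0.
have eI : 0 < e / #|I|.+1%:R by rewrite divr_gt0.
(* A choice of threshold for each [F i]; the default value 1 never occurs, since [gF] provides a
   threshold. *)
pose d i := xget 1 [set d : R | 0 < d /\ forall X r E N bm delta, 0 < delta <= d ->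
  replicas r E N bm -> @approx_gg delta X r E ->
  forall n g, (0 < n < M)%N -> weight r n g -> `|gerr r E n g (F i)| <= e / #|I|.+1%:R].
have dP i : 0 < d i /\ forall X r E N bm delta, 0 < delta <= d i ->
  replicas r E N bm -> @approx_gg delta X r E ->
  forall n g, (0 < n < M)%N -> weight r n g -> `|gerr r E n g (F i)| <= e / #|I|.+1%:R.
  rewrite /d; case: xgetP => [y _ //|nex]; exfalso.
  have [d0 d00 H] := (gF i).2 _ eI.
  by apply: (nex d0).
exists (\big[Num.min/1]_i d i).
  by elim/big_ind : _ => // [x y x0 y0|i _]; [rewrite lt_min x0|exact: (dP i).1].
move=> X r E N bm delta /andP[delta0 deltad] S G n g nM wg a a1.
have key (s : seq I) : tame (fun x => \sum_(i <- s) a i * F i x) /\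
    `|gerr r E n g (fun x => \sum_(i <- s) a i * F i x)| <= \sum_(i <- s) e / #|I|.+1%:R.
  elim: s => [|i s [IHt IH]].
    rewrite big_nil; split; under eq_fun do rewrite big_nil; first exact: tame_cst.
    have -> : (fun=> 0) = (fun x : R * R => 0 * 1 : R) by apply/funext => x; rewrite mulr1.
    by rewrite (gerrZ S wg _ (tame_cst 1)) mul0r normr0.
  have ti := tameZ (a i) (gF i).1.
  split; first by under eq_fun do rewrite big_cons; exact: tameD.
  rewrite big_cons; under eq_fun do rewrite big_cons.
  rewrite (gerrD S wg)//; apply: le_trans (ler_normD _ _) _; rewrite lerD//.
  rewrite (gerrZ S wg _ (gF i).1) normrM -[leRHS]mul1r ler_pM//.
  apply: ((dP i).2 X r E N bm delta _ S G n g nM wg); rewrite delta0/=.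
  by apply: le_trans deltad _; rewrite (bigminD1 i)// ge_min lexx.
apply: le_trans (key _).2 _.
rewrite sumr_const -[leLHS]mulr_natl mulrA ler_pdivrMr// mulrC.
by rewrite ler_wpM2l ?(ltW e0)// ler_nat.
Qed.

Lemma box_range (X : Type) (r : X -> X -> R * R) E N bm :
  replicas r E N bm -> forall x y,
  [/\ -2 <= (r x y).1 <= 2, -2 <= (r x y).2 <= 2 & -2 <= (r x y).1 + (r x y).2 <= 2].
Proof.
by move=> S x y; have [] := r_bnd S x y; rewrite !ler_norml => h1 h2; split; lra.
Qed.

Lemma tame_approx (phi psi : R * R -> R) (e1 e2 : R) (X : Type) (r : X -> X -> R * R)
    E N bm n g : replicas r E N bm -> (0 < n)%N -> weight r n g ->
  tame phi -> tame psi -> 0 <= e1 -> (forall x y, `|psi (r x y) - phi (r x y)| <= e1) ->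
  `|gerr r E n g psi| <= e2 -> `|gerr r E n g phi| <= 3 * e1 + e2.
Proof.
move=> S n0 wg tp tq e10 pq ge.
have td : tame (fun x => phi x + (-1) * psi x) by apply: tameD => //; exact: tameZ.
have e : phi = fun x => (phi x + (-1) * psi x) + psi x.
  by apply/funext => x; ring.
rewrite {1}e (gerrD S wg td tq); apply: le_trans (ler_normD _ _) _; rewrite lerD//.
apply: (gerr_bound S n0 wg td e10) => x y.
by rewrite mulN1r distrC.
Qed.

Lemma GG_of_approx_gg : (0 < M)%N -> exists2 delta : R, 0 < delta &
  forall X r E N bm, replicas r E N bm -> @approx_gg delta X r E -> GG r E M.
Proof.
(* Approximation enters the three terms of [gerr], with two factors in a product test, and 3 * 2 /
   (12 M) = 1 / (2 M). The other half is left to the defect of the polynomial. *)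
move=> M0; have e0 : 0 < (12 * M%:R)^-1 :> R by rewrite invr_gt0 mulr_gt0// ltr0n.
have e60 : 0 < (2 * M%:R)^-1 :> R by rewrite invr_gt0 mulr_gt0// ltr0n.
have [m Hm] := bernstein_approx M e0.
have [d1 d10 H1] := @good_unif ('I_m.+1 * 'I_m.+1)%type
  (fun k x => (bernstein_basis R m k.1).[x.1] * (bernstein_basis R m k.2).[x.2])
  (fun k => good_horner2 _ _) _ e60.
have [d2 d20 H2] := @good_unif 'I_m.+1
  (fun k x => (bernstein_basis R m k).[x.1 + x.2])
  (fun k => good_horner_sum _) _ e60.
have dmin : 0 < Num.min d1 d2 by rewrite lt_min d10.
exists (Num.min d1 d2) => // X r E N bm S G n g phi nM wg tphi.
have [n0 _] := andP nM.
have tp := gg_test_tame tphi.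
have dd1 : 0 < Num.min d1 d2 <= d1 by rewrite dmin ge_min lexx.
have dd2 : 0 < Num.min d1 d2 <= d2 by rewrite dmin ge_min lexx orbT.
have e2 : 3 * (2 * (12 * M%:R)^-1) + (2 * M%:R)^-1 = M%:R^-1 :> R.
  by field; rewrite pnatr_eq0 -lt0n.
have box := box_range S.
case: tphi => u [v [ul vl e]]; rewrite -e2.
have unit01 (f : R -> R) k : lip M f -> `|f k| <= 1.
  by move=> [f01 _]; rewrite ler_norml; have := f01 k; lra.
have B1 (f : R -> R) x : lip M f -> -2 <= x <= 2 ->
    `|(bernstein m (fun k => f (node R m k))).[x]| <= 1.
  move=> [f01 _] hx; rewrite ler_norml; apply/andP; split.
    rewrite -[leLHS](bernstein_cst m _ x); apply: bernstein_le => // k _.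
    by have := f01 (node R m k); lra.
  rewrite -[leRHS](bernstein_cst m _ x); apply: bernstein_le => // k _.
  by have := f01 (node R m k); lra.
have e120 : 0 <= 2 * (12 * M%:R)^-1 :> R by rewrite mulr_ge0// ltW.
case: e => e.
  pose bu := bernstein m (fun k => u (node R m k)).
  pose bv := bernstein m (fun k => v (node R m k)).
  apply: (@tame_approx phi (fun x => bu.[x.1] * bv.[x.2]) _ _ X r E N bm n g S n0 wg tp) => //.
  - by apply: tameM; apply: tame_horner; apply: tame_comb; [constructor 1|constructor 2].
  - move=> x y; rewrite e; have [b1 b2 _] := box x y.
    set s := (r x y).1 in b1 *; set t := (r x y).2 in b2 *.
    have -> : bu.[s] * bv.[t] - u s * v t = (bu.[s] - u s) * bv.[t] + u s * (bv.[t] - v t).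
      by ring.
    apply: le_trans (ler_normD _ _) _; rewrite [leRHS]mulr_natl mulr2n !normrM lerD//.
      by rewrite -[leRHS]mulr1 ler_pM//; [exact: Hm|exact: B1].
    by rewrite -[leRHS]mul1r ler_pM//; [exact: unit01|exact: Hm].
  - rewrite (_ : (fun x : R * R => _) = fun x : R * R => \sum_(k : 'I_m.+1 * 'I_m.+1)
      (u (node R m k.1) * v (node R m k.2)) *
      ((bernstein_basis R m k.1).[x.1] * (bernstein_basis R m k.2).[x.2])).
      apply: (H1 X r E N bm _ dd1 S G n g nM wg (fun k => u (node R m k.1) * v (node R m k.2))) => k.
      by rewrite normrM mulr_ile1// unit01.
    apply/funext => x.
    rewrite -(pair_bigA _ (fun i j : 'I_m.+1 => (u (node R m i) * v (node R m j)) *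
      ((bernstein_basis R m i).[x.1] * (bernstein_basis R m j).[x.2])))/=.
    rewrite /bu /bv !(bernstein_basisE m) mulr_suml; apply: eq_bigr => i _.
    by rewrite mulr_sumr; apply: eq_bigr => j _; ring.
pose bu := bernstein m (fun k => u (node R m k)).
apply: (@tame_approx phi (fun x => bu.[x.1 + x.2]) _ _ X r E N bm n g S n0 wg tp) => //.
- by apply: (tame_horner bu (phi := fun x => x.1 + x.2)); apply: tame_comb; constructor 3.
- move=> x y; rewrite e; have [_ _ b3] := box x y.
  apply: le_trans (Hm _ ul _ b3) _.
  by rewrite ler_peMl ?ler1n// ltW.
- rewrite (_ : (fun x : R * R => _) = fun x : R * R => \sum_(k : 'I_m.+1)
      u (node R m k) * (bernstein_basis R m k).[x.1 + x.2]).
    by apply: (H2 X r E N bm _ dd2 S G n g nM wg (fun k => u (node R m k))) => k; exact: unit01.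
  by apply/funext => x; rewrite /bu (bernstein_basisE m).
Qed.

End PolynomialTests.

(** * The replica measure *)

Section Configurations.
Context d (X : measurableType d).

Definition cylinders : set (set (nat -> X)) :=
  [set B | exists i, exists2 A, measurable A & B = (fun c => c i) @^-1` A].

(** An alias of [nat -> X] that carries the product sigma-algebra. *)
Definition config := g_sigma_algebraType cylinders.
HB.instance Definition _ := Measurable.on config.

Lemma measurable_coord i : measurable_fun setT (fun c : config => c i).
Proof.
move=> _ A mA; rewrite setTI; apply: sub_sigma_algebra.
by exists i, A.
Qed.

Lemma measurable_config d' (T : measurableType d') (f : T -> config) :
  (forall i, measurable_fun setT (fun t => f t i)) -> measurable_fun setT f.
Proof.
move=> mf; apply: (@measurability _ _ T config setT f cylinders); first by [].
by move=> _ [B [i [A mA ->]] <-]; exact: (mf i).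
Qed.

Lemma measurable_upd k : measurable_fun setT (fun p : config * X => upd p.1 k p.2 : config).
Proof.
apply: measurable_config => i; rewrite /upd; case: eqP => _; first exact: measurable_snd.
exact: (measurableT_comp (measurable_coord i)).
Qed.

End Configurations.

(** * Probability kernels and repackaged probability measures *)

Section KernelPullback.
Context d1 d2 d3 (T1 : measurableType d1) (T2 : measurableType d2)
  (T3 : measurableType d3) (R : realType).
Variables (h : T1 -> T2) (mh : measurable_fun setT h) (k : R.-pker T2 ~> T3).

(** The measurability proof is an argument, so that the kernel structure built from it can be
    inferred from the term. *)
Definition kpullback & measurable_fun setT h : T1 -> {measure set T3 -> \bar R} :=
  fun x => k (h x).

Let mk U : measurable U -> measurable_fun [set: T1] (kpullback mh ^~ U).
Proof.
by move=> mU; apply: (measurableT_comp (measurable_kernel k _ mU) mh).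
Qed.

HB.instance Definition _ := isKernel.Build _ _ _ _ R (kpullback mh) mk.

Let k1 x : kpullback mh x setT = 1%E. Proof. exact: prob_kernel. Qed.

HB.instance Definition _ := Kernel_isProbability.Build _ _ _ _ R (kpullback mh) k1.

End KernelPullback.

Section KernelComposition.
Context d1 d2 d3 (T1 : measurableType d1) (T2 : measurableType d2)
  (T3 : measurableType d3) (R : realType).
Variables (l : R.-pker T1 ~> T2) (k : R.-pker (T1 * T2) ~> T3).

Definition kcomp_prob : T1 -> {measure set T3 -> \bar R} := mkcomp l k.

Let mk U : measurable U -> measurable_fun [set: T1] (kcomp_prob ^~ U).
Proof. exact: measurable_fun_mkcomp_sfinite. Qed.

HB.instance Definition _ := isKernel.Build _ _ _ _ R kcomp_prob mk.

Let k1 x : kcomp_prob x setT = 1%E.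
Proof.
rewrite /kcomp_prob /mkcomp/= /kcomp.
under eq_integral do rewrite prob_kernel.
by rewrite integral_cst// mul1e prob_kernel.
Qed.

HB.instance Definition _ := Kernel_isProbability.Build _ _ _ _ R kcomp_prob k1.

End KernelComposition.

Section ProbabilityOfMeasure.
Context (R : realType) d (T : measurableType d) (mu : {measure set T -> \bar R}).
Hypothesis mu1 : mu setT = 1%E.

Definition prob_copy & mu setT = 1%E : set T -> \bar R := mu.
HB.instance Definition _ := Measure.copy (prob_copy mu1) mu.
HB.instance Definition _ := Measure_isProbability.Build _ _ _ (prob_copy mu1) mu1.

Lemma probability_of_measure : exists Q : probability T R, (Q : set T -> \bar R) = mu.
Proof. by exists (prob_copy mu1). Qed.

End ProbabilityOfMeasure.


Section ReplicaKernel.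
Context (R : realType) dO dX (O : measurableType dO) (X : measurableType dX).
Variables (P : probability O R) (G : R.-pker O ~> X).
Local Notation cfg := (config X).

(** The iterated integral becomes one integral against a kernel, built from the Dirac kernel by
    composition with [G]. Joint measurability in the environment and the configuration comes with
    it. *)
Lemma rint_kernel k : exists K : R.-pker (O * cfg) ~> cfg, forall w c f,
  (forall c, 0 <= f c)%E -> measurable_fun setT f ->
  (\int[K (w, c)]_c' f c' = rint G w k f c)%E.
Proof.
elim: k => [|k [K HK]].
  exists (kdirac (@measurable_snd _ _ O cfg)) => w c f f0 mf /=.
  by rewrite /kdirac/= integral_dirac//= diracT mul1e.
have mh : measurable_fun setT
    (fun z : (O * cfg) * X => (z.1.1, upd z.1.2 k.+1 z.2 : cfg)).
  apply: measurable_fun_pair; first exact: measurableT_comp.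
  have mp : measurable_fun setT (fun z : (O * cfg) * X => (z.1.2, z.2)).
    by apply: measurable_fun_pair => //; exact: measurableT_comp.
  exact: (measurableT_comp (measurable_upd k.+1) mp).
exists (kcomp_prob (kpullback G (@measurable_fst _ _ O cfg)) (kpullback K mh)).
move=> w c f f0 mf; rewrite /kcomp_prob integral_kcomp//=.
by apply: eq_integral => x _; rewrite /kpullback/= HK.
Qed.

Lemma replica_measure N : exists Q : probability cfg R, forall f,
  (forall c, 0 <= f c)%E -> measurable_fun setT f ->
  (\int[Q]_c f c = EG P G N f)%E.
Proof.
have [K HK] := rint_kernel N.
have mh : measurable_fun setT
    (fun z : unit * O => (z.2, (fun=> point) : cfg)).
  by apply: measurable_fun_pair.
(* [P] is viewed as a kernel from a one-point space, so that kernel composition applies to it. *)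
have mP : measurable_fun setT (fun _ : unit => P : pprobability O R).
  exact: measurable_cst.
pose L := kcomp_prob (kprobability mP) (kpullback K mh).
have L1 : L tt setT = 1%E by exact: prob_kernel.
have [Q QL] := probability_of_measure L1; exists Q => f f0 mf.
rewrite QL /L /kcomp_prob integral_kcomp//=.
by apply: eq_integral => w _; rewrite /kpullback/= HK.
Qed.

End ReplicaKernel.

Definition bounded_measurable (R : realType) d (T : measurableType d) (f : T -> R) :=
  measurable_fun setT f /\ exists B : R, forall t, `|f t| <= B.

Section BoundedIntegral.
Context (R : realType) d (T : measurableType d).
Variables (mu : {measure set T -> \bar R}) (mu1 : mu setT = 1%E).

Lemma bm_integrable (f : T -> R) : bounded_measurable f ->
  mu.-integrable setT (EFin \o f).
Proof.
move=> [mf [B fB]]; apply: measurable_bounded_integrable => //.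
  by rewrite mu1 ltry.
exists B; split; first exact: num_real.
by move=> x Bx y _ /=; apply: le_trans (fB y) (ltW Bx).
Qed.

Lemma integral_shift (f : T -> R) (B : R) : bounded_measurable f ->
  (\int[mu]_x (f x + B)%:E = \int[mu]_x (f x)%:E + B%:E)%E.
Proof.
move=> bf; under eq_integral do rewrite EFinD.
rewrite integralD//; first by rewrite integral_cst// mu1 mule1.
- exact: bm_integrable.
- apply: (@bm_integrable (fun=> B)); split; first exact: measurable_cst.
  by exists `|B|.
Qed.

Lemma integral_fin (f : T -> R) : bounded_measurable f ->
  (\int[mu]_x (f x)%:E = (\int[mu]_x f x)%:E)%E.
Proof.
move=> bf; rewrite /Rintegral fineK//.
by apply: integrable_fin_num => //; exact: bm_integrable.
Qed.

End BoundedIntegral.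

(** * Iterated Gibbs averages under a single replica measure *)

Section Replicas.
Context (R : realType) dO dX (O : measurableType dO) (X : measurableType dX).
Variables (P : probability O R) (G : R.-pker O ~> X).
Local Notation cfg := (config X).

Let G1 w : G w setT = 1%E. Proof. exact: prob_kernel. Qed.

Lemma measurable_rint k (f : cfg -> \bar R) : (forall c, 0 <= f c)%E ->
  measurable_fun setT f -> measurable_fun setT (fun z : O * cfg => rint G z.1 k f z.2).
Proof.
move=> f0 mf; have [K HK] := rint_kernel G k.
rewrite (_ : (fun z => _) = fun z => (\int[K z]_c f c)%E).
  apply: measurable_fun_integral_kernel => // U mU; exact: measurable_kernel.
by apply/funext => -[w c]; rewrite HK.
Qed.

Lemma rint_range k (f : cfg -> R) (B : R) : measurable_fun setT f ->
  (forall c, 0 <= f c <= B) -> forall w c,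
  (0 <= rint G w k (fun c => (f c)%:E) c <= B%:E)%E.
Proof.
move=> mf fB w c; have [K HK] := rint_kernel G k.
have f0 c' : (0 <= (f c')%:E)%E by rewrite lee_fin; have /andP[] := fB c'.
rewrite -HK//; last exact/measurable_EFinP.
apply/andP; split; first exact: integral_ge0.
apply: (@le_trans _ _ (\int[K (w, c)]_x B%:E)%E).
  apply: ge0_le_integral => //; first exact/measurable_EFinP.
  by move=> x _; rewrite lee_fin; have /andP[] := fB x.
by rewrite integral_cst// prob_kernel mule1.
Qed.

(** The kernel formula concerns nonnegative functions. A bounded [f] is reached through [f + B], and
    the shift comes out of each integral unchanged because [G w] has mass 1. *)
Lemma rint_real k (f : cfg -> R) (B : R) : measurable_fun setT f ->
  (forall c, `|f c| <= B) -> exists u : O * cfg -> R, [/\ measurable_fun setT u,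
    (forall z, `|u z| <= B), (forall w c, rint G w k (fun c => (f c)%:E) c = (u (w, c))%:E) &
    (forall w c, rint G w k (fun c => (f c + B)%:E) c = (u (w, c) + B)%:E)].
Proof.
move=> mf fB.
have mfB : measurable_fun setT (fun c : cfg => f c + B) by apply: measurable_funD.
have fB2 c : 0 <= f c + B <= B + B by have := fB c; rewrite ler_norml; lra.
have fB0 c : (0 <= (f c + B)%:E)%E by rewrite lee_fin; have /andP[] := fB2 c.
have rB k' := rint_range k' mfB fB2.
pose u k' (z : O * cfg) := fine (rint G z.1 k' (fun c => (f c + B)%:E) z.2) - B.
have uE k' w c : rint G w k' (fun c => (f c + B)%:E) c = (u k' (w, c) + B)%:E.
  rewrite /u/= subrK fineK// fin_numE; have /andP[h1 h2] := rB k' w c.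
  by rewrite -ltey -ltNye (lt_le_trans _ h1)// (le_lt_trans h2)// ltry.
have uB k' z : `|u k' z| <= B.
  case: z => w c; have := rB k' w c; rewrite uE !lee_fin ler_norml; lra.
have mu k' : measurable_fun setT (u k').
  apply: measurable_funB => //; apply: measurableT_comp => //.
  by apply: measurable_rint => //; exact/measurable_EFinP.
exists (u k); split => // w; elim: k => [|k IH] c.
  by rewrite /= /u/= addrK.
have bu : bounded_measurable (fun x : X => u k (w, upd c k.+1 x : cfg)).
  split; last by exists B => x.
  apply: measurableT_comp => //; apply: measurable_fun_pair => //.
  have mp : measurable_fun setT (fun x : X => (c : cfg, x)) by exact: measurable_fun_pair.
  exact: (measurableT_comp (measurable_upd k.+1) mp).
have /= := uE k.+1 w c; under eq_integral do rewrite uE.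
rewrite (integral_shift (G1 w) _ bu) (integral_fin (G1 w) bu) -EFinD => -[] /addIr <-.
by under eq_integral do rewrite IH; rewrite (integral_fin (G1 w) bu).
Qed.

Variable N : nat.

Lemma replica_expectation : exists Q : probability cfg R, forall f : cfg -> R,
  bounded_measurable f ->
  EG P G N (fun c => (f c)%:E) = (\int[Q]_c f c)%:E.
Proof.
have [Q HQ] := replica_measure P G N; exists Q => f bf; have [mf [B fB]] := bf.
have Q1 : Q setT = 1%E by exact: probability_setT.
have P1 : P setT = 1%E by exact: probability_setT.
have [u [mu uB u1 u2]] := rint_real N mf fB.
have bu : bounded_measurable (fun w : O => u (w, (fun=> point) : cfg)).
  split; last by exists B => w.
  by apply: measurableT_comp => //; exact: measurable_fun_pair.
have EB : EG P G N (fun c => (f c + B)%:E) =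
    (\int[P]_w u (w, (fun=> point) : cfg) + B)%:E.
  rewrite /EG; under eq_integral do rewrite u2.
  by rewrite (integral_shift P1 _ bu) (integral_fin P1 bu) -EFinD.
have EQ : (\int[Q]_c (f c + B)%:E = (\int[Q]_c f c + B)%:E)%E.
  by rewrite (integral_shift Q1 _ bf) (integral_fin Q1 bf) -EFinD.
have := HQ (fun c => (f c + B)%:E); rewrite EB EQ => h.
rewrite /EG; under eq_integral do rewrite u1.
rewrite (integral_fin P1 bu); congr (_%:E).
have h1 c : (0 <= (f c + B)%:E)%E.
  by rewrite lee_fin; have := fB c; rewrite ler_norml; lra.
have h2 : measurable_fun setT (fun c : cfg => (f c + B)%:E).
  by apply/measurable_EFinP/measurable_funD.
by have := h h1 h2; case=> /addIr ->.
Qed.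

Lemma rint_upd (f : (nat -> X) -> \bar R) j : (forall c x, f (upd c j x) = f c) ->
  forall w k c x, rint G w k f (upd c j x) = rint G w k f c.
Proof.
move=> fj w; elim=> [|k IH] c x /=; first exact: fj.
apply: eq_integral => y _.
have [e|e] := eqVneq k.+1 j.
  congr (rint _ _ _ _ _); apply/funext => i; rewrite /upd e.
  by case: eqP.
rewrite -[RHS](IH _ x); congr (rint _ _ _ _ _); apply/funext => i; rewrite /upd.
have [->|//] := eqVneq i k.+1; by rewrite (negbTE e).
Qed.

(** A replica that [f] does not read is integrated against mass 1. Averages over different numbers
    of replicas thus become expectations under one measure. *)
Lemma EG_local (f : (nat -> X) -> \bar R) n : (n <= N)%N ->
  (forall j c x, (n < j)%N -> f (upd c j x) = f c) -> EG P G N f = EG P G n f.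
Proof.
move=> nN fj; rewrite -(subnKC nN); elim: (N - n)%N => [|k <-]; first by rewrite addn0.
rewrite addnS; apply: eq_integral => w _ /=.
rewrite (eq_integral (cst (rint G w (n + k) f (fun=> point)))).
  by rewrite integral_cst// G1 mule1.
move=> x _; rewrite rint_upd// => c y; apply: fj; rewrite ltnS; exact: leq_addr.
Qed.

Lemma upd_sw i j k (c : nat -> X) x : k != i -> k != j ->
  upd (sw i j c) k x = sw i j (upd c k x).
Proof.
move=> /negbTE ki /negbTE kj; apply/funext => m; rewrite /upd /sw.
case: (eqVneq m k) => [->|mk]; first by rewrite ki kj eqxx.
case: (m == i); first by rewrite eq_sym kj.
case: (m == j); first by rewrite eq_sym ki.
by rewrite (negbTE mk).
Qed.

Lemma rint_sw_high (f : (nat -> X) -> \bar R) i j w k : (k < i)%N -> (k < j)%N ->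
  forall c, rint G w k (f \o sw i j) c = rint G w k f (sw i j c).
Proof.
elim: k => [//|k IH] ki kj c /=; apply: eq_integral => x _.
rewrite IH ?(ltnW ki) ?(ltnW kj)// upd_sw//.
  by rewrite ltn_eqF.
by rewrite ltn_eqF.
Qed.

(** Adjacent replicas are integrated consecutively, so one use of Tonelli's theorem exchanges
    them. *)
Lemma rint_sw_adjacent (f : cfg -> \bar R) : (forall c, 0 <= f c)%E ->
  measurable_fun setT f -> forall w i k, (0 < i)%N -> (i < k)%N -> forall c,
  rint G w k (f \o sw i i.+1) c = rint G w k f c.
Proof.
move=> f0 mf w [//|i] k _; elim: k => [//|k IH]; rewrite ltnS leq_eqVlt => /orP[/eqP<-|ik] c.
  have [Gw GwE] := probability_of_measure (G1 w).
  pose phi (z : X * X) := rint G w i f (upd (upd c i.+2 z.1) i.+1 z.2).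
  have mphi : measurable_fun setT phi.
    have m1 : measurable_fun setT (fun z : X * X => upd c i.+2 z.1 : cfg).
      have mp : measurable_fun setT (fun z : X * X => (c : cfg, z.1)).
        exact: measurable_fun_pair.
      exact: (measurableT_comp (measurable_upd i.+2) mp).
    have m2 : measurable_fun setT (fun z : X * X => upd (upd c i.+2 z.1) i.+1 z.2 : cfg).
      have mp : measurable_fun setT (fun z : X * X => (upd c i.+2 z.1 : cfg, z.2)).
        exact: measurable_fun_pair.
      exact: (measurableT_comp (measurable_upd i.+1) mp).
    have m3 : measurable_fun setT (fun z : X * X => (w, upd (upd c i.+2 z.1) i.+1 z.2 : cfg)).
      exact: measurable_fun_pair.
    exact: (measurableT_comp (measurable_rint i f0 mf) m3).
  have phi0 z : (0 <= phi z)%E.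
    have [K HK] := rint_kernel G i.
    by rewrite /phi -HK//; exact: integral_ge0.
  have F : (\int[G w]_x \int[G w]_y phi (y, x) = \int[G w]_x \int[G w]_y phi (x, y))%E.
    by rewrite -!GwE; exact/esym/(@fubini_tonelli _ _ X X R Gw Gw phi mphi phi0).
  rewrite /=; transitivity (\int[G w]_x \int[G w]_y phi (y, x))%E; last by rewrite F.
  apply: eq_integral => x _; apply: eq_integral => y _.
  rewrite /phi/= rint_sw_high//; congr (rint _ _ _ _ _); apply/funext => m.
  rewrite /sw /upd.
  case: (eqVneq m i.+1) => [_|m1]; first by rewrite gtn_eqF// eqxx.
  case: (eqVneq m i.+2) => [_|m2]; first by rewrite eqxx.
  by rewrite (negbTE m1) (negbTE m2).
by apply: eq_integral => x _; exact: IH.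
Qed.

End Replicas.

(** * Borel functions on the plane *)

Section Plane.
Variable R : realType.

Lemma open_measurable_plane (U : set (R * R)) : open U -> measurable U.
Proof.
move=> oU.
pose box (a1 b1 a2 b2 : rat) : set (R * R) :=
  `]ratr a1, ratr b1[%classic `*` `]ratr a2, ratr b2[%classic.
(* Boxes not contained in [U] are replaced by the empty set, so that the unions run over all
   rationals. *)
pose F a1 b1 a2 b2 := if `[< box a1 b1 a2 b2 `<=` U >] then box a1 b1 a2 b2 else set0.
have -> : U = \bigcup_a1 \bigcup_b1 \bigcup_a2 \bigcup_b2 F a1 b1 a2 b2.
  apply/seteqP; split => [x Ux|x [a1 _] [b1 _] [a2 _] [b2 _]]; last first.
    by rewrite /F; case: asboolP => // qU; exact: qU.
  have /nbhs_ballP[e /= e0 eU] : nbhs x U by exact: open_nbhs_nbhs.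
  have lo (y : R) : y - e < y by rewrite gtrBl.
  have hi (y : R) : y < y + e by rewrite ltrDl.
  have [a1 /itvP a1P] := rat_in_itvoo (lo x.1).
  have [b1 /itvP b1P] := rat_in_itvoo (hi x.1).
  have [a2 /itvP a2P] := rat_in_itvoo (lo x.2).
  have [b2 /itvP b2P] := rat_in_itvoo (hi x.2).
  exists a1 => //; exists b1 => //; exists a2 => //; exists b2 => //.
  rewrite /F; case: asboolP => [_|].
    by split => /=; rewrite in_itv/= ?a1P ?b1P ?a2P ?b2P.
  case=> -[y1 y2] [/=]; rewrite !in_itv/= => /andP[h1 h2] /andP[h3 h4].
  have k1 : x.1 - e < ratr a1 by rewrite a1P.
  have k2 : ratr b1 < x.1 + e by rewrite b1P.
  have k3 : x.2 - e < ratr a2 by rewrite a2P.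
  have k4 : ratr b2 < x.2 + e by rewrite b2P.
  apply: eU; split; rewrite /ball/= ltr_norml.
    by move: h1 h2 k1 k2; clear; lra.
  by move: h3 h4 k3 k4; clear; lra.
do 4 (apply: bigcupT_measurable_rat => ?).
by rewrite /F; case: asboolP => // _; apply: measurableX.
Qed.

Lemma continuous_measurable_plane (f : R * R -> R) :
  continuous f -> measurable_fun setT f.
Proof.
move=> cf; apply: (measurability (@RGenOInfty.G R) (RGenOInfty.measurableE R)).
move=> _ [_ [a ->] <-]; rewrite setTI; apply: open_measurable_plane.
by apply: open_comp; [move=> x _; exact: cf|exact: interval_open].
Qed.

End Plane.

(** * Inequalities for inner products *)

Section Hilbert.
Context (R : realType) (V : normedModType R) (ip : V -> V -> R).
Hypothesis hip : is_hilbert_ip ip.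

Lemma ip_sym x y : ip x y = ip y x. Proof. by case: hip. Qed.
Lemma ip_linear a x y z : ip (a *: x + y) z = a * ip x z + ip y z.
Proof. by case: hip. Qed.
Lemma ip_ge0 x : 0 <= ip x x.
Proof. by case: hip => _ _ ->; rewrite sqr_ge0. Qed.

Lemma ip0 z : ip 0 z = 0.
Proof. by have := ip_linear 1 0 0 z; rewrite scaler0 addr0 mul1r; lra. Qed.

Lemma ipD x y z : ip (x + y) z = ip x z + ip y z.
Proof. by have := ip_linear 1 x y z; rewrite scale1r mul1r. Qed.

Lemma ip_sum m (x : nat -> V) z : ip (\sum_(i < m) x i) z = \sum_(i < m) ip (x i) z.
Proof.
elim: m => [|m IH]; first by rewrite !big_ord0 ip0.
by rewrite !big_ord_recr/= ipD IH.
Qed.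

(** Expanding the squared norms of [x + y] and [x - y] gives [2 * |ip x y| <= ip x x + ip y y]. *)
Lemma ip_unit_ball x y : `|x| <= 1 -> `|y| <= 1 -> `|ip x y| <= 1.
Proof.
have sq z : `|z| <= 1 -> ip z z <= 1.
  by case: hip => _ _ -> z1; rewrite expr_le1.
move=> /sq x1 /sq y1.
have := ip_ge0 (1 *: x + y); have := ip_ge0 ((-1) *: x + y).
rewrite !ip_linear !(ip_sym _ (_ *: _ + _)) !ip_linear (ip_sym y x) ler_norml; lra.
Qed.

(** The right side is the squared norm of [t z + sum x - sum y]. *)
Lemma ip_psd m (z : V) (x y : nat -> V) (t : R) :
  0 <= t ^+ 2 * ip z z + 2 * t * \sum_(i < m) (ip z (x i) - ip z (y i))
       + (\sum_(i < m) \sum_(j < m) ip (x i) (x j)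
       + \sum_(i < m) \sum_(j < m) ip (y i) (y j)
       - 2 * \sum_(i < m) \sum_(j < m) ip (x i) (y j)).
Proof.
pose A := \sum_(i < m) x i; pose B := \sum_(i < m) y i.
have dbl (u v : nat -> V) : \sum_(i < m) \sum_(j < m) ip (u i) (v j) =
    ip (\sum_(i < m) u i) (\sum_(i < m) v i).
  rewrite ip_sum; apply: eq_bigr => i _.
  by rewrite ip_sym ip_sum; apply: eq_bigr => j _; rewrite ip_sym.
have zA (u : nat -> V) : \sum_(i < m) ip z (u i) = ip z (\sum_(i < m) u i).
  by rewrite ip_sym ip_sum; apply: eq_bigr => j _; rewrite ip_sym.
rewrite !dbl sumrB !zA -/A -/B.
have := ip_ge0 (t *: z + ((-1) *: B + A)).
rewrite !ip_linear !(ip_sym _ (_ *: _ + _)) !ip_linear.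
by rewrite (ip_sym B z) (ip_sym A z) (ip_sym B A); lra.
Qed.

End Hilbert.

(** * Expectations of bounded measurable functions *)

Section BoundedMeasurable.
Context (R : realType) d (T : measurableType d).
Implicit Types f g : T -> R.

Lemma bounded_measurable_cst (a : R) : bounded_measurable (fun _ : T => a).
Proof. by split; [exact: measurable_cst|exists `|a|]. Qed.

Lemma bounded_measurableD f g : bounded_measurable f -> bounded_measurable g ->
  bounded_measurable (fun x => f x + g x).
Proof.
move=> [mf [B fB]] [mg [B' gB]]; split; first exact: measurable_funD.
by exists (B + B') => c; apply: le_trans (ler_normD _ _) _; exact: lerD.
Qed.

Lemma bounded_measurableM f g : bounded_measurable f -> bounded_measurable g ->
  bounded_measurable (fun x => f x * g x).
Proof.
move=> [mf [B fB]] [mg [B' gB]]; split; first exact: measurable_funM.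
by exists (B * B') => c; rewrite normrM; exact: ler_pM.
Qed.

Lemma bounded_measurable_sum (I : Type) (s : seq I) (F : I -> T -> R) :
  (forall i, bounded_measurable (F i)) ->
  bounded_measurable (fun x => \sum_(i <- s) F i x).
Proof.
move=> bF; elim: s => [|i s IH].
  by under eq_fun do rewrite big_nil; exact: bounded_measurable_cst.
by under eq_fun do rewrite big_cons; exact: bounded_measurableD.
Qed.

Lemma bounded_measurable_le (Y : T -> R) (t : R) : measurable_fun setT Y ->
  bounded_measurable (fun x => (Y x <= t)%R%:R : R).
Proof.
move=> mY; split; last by exists 1 => x; rewrite normr_nat lern1 leq_b1.
rewrite (_ : (fun x => _) = \1_(Y @^-1` `]-oo, t]) :> (T -> R)).
  by apply: measurable_indic; rewrite -[X in measurable X]setTI; exact: mY.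
apply/funext => x; rewrite indicE; congr (_%:R); congr nat_of_bool.
by apply/idP/idP; rewrite inE/= in_itv.
Qed.

Variable Q : probability T R.
Let Q1 : Q setT = 1%E. Proof. exact: probability_setT. Qed.

Lemma expD f g : bounded_measurable f -> bounded_measurable g ->
  \int[Q]_x (f x + g x) = \int[Q]_x f x + \int[Q]_x g x.
Proof. by move=> bf bg; rewrite RintegralD//; exact: bm_integrable. Qed.

Lemma expZ a f : bounded_measurable f ->
  \int[Q]_x (a * f x) = a * \int[Q]_x f x.
Proof. by move=> bf; rewrite RintegralZl//; exact: bm_integrable. Qed.

Lemma exp_le f g : bounded_measurable f -> bounded_measurable g ->
  (forall x, f x <= g x) -> \int[Q]_x f x <= \int[Q]_x g x.
Proof. by move=> bf bg fg; apply: le_Rintegral => //; exact: bm_integrable. Qed.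

Lemma exp_cst a : \int[Q]_x (fun=> a) x = a.
Proof.
rewrite Rintegral_cst//; have fQ : fine (Q setT) = 1 by rewrite Q1.
by transitivity (a * 1); [congr (_ * _); exact: fQ|rewrite mulr1].
Qed.

Lemma exp_sum (I : Type) (s : seq I) (F : I -> T -> R) :
  (forall i, bounded_measurable (F i)) ->
  \int[Q]_x (\sum_(i <- s) F i x) = \sum_(i <- s) \int[Q]_x F i x.
Proof.
move=> bF; elim: s => [|i s IH].
  by rewrite big_nil -[RHS](exp_cst 0); apply: eq_Rintegral => x _; rewrite big_nil.
rewrite big_cons -IH -expD//; last exact: bounded_measurable_sum.
by apply: eq_Rintegral => x _; rewrite big_cons.
Qed.

Lemma exp_dist f g e : bounded_measurable f -> bounded_measurable g ->
  (forall x, `|f x - g x| <= e) -> `|\int[Q]_x f x - \int[Q]_x g x| <= e.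
Proof.
move=> bf bg fge; have bc := bounded_measurable_cst e.
have h1 : \int[Q]_x f x <= \int[Q]_x (g x + e).
  apply: exp_le => //; first exact: bounded_measurableD.
  by move=> x; have := fge x; rewrite ler_norml; lra.
have h2 : \int[Q]_x g x <= \int[Q]_x (f x + e).
  apply: exp_le => //; first exact: bounded_measurableD.
  by move=> x; have := fge x; rewrite ler_norml; lra.
move: h1 h2; rewrite !expD// exp_cst ler_norml; lra.
Qed.

End BoundedMeasurable.

(** Conjugation by an adjacent transposition lengthens the gap by one, which reduces every
    transposition to adjacent ones. *)
Lemma sw_conj X i j (c : nat -> X) : (i < j)%N ->
  sw i j.+1 c = sw j j.+1 (sw i j (sw j j.+1 c)).
Proof.
move=> ij.
have ni : i != j by rewrite ltn_eqF.
have ni1 : i != j.+1 by rewrite ltn_eqF// (leq_trans ij).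
have nj : j != i by rewrite gtn_eqF.
have nj1 : j != j.+1 by rewrite ltn_eqF.
have j1i : j.+1 != i by rewrite eq_sym.
have j1j : j.+1 != j by rewrite eq_sym.
apply/funext => k; have [->|ki] := eqVneq k i.
  by rewrite [LHS]swE1 [RHS]swE// [RHS]swE1 [RHS]swE1.
have [->|kj1] := eqVneq k j.+1.
  by rewrite [LHS]swE2 [RHS]swE2 [RHS]swE2 [RHS]swE.
have [->|kj] := eqVneq k j.
  by rewrite [LHS]swE// [RHS]swE1 [RHS]swE// [RHS]swE2.
by rewrite [LHS]swE// [RHS]swE// [RHS]swE// [RHS]swE.
Qed.

(** * Exchangeability of the replicas *)

Section Exchangeability.
Context (R : realType) dO dX (O : measurableType dO) (X : measurableType dX).
Variables (P : probability O R) (G : R.-pker O ~> X).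
Local Notation cfg := (config X).

Lemma measurable_sw i j : measurable_fun setT (fun c : cfg => sw i j c : cfg).
Proof.
by apply: measurable_config => k; rewrite /sw; exact: measurable_coord.
Qed.

Lemma bm_sw_config (f : cfg -> R) i j : bounded_measurable f ->
  bounded_measurable (fun c : cfg => f (sw i j c)).
Proof.
move=> [mf [B fB]]; split; last by exists B => c; exact: fB.
exact: (measurableT_comp mf (measurable_sw i j)).
Qed.

Variables (N : nat) (Q : probability cfg R).
Hypothesis QE : forall f : cfg -> R, bounded_measurable f ->
  EG P G N (fun c => (f c)%:E) = (\int[Q]_c f c)%:E.

Let inv i j := forall f : cfg -> R, bounded_measurable f ->
  \int[Q]_c f (sw i j c) = \int[Q]_c f c.

Let inv_adjacent i : (0 < i)%N -> (i < N)%N -> inv i i.+1.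
Proof.
move=> i0 iN f bf; have [mf [B fB]] := bf.
(* Invariance of iterated integrals is known for nonnegative integrands, hence the shift by [B]. *)
have bfB : bounded_measurable (fun c : cfg => f c + B).
  split; first by apply: measurable_funD.
  by exists (B + `|B|) => c; apply: le_trans (ler_normD _ _) _; rewrite lerD2r.
have Q1 : Q setT = 1%E by exact: probability_setT.
have shift (g : cfg -> R) : bounded_measurable g ->
    \int[Q]_c (g c + B) = \int[Q]_c g c + B.
  by move=> bg; rewrite /Rintegral (integral_shift Q1 _ bg) (integral_fin Q1 bg).
apply: (@addIr _ B); rewrite -(shift _ (bm_sw_config _ _ bf)) -(shift _ bf).
apply: EFin_inj; rewrite -(QE bfB) -(QE (bm_sw_config i i.+1 bfB)).
apply: eq_integral => w _.
apply: (@rint_sw_adjacent _ _ _ _ _ G (fun c : cfg => (f c + B)%:E) _ _ w i N i0 iN).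
- by move=> c; rewrite lee_fin; have := fB c; rewrite ler_norml; lra.
- by apply/measurable_EFinP; case: bfB.
Qed.

Let inv_lt i j : (0 < i)%N -> (i < j)%N -> (j <= N)%N -> inv i j.
Proof.
move=> i0; elim: j => [//|j IH]; rewrite ltnS leq_eqVlt => /orP[/eqP<-|ij] jN.
  exact: inv_adjacent.
have j0 : (0 < j)%N by exact: leq_trans ij.
have a := inv_adjacent j0 jN; have b := IH ij (ltnW jN).
move=> f bf.
have -> : (fun c : cfg => f (sw i j.+1 c)) =
    (fun c => f (sw j j.+1 (sw i j (sw j j.+1 c)))).
  by apply/funext => c; rewrite sw_conj.
rewrite (a (fun c => f (sw j j.+1 (sw i j c)))); last exact: (bm_sw_config i j (bm_sw_config j j.+1 bf)).
by rewrite (b (fun c => f (sw j j.+1 c))) ?a//; exact: (bm_sw_config j j.+1 bf).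
Qed.

Lemma exchangeable i j : (0 < i <= N)%N -> (0 < j <= N)%N -> inv i j.
Proof.
move=> /andP[i0 iN] /andP[j0 jN]; have [ij|ji|->] := ltngtP i j.
- exact: inv_lt.
- move=> f bf; rewrite -(inv_lt j0 ji iN bf); congr (Rintegral _ _ _).
  apply/funext => c /=; congr f; apply/funext => k; rewrite /sw.
  by case: (eqVneq k i) => [->|ki]; case: (eqVneq _ j) => // ->.
- by move=> f bf; congr (Rintegral _ _ _); apply/funext => c /=; rewrite swii.
Qed.

End Exchangeability.

(** * The replica system of a random measure *)

Section Assembly.
Context (R : realType) (V1 V2 : normedModType R) (ip1 : V1 -> V1 -> R)
  (ip2 : V2 -> V2 -> R) (hip1 : is_hilbert_ip ip1) (hip2 : is_hilbert_ip ip2).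
Context dO dX (O : measurableType dO) (X : measurableType dX).
Variables (P : probability O R) (G : R.-pker O ~> X) (s1 : X -> V1) (s2 : X -> V2).
Hypotheses (s1_ball : forall x, `|s1 x| <= 1) (s2_ball : forall x, `|s2 x| <= 1).
Hypothesis meas1 : measurable_fun setT (fun xy : X * X => ip1 (s1 xy.1) (s1 xy.2)).
Hypothesis meas2 : measurable_fun setT (fun xy : X * X => ip2 (s2 xy.1) (s2 xy.2)).
Local Notation cfg := (config X).

Definition overlaps (x y : X) : R * R := (ip1 (s1 x) (s1 y), ip2 (s2 x) (s2 y)).

Lemma measurable_overlap1 i j : measurable_fun setT (fun c : cfg => overlap ip1 s1 c i j).
Proof.
have m : measurable_fun setT (fun c : cfg => (c i, c j)).
  by apply: measurable_fun_pair; exact: measurable_coord.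
exact: (measurableT_comp meas1 m).
Qed.

Lemma measurable_overlap2 i j : measurable_fun setT (fun c : cfg => overlap ip2 s2 c i j).
Proof.
have m : measurable_fun setT (fun c : cfg => (c i, c j)).
  by apply: measurable_fun_pair; exact: measurable_coord.
exact: (measurableT_comp meas2 m).
Qed.

Lemma overlaps_bound x y : `|(overlaps x y).1| <= 1 /\ `|(overlaps x y).2| <= 1.
Proof. by split; exact: ip_unit_ball. Qed.

Lemma bm_overlaps (u : R * R -> R) i j : continuous u -> box_bounded u ->
  bounded_measurable (fun c : cfg => u (overlaps (c i) (c j))).
Proof.
move=> cu [B uB]; split; last first.
  by exists B => c; have [h1 h2] := overlaps_bound (c i) (c j); exact: uB.
have m : measurable_fun setT (fun c : cfg => overlaps (c i) (c j)).
  apply: measurable_fun_pair; first exact: measurable_overlap1.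
  exact: measurable_overlap2.
exact: (measurableT_comp (continuous_measurable_plane cu) m).
Qed.

Lemma replica_system N : exists Q : probability cfg R,
  replicas overlaps (fun f => \int[Q]_c f c) N (@bounded_measurable R _ cfg) /\
  forall (f : cfg -> R) n, bounded_measurable f -> (n <= N)%N ->
    (forall j c x, (n < j)%N -> f (upd c j x) = f c) ->
    EG P G n (fun c => (f c)%:E) = (\int[Q]_c f c)%:E.
Proof.
have [Q QE] := replica_expectation P G N; exists Q; split; last first.
  move=> f n bf nN fl; rewrite -(QE f bf); apply/esym/EG_local => // j c x nj.
  by rewrite fl.
split.
- by move=> a; exact: bounded_measurable_cst.
- by move=> g h; exact: bounded_measurableD.
- by move=> g h; exact: bounded_measurableM.
- by move=> u i j; exact: bm_overlaps.
- by move=> g i j; exact: bm_sw_config.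
- by move=> a; exact: (exp_cst Q a).
- by move=> g h; exact: expD.
- by move=> a g; exact: expZ.
- by move=> g h; exact: exp_le.
- by move=> g i j bg hi hj; exact: (exchangeable QE hi hj bg).
- by move=> x y; rewrite /overlaps (ip_sym hip1) (ip_sym hip2).
- exact: overlaps_bound.
- by move=> m z x y t; exact: (ip_psd hip1 m (s1 z) (s1 \o x) (s1 \o y) t).
- by move=> m z x y t; exact: (ip_psd hip2 m (s2 z) (s2 \o x) (s2 \o y) t).
Qed.

(** Makes every weight an admissible [f] of the hypothesis. Rows of the array count from 0 and
    replicas from 1, so replica [i.+1] is row [i]. *)
Lemma weight_Rle n g : weight overlaps n g ->
  exists f : 'M[R]_(n, n) * 'M[R]_(n, n) -> R,
   [/\ continuous f, forall z, `|f z| <= 1 & forall c, f (Rle ip1 ip2 s1 s2 n c) = g c].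
Proof.
elim=> [|i j u g' /andP[i0 iN] /andP[j0 jN] cu u01 _ [f [cf f1 fg]]].
  by exists (fun=> 1); split; [move=> z; exact: cvg_cst|move=> z; rewrite normr1|].
case: i j i0 iN j0 jN => // i [//|j] _ iN _ jN.
pose a : 'I_n := Ordinal iN; pose b : 'I_n := Ordinal jN.
exists (fun z : 'M[R]_(n, n) * 'M[R]_(n, n) => u (z.1 a b, z.2 a b) * f z); split.
- move=> z; apply: cvgM; last exact: cf.
  apply: (@continuous2_cvg _ _ _ _ (nbhs z) _ (fun z => z.1 a b) (fun z => z.2 a b)
    (fun p q : R => u (p, q))).
  - rewrite (_ : (fun _ : R * R => _) = u); first exact: cu.
    by apply/funext => -[].
  - apply: (@continuous_comp _ _ _ (fun z : 'M[R]_(n, n) * 'M[R]_(n, n) => z.1)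
      (fun M : 'M[R]_(n, n) => M a b)); [exact: cvg_fst|exact: coord_continuous].
  - apply: (@continuous_comp _ _ _ (fun z : 'M[R]_(n, n) * 'M[R]_(n, n) => z.2)
      (fun M : 'M[R]_(n, n) => M a b)); [exact: cvg_snd|exact: coord_continuous].
- move=> z; rewrite normrM mulr_ile1//.
  by have := u01 (z.1 a b, z.2 a b); rewrite ler_norml; lra.
- by move=> c; rewrite fg /Rle/= !mxE.
Qed.

End Assembly.

(** * Translation of the hypothesis into approximate identities *)

Section FromHypothesis.
Context (R : realType) (V1 V2 : normedModType R) (ip1 : V1 -> V1 -> R)
  (ip2 : V2 -> V2 -> R) (hip1 : is_hilbert_ip ip1) (hip2 : is_hilbert_ip ip2).
Context dO dX (O : measurableType dO) (X : measurableType dX).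
Variables (P : probability O R) (G : R.-pker O ~> X) (s1 : X -> V1) (s2 : X -> V2).
Hypotheses (s1_ball : forall x, `|s1 x| <= 1) (s2_ball : forall x, `|s2 x| <= 1).
Hypothesis meas1 : measurable_fun setT (fun xy : X * X => ip1 (s1 xy.1) (s1 xy.2)).
Hypothesis meas2 : measurable_fun setT (fun xy : X * X => ip2 (s2 xy.1) (s2 xy.2)).
Variables (lam : nat -> rat) (delta : R).
Local Notation cfg := (config X).
Local Notation r := (overlaps ip1 ip2 s1 s2).

Definition gg_hypothesis := forall (n h1 h2 p : nat),
     (0 < n)%N -> n%:R <= delta^-1 ->
     (0 < h1)%N -> h1%:R <= delta^-1 ->
     (0 < h2)%N -> h2%:R <= delta^-1 ->
     (0 < p)%N -> p%:R <= delta^-1 ->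
     forall f : 'M[R]_(n, n) * 'M[R]_(n, n) -> R,
       continuous f -> (forall z, `|f z| <= 1) ->
       let lR l l' c :=
         ratr (lam h1) * overlap ip1 s1 c l l' +
         ratr (lam h2) * overlap ip2 s2 c l l' in
       (`| EG P G n.+1 (fun c => (f (Rle ip1 ip2 s1 s2 n c) * lR 1 n.+1 c ^+ p)%R%:E)
          - (n%:R^-1)%R%:E * EG P G n (fun c => (f (Rle ip1 ip2 s1 s2 n c))%:E)
                         * EG P G 2 (fun c => (lR 1 2 c ^+ p)%R%:E)
          - (n%:R^-1)%R%:E * \sum_(2 <= l < n.+1)
               EG P G n (fun c => (f (Rle ip1 ip2 s1 s2 n c) * lR 1 l c ^+ p)%R%:E)
       | <= delta%:E)%E.

Lemma approx_gg_of_hypothesis N (Q : probability cfg R) : gg_hypothesis ->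
  (1 < N)%N -> (forall n : nat, n%:R <= delta^-1 -> (n < N)%N) ->
  replicas r (fun f => \int[Q]_c f c) N (@bounded_measurable R _ cfg) ->
  (forall (f : cfg -> R) n, bounded_measurable f -> (n <= N)%N ->
    (forall j c x, (n < j)%N -> f (upd c j x) = f c) ->
    EG P G n (fun c => (f c)%:E) = (\int[Q]_c f c)%:E) ->
  approx_gg lam delta r (fun f => \int[Q]_c f c).
Proof.
move=> H N1 nN S EGE n h1 h2 p n0 nd h10 h1d h20 h2d p0 pd g wg.
have [f [cf f1 fg]] := weight_Rle wg.
have := H n h1 h2 p n0 nd h10 h1d h20 h2d p0 pd f cf f1; rewrite /=.
have nlt := nN n nd.
pose phi (x : R * R) := (ratr (lam h1) * x.1 + ratr (lam h2) * x.2) ^+ p.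
have tphi : tame phi.
  apply: tameX; apply: tameD; apply: tameZ; apply: tame_comb.
    by constructor 1.
  by constructor 2.
have bg : bounded_measurable (g : cfg -> R) := weight_bm S wg.
have bphi i j : bounded_measurable (fun c : cfg => phi (r (c i) (c j))).
  by apply: (bm_ov S) => //; case: tphi.
have bgphi i j : bounded_measurable (fun c : cfg => g c * phi (r (c i) (c j))).
  exact: (bmM S bg (bphi i j)).
have gl j c x : (n < j)%N -> g (upd c j x) = g c.
  move=> nj; apply: (weight_loc wg) => k /andP[_ kn].
  by rewrite /upd ltn_eqF// (leq_ltn_trans kn).
have cl j k (c : nat -> X) x : (k < j)%N -> upd c j x k = c k.
  by move=> kj; rewrite /upd ltn_eqF.
have e1 m l : (l <= m)%N -> (0 < l)%N -> (n <= m)%N -> (m <= N)%N ->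
    EG P G m (fun c => (f (Rle ip1 ip2 s1 s2 n c) *
     (ratr (lam h1) * overlap ip1 s1 c 1 l + ratr (lam h2) * overlap ip2 s2 c 1 l) ^+ p)%:E)
    = (\int[Q]_c (g c * phi (r (c 1%N) (c l))))%:E.
  move=> lm l0 nm mN; rewrite -(EGE _ m (bgphi 1%N l) mN).
    by congr (EG _ _ _ _); apply/funext => c; rewrite fg.
  move=> j c x mj; rewrite gl ?(leq_ltn_trans nm)// !cl//.
    exact: leq_ltn_trans mj.
  exact: leq_ltn_trans (leq_trans l0 lm) mj.
have e2 : EG P G n (fun c => (f (Rle ip1 ip2 s1 s2 n c))%:E) = (\int[Q]_c g c)%:E.
  rewrite -(EGE g n bg (ltnW nlt) gl).
  by congr (EG _ _ _ _); apply/funext => c; rewrite fg.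
have e3 : EG P G 2 (fun c => ((ratr (lam h1) * overlap ip1 s1 c 1 2 +
     ratr (lam h2) * overlap ip2 s2 c 1 2) ^+ p)%:E) =
    (\int[Q]_c phi (r (c 1%N) (c 2%N)))%:E.
  rewrite -(EGE _ 2%N (bphi 1%N 2%N) N1)// => j c x j2.
  by rewrite !cl// ltnW.
rewrite e1// e2 e3.
under eq_big_nat => l /andP[l2 ln].
  rewrite e1//; [|exact: ltnW|exact: ltnW].
  over.
by rewrite sumEFin -!EFinM -!EFinB lee_fin.
Qed.

End FromHypothesis.

Lemma overlaps_synchronize (R : realType) (lam : nat -> rat)
  (lam_onto : forall q : rat, 0 <= q <= 1 -> exists2 n, (0 < n)%N & lam n = q)
  (kappa w : R) : 0 < kappa -> 0 < w <= 1 ->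
  exists2 delta : R, 0 < delta &
  forall (V1 V2 : normedModType R) (ip1 : V1 -> V1 -> R) (ip2 : V2 -> V2 -> R),
  is_hilbert_ip ip1 -> is_hilbert_ip ip2 ->
  forall (dO dX : measure_display) (O : measurableType dO) (X : measurableType dX)
    (P : probability O R) (G : R.-pker O ~> X) (s1 : X -> V1) (s2 : X -> V2),
  (forall x, `|s1 x| <= 1) -> (forall x, `|s2 x| <= 1) ->
  measurable_fun setT (fun xy : X * X => ip1 (s1 xy.1) (s1 xy.2)) ->
  measurable_fun setT (fun xy : X * X => ip2 (s2 xy.1) (s2 xy.2)) ->
  gg_hypothesis ip1 ip2 P G s1 s2 lam delta ->
  exists Q : probability (config X) R,
  (forall f : config X -> R, bounded_measurable f ->
    (forall j c x, (2 < j)%N -> f (upd c j x) = f c) ->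
    EG P G 2 (fun c => (f c)%:E) = (\int[Q]_c f c)%:E) /\
  forall s t, (\int[Q]_c upper_left w s t (overlaps ip1 ip2 s1 s2 (c 1%N) (c 2%N))) *
    (\int[Q]_c lower_right w s t (overlaps ip1 ip2 s1 s2 (c 1%N) (c 2%N))) <= kappa.
Proof.
move=> kappa0 w01; have [M1 HM] := synchronization kappa0 w01.
pose M := maxn M1 2; have M0 : (0 < M)%N by rewrite /M leq_max orbT.
have [delta delta0 Hd] := @GG_of_approx_gg R lam lam_onto M M0.
exists delta => // V1 V2 ip1 ip2 hip1 hip2 dO dX O X P G s1 s2 b1 b2 m1 m2 H.
(* Large enough for the abstract statement and, since [n <= delta^-1] implies [n < N], for the fresh
   replica of every identity in the hypothesis. *)
pose N := maxn M (Num.bound (delta^-1)).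
have [Q [S EGE]] := replica_system hip1 hip2 P G b1 b2 m1 m2 N.
have MN : (M <= N)%N by exact: leq_maxl.
have M2 : (2 <= M)%N by exact: leq_maxr.
have N2 : (1 < N)%N by exact: leq_trans MN.
have nN n : n%:R <= delta^-1 -> (n < N)%N.
  move=> nd; rewrite -(ltr_nat R); apply: le_lt_trans nd _.
  apply: (@lt_le_trans _ _ (Num.bound (delta^-1))%:R).
    by apply: archi_boundP; rewrite invr_ge0 ltW.
  by rewrite ler_nat leq_maxr.
have A := approx_gg_of_hypothesis H N2 nN S EGE.
exists Q; split=> [f bf fl|]; first exact: (EGE f 2%N bf N2 fl).
apply: (HM X (overlaps ip1 ip2 s1 s2) (fun f => \int[Q]_c f c) M); first exact: leq_maxl.
exists (@bounded_measurable R _ (config X)); last exact: (Hd X _ _ N _ S A).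
(* Exchangeability is known up to [N] and required only up to [M], which is at most [N]. *)
have le i : (0 < i <= M)%N -> (0 < i <= N)%N.
  by move=> /andP[-> /leq_trans]; apply.
by case: S => *; split => // g i j bg /le hi /le hj; auto.
Qed.

(** * The quantile coupling *)

Section StepApproximation.
Variable R : realType.
Implicit Types (s t : nat -> R) (f : R -> R -> R).

(* Abel summation: a function of the first threshold above [x]. *)
Lemma abel_indicator n (b s : nat -> R) x i : (i <= n)%N -> b n.+1 = 0 ->
  (forall k, (x <= s k) = (i <= k)%N) ->
  \sum_(k < n.+1) (b k - b k.+1) * (x <= s k)%R%:R = b i.
Proof.
move=> iln bn xs; rewrite -(big_mkord xpredT (fun k => (b k - b k.+1) * (x <= s k)%R%:R)).
rewrite (@big_cat_nat _ _ _ i)//=; last exact: leqW.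
rewrite big_nat big1 ?add0r; last by move=> k /andP[_ ki]; rewrite xs leqNgt ki mulr0.
rewrite (eq_big_nat _ _ (F2 := fun k => (- b k.+1) - (- b k))).
  by rewrite telescope_sumr ?leqW// bn oppr0 sub0r opprK.
by move=> k /andP[ik _]; rewrite xs ik mulr1; ring.
Qed.

(** One threshold in each cell of length [omega], free inside its cell so that it can be put where a
    distribution function is almost flat. *)
Definition thresholds (omega : R) s :=
  forall k, -1 + k%:R * omega <= s k < -1 + k.+1%:R * omega.

Lemma thresholds_le omega s k m : thresholds omega s -> (k <= m)%N -> s k <= s m.
Proof.
move=> th; elim: m => [|m IH]; first by rewrite leqn0 => /eqP->.
rewrite leq_eqVlt => /orP[/eqP->//|km]; apply: le_trans (IH km) _.
by have /andP[_ /ltW h1] := th m; have /andP[h2 _] := th m.+1; exact: le_trans h2.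
Qed.

(** Consecutive thresholds lie in adjacent cells, so they differ by less than [2 * omega]. *)
Lemma threshold_above omega s n x : 0 < omega -> thresholds omega s ->
  2 <= n%:R * omega -> -1 <= x <= 1 -> exists i, [/\ (i <= n)%N,
    forall k, (x <= s k) = (i <= k)%N & `|x - s i| <= 2 * omega].
Proof.
move=> o0 th n2 /andP[x0 x1].
have ex : exists i, x <= s i.
  by exists n; have /andP[h _] := th n; apply: le_trans h; lra.
case: (ex_minnP ex) => i xi mini; exists i; split.
- by apply: mini; have /andP[h _] := th n; apply: le_trans h; lra.
- move=> k; apply/idP/idP; first exact: mini.
  by move=> /(thresholds_le th); exact: le_trans.
- rewrite ler0_norm ?subr_le0// opprB.
  case: i xi mini => [|i] xi mini.
    by have /andP[_] := th 0%N; rewrite mul1r; lra.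
  have six : s i < x by rewrite ltNge; apply/negP => /mini; rewrite ltnn.
  have /andP[h1 _] := th i; have /andP[_ h2] := th i.+1.
  by move: h2; rewrite -(natr1 i.+1) -(natr1 i) !mulrDl !mul1r; lra.
Qed.

(** Extension by zero past index [n] removes the boundary terms of Abel summation; [grid_weight] is
    the mixed second difference. *)
Definition grid f s t n i j := if (i <= n)%N && (j <= n)%N then f (s i) (t j) else 0.
Definition grid_weight f s t n i j := (grid f s t n i j - grid f s t n i.+1 j)
  - (grid f s t n i j.+1 - grid f s t n i.+1 j.+1).

Lemma grid_weight_bound f s t n i j A : 0 <= A -> (forall x y, `|f x y| <= A) ->
  `|grid_weight f s t n i j| <= 4 * A.
Proof.
move=> A0 fA; have gA k m : `|grid f s t n k m| <= A.
  by rewrite /grid; case: ifP => // _; rewrite normr0.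
rewrite /grid_weight; move: (gA i j) (gA i.+1 j) (gA i j.+1) (gA i.+1 j.+1).
by rewrite !ler_norml; lra.
Qed.

Lemma grid_step f s t n x y i j : (i <= n)%N -> (j <= n)%N ->
  (forall k, (x <= s k) = (i <= k)%N) -> (forall k, (y <= t k) = (j <= k)%N) ->
  \sum_(k < n.+1) \sum_(m < n.+1)
    grid_weight f s t n k m * ((x <= s k)%R%:R * (y <= t m)%R%:R) = f (s i) (t j).
Proof.
move=> iln jn xs yt.
have -> : f (s i) (t j) = grid f s t n i j by rewrite /grid iln jn.
rewrite -(@abel_indicator n (fun k => grid f s t n k j) s x i)//; last first.
  by rewrite /grid ltnn.
apply: eq_bigr => k _.
rewrite -(@abel_indicator n (fun m => grid f s t n k m - grid f s t n k.+1 m) t y j)//.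
  by rewrite mulr_suml; apply: eq_bigr => m _; rewrite /grid_weight; ring.
by rewrite /grid ltnn !andbF subr0.
Qed.

Section Expectation.
Context d (T : measurableType d) (Q : probability T R) (Y1 Y2 : T -> R).
Hypotheses (m1 : measurable_fun setT Y1) (m2 : measurable_fun setT Y2).
Hypotheses (Y1b : forall x, -1 <= Y1 x <= 1) (Y2b : forall x, -1 <= Y2 x <= 1).

Definition joint_cdf (s t : R) := \int[Q]_x ((Y1 x <= s)%R%:R * (Y2 x <= t)%R%:R).

(** Rounding each coordinate up to a threshold moves it by at most [2 * omega]. The rounded
    expectation depends on the law of the pair only through [joint_cdf] at grid points, with weights
    common to all pairs. *)
Lemma expectation_grid f A B omega s t n : 0 <= B -> 0 < omega ->
  thresholds omega s -> thresholds omega t -> 2 <= n%:R * omega ->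
  continuous (fun p : R * R => f p.1 p.2) -> (forall x y, `|f x y| <= A) ->
  (forall x x' y, `|f x y - f x' y| <= B * `|x - x'|) ->
  (forall x y y', `|f x y - f x y'| <= B * `|y - y'|) ->
  bounded_measurable (fun x => f (Y1 x) (Y2 x)) /\
  `|\int[Q]_x f (Y1 x) (Y2 x) - \sum_(k < n.+1) \sum_(m < n.+1)
    grid_weight f s t n k m * joint_cdf (s k) (t m)| <= 4 * omega * B.
Proof.
move=> B0 o0 ths tht n2 cf fA L1 L2.
have bf : bounded_measurable (fun x => f (Y1 x) (Y2 x)).
  split; last by exists A => x.
  apply: (measurableT_comp (continuous_measurable_plane cf) (f := fun p => f p.1 p.2)
    (g := fun x => (Y1 x, Y2 x))).
  exact: measurable_fun_pair.
split => //.
have bi k m : bounded_measurable (fun x => (Y1 x <= s k)%R%:R * (Y2 x <= t m)%R%:R : R).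
  by apply: bounded_measurableM; exact: bounded_measurable_le.
have bw k m : bounded_measurable (fun x => grid_weight f s t n k m *
    ((Y1 x <= s k)%R%:R * (Y2 x <= t m)%R%:R)).
  by apply: bounded_measurableM => //; exact: bounded_measurable_cst.
have -> : \sum_(k < n.+1) \sum_(m < n.+1) grid_weight f s t n k m * joint_cdf (s k) (t m)
   = \int[Q]_x \sum_(k < n.+1) \sum_(m < n.+1)
    grid_weight f s t n k m * ((Y1 x <= s k)%R%:R * (Y2 x <= t m)%R%:R).
  rewrite exp_sum; last by move=> k; exact: bounded_measurable_sum.
  apply: eq_bigr => k _; rewrite exp_sum//; apply: eq_bigr => m _.
  by rewrite expZ.
apply: exp_dist => //.
  by apply: bounded_measurable_sum => k; exact: bounded_measurable_sum.
move=> x; have [i [iln xs di]] := threshold_above o0 ths n2 (Y1b x).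
have [j [jn yt dj]] := threshold_above o0 tht n2 (Y2b x).
rewrite (grid_step _ iln jn xs yt).
rewrite (_ : _ - _ = (f (Y1 x) (Y2 x) - f (s i) (Y2 x)) + (f (s i) (Y2 x) - f (s i) (t j))).
  apply: le_trans (ler_normD _ _) _.
  have h1 : B * `|Y1 x - s i| <= B * (2 * omega) by rewrite ler_wpM2l.
  have h2 : B * `|Y2 x - t j| <= B * (2 * omega) by rewrite ler_wpM2l.
  have := L1 (Y1 x) (s i) (Y2 x); have := L2 (s i) (Y2 x) (t j); lra.
by ring.
Qed.

End Expectation.
End StepApproximation.

(** * Distribution and quantile functions *)

Section Quantile.
Context (R : realType) d (T : measurableType d) (Q : probability T R) (Y : T -> R).
Hypotheses (mY : measurable_fun setT Y) (Yb : forall x, -1 <= Y x <= 1).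

Definition distr (t : R) : R := \int[Q]_x (Y x <= t)%R%:R.
Definition quantile (u : R) : R := inf [set t | u <= distr t].

Let bmY (t : R) : bounded_measurable (fun x => (Y x <= t)%R%:R : R).
Proof. exact: bounded_measurable_le. Qed.

Lemma distr_le s t : s <= t -> distr s <= distr t.
Proof.
move=> st; apply: exp_le => // x; rewrite ler_nat.
by case: (leP (Y x) s) => // /le_trans -> .
Qed.

Lemma distr01 t : 0 <= distr t <= 1.
Proof.
apply/andP; split.
  rewrite -(exp_cst Q 0); apply: exp_le => //; exact: bounded_measurable_cst.
rewrite -[leRHS](exp_cst Q 1); apply: exp_le => //; first exact: bounded_measurable_cst.
by move=> x; rewrite lern1 leq_b1.
Qed.

Lemma distr_eq0 t : t < -1 -> distr t = 0.
Proof.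
move=> t1; rewrite -[RHS](exp_cst Q 0); apply: eq_Rintegral => x _.
by rewrite leNgt (lt_le_trans t1)//; have /andP[] := Yb x.
Qed.

Lemma distr_eq1 t : 1 <= t -> distr t = 1.
Proof.
move=> t1; rewrite -[RHS](exp_cst Q 1); apply: eq_Rintegral => x _.
by rewrite (le_trans _ t1)//; have /andP[] := Yb x.
Qed.

Lemma distrE t : (distr t)%:E = Q (Y @^-1` `]-oo, t]).
Proof.
have mA : measurable (Y @^-1` `]-oo, t]).
  by rewrite -[X in measurable X]setTI; exact: mY.
have := @integral_indic _ _ _ Q setT measurableT _ mA; rewrite setIT => <-.
rewrite /distr -(integral_fin (probability_setT Q) (bmY t)).
apply: eq_integral => x _; rewrite indicE; congr (_%:R%:E); congr nat_of_bool.
by apply/idP/idP; rewrite inE/= in_itv.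
Qed.

(** Continuity from above of the measure. It makes the infimum defining the quantile attained. *)
Lemma distr_right_continuous u s : (forall n, u <= distr (s + n.+1%:R^-1)) -> u <= distr s.
Proof.
move=> h; pose F n := Y @^-1` `]-oo, s + n.+1%:R^-1].
have mF n : measurable (F n) by rewrite -[X in measurable X]setTI; exact: mY.
have FE : \bigcap_n F n = Y @^-1` `]-oo, s].
  apply/seteqP; split=> x /=; rewrite in_itv/=.
    move=> Fx; apply/ler_addgt0Pl => e e0; rewrite addrC.
    have := Fx (Num.bound e^-1) I; rewrite /F/= in_itv/= => /le_trans; apply.
    rewrite lerD2l -[leRHS]invrK lef_pV2 ?posrE ?invr_gt0//.
    apply: (@le_trans _ _ (Num.bound e^-1)%:R); last by rewrite ler_nat.
    by apply/ltW/archi_boundP; rewrite invr_ge0 ltW.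
  by move=> Yx n _; rewrite /F/= in_itv/= (le_trans Yx)// lerDl.
have cF : Q \o F @ \oo --> Q (\bigcap_n F n).
  apply: nonincreasing_cvg_mu => //.
  - by rewrite (le_lt_trans (probability_le1 _ _))// ltry.
  - by rewrite FE -[X in measurable X]setTI; exact: mY.
  - move=> n m nm; apply/subsetPset => x; rewrite /F/= !in_itv/= => /le_trans; apply.
    by rewrite lerD2l lef_pV2 ?posrE// ler_nat.
rewrite -lee_fin distrE -FE -(cvg_lim _ cF)//; apply: lime_ge.
  by apply/cvg_ex; exists (Q (\bigcap_n F n)).
by apply: nearW => n /=; rewrite -distrE lee_fin; exact: h.
Qed.

(* The set is then empty or unbounded below, and its [inf] is the junk value 0. *)
Lemma quantile_out u : (0 < u <= 1) = false -> quantile u = 0.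
Proof.
move=> hu; rewrite /quantile; have [u0|u0] := leP u 0.
  apply: inf_out => -[_ [y yl]].
  have := yl (y - 1) (le_trans u0 (proj1 (andP (distr01 _)))); lra.
rewrite (_ : [set t | _] = set0) ?inf0//; apply/seteqP; split => // t /= ut.
have /andP[_ t1] := distr01 t.
by move: hu; rewrite u0 (le_trans ut t1).
Qed.

Let quantile_has_inf u : 0 < u <= 1 ->
  nonempty [set t | u <= distr t] /\ lbound [set t | u <= distr t] (-1).
Proof.
move=> /andP[u0 u1]; split; first by exists 1 => /=; rewrite distr_eq1.
move=> t /= ut; rewrite leNgt; apply/negP => /distr_eq0 e.
by move: ut; rewrite e leNgt u0.
Qed.

(** The Galois connection between quantile and distribution function, from which measurability and
    the law of the coupling follow. *)
Lemma quantile_le u s : 0 < u <= 1 -> (quantile u <= s) = (u <= distr s).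
Proof.
move=> hu; have [ne lb] := quantile_has_inf hu.
apply/idP/idP => [qs|us]; last by apply: ge_inf => //; exists (-1).
apply: distr_right_continuous => n.
have n0 : 0 < n.+1%:R^-1 :> R by rewrite invr_gt0.
have [|t /= ut tq] := inf_adherent n0 (_ : has_inf [set t | u <= distr t]).
  by split => //; exists (-1).
apply: le_trans ut (distr_le _); apply/ltW/(lt_le_trans tq).
by rewrite lerD2r.
Qed.

Lemma quantile_range u : -1 <= quantile u <= 1.
Proof.
have [hu|hu] := boolP (0 < u <= 1); last by rewrite quantile_out ?(negbTE hu)//; lra.
have [ne lb] := quantile_has_inf hu.
rewrite quantile_le// distr_eq1//; case/andP: (hu) => _ ->; rewrite andbT.
exact: lb_le_inf.
Qed.

Lemma measurable_quantile : measurable_fun setT quantile.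
Proof.
apply: (measurability (@RGenOInfty.G R) (RGenOInfty.measurableE R)).
move=> _ [_ [a ->] <-]; rewrite setTI.
(* Outside ]0, 1] the quantile is constantly 0, so that part of the preimage is everything or
   nothing according to the sign of [a]. *)
rewrite (_ : _ @^-1` _ = (`]0, 1] `&` `]distr a, +oo[) `|`
   (~` `]0, 1] `&` (if a < 0 then setT else set0)))%classic.
  by apply: measurableU; apply: measurableI => //;
    [exact: measurableC|case: ifP].
apply/seteqP; split => u /=; rewrite !in_itv/= !andbT.
  have [hu|hu] := boolP (0 < u <= 1).
    by rewrite ltNge quantile_le// -ltNge => h; left.
  by rewrite quantile_out ?(negbTE hu)// => ->; right; split => //; apply/negP.
move=> [[hu h]|[/negP hu]]; first by rewrite ltNge quantile_le// -ltNge.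
by rewrite quantile_out ?(negbTE hu)//; case: ifP.
Qed.

End Quantile.

(** * Joint distribution function of the quantile coupling *)

Section JointQuantile.
Context (R : realType) d (T : measurableType d) (Q : probability T R) (Y1 Y2 : T -> R).
Hypotheses (m1 : measurable_fun setT Y1) (m2 : measurable_fun setT Y2).
Hypotheses (Y1b : forall x, -1 <= Y1 x <= 1) (Y2b : forall x, -1 <= Y2 x <= 1).
Local Notation unif := (uniform_prob (@ltr01 R)).

Lemma integral_uniform01 (f : R -> R) : bounded_measurable f ->
  (\int[unif]_u (f u)%:E = \int[lebesgue_measure]_(u in `[0%R, 1%R]) (f u)%:E)%E.
Proof.
move=> [mf _]; have mf' : measurable_fun setT (EFin \o f) by exact/measurable_EFinP.
rewrite integralE [RHS]integralE !integral_uniform//.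
- by rewrite subr0 invr1 !mul1e.
- exact: measurable_funeneg.
- exact: measurable_funepos.
Qed.

(** By the Galois connection the two indicators together say that [u] is at most the minimum [m],
    and a uniform variable does so with probability [m]. *)
Lemma joint_cdf_quantile s t :
  joint_cdf unif (quantile Q Y1) (quantile Q Y2) s t =
  Num.min (distr Q Y1 s) (distr Q Y2 t).
Proof.
set m := Num.min _ _.
have m01 : 0 <= m <= 1.
  by rewrite /m /Num.min; case: ifP => _; exact: distr01.
have bi : bounded_measurable (fun u : R =>
    (quantile Q Y1 u <= s)%R%:R * (quantile Q Y2 u <= t)%R%:R : R).
  by apply: bounded_measurableM; apply: bounded_measurable_le;
    exact: measurable_quantile.
rewrite /joint_cdf /Rintegral integral_uniform01//.
(* The point 0, where the quantile has its default value, is discarded as negligible. *)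
rewrite -integral_itv_obnd_cbnd; last first.
  by apply/measurable_EFinP; apply: measurable_funTS; case: bi.
transitivity (fine (\int[lebesgue_measure]_(u in `]0%R, 1%R]) (\1_`]-oo, m] u)%:E)).
  congr fine; apply: eq_integral.
  move=> u; rewrite inE/= in_itv/= => hu.
  rewrite !quantile_le// -natrM mulnb indicE; congr (_%:R%:E); congr nat_of_bool.
  by rewrite -le_min; apply/idP/idP; rewrite inE/= in_itv.
rewrite integral_indic//.
rewrite (_ : `]-oo, m] `&` `]0, 1] = `]0, m])%classic; last first.
  apply/seteqP; split => u /=; rewrite !in_itv/=; first by move=> [-> /andP[->]].
  by move=> /andP[-> um]; split => //; rewrite /= (le_trans um)//; case/andP: m01.
transitivity (fine (lebesgue_measure (`]0, m]%classic : set R))) => //.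
rewrite lebesgue_measure_itv/= lte_fin; case: ifPn => [_|]; first by rewrite /= subr0.
by rewrite -leNgt => m0 /=; apply/le_anti; case/andP: m01 => -> _; rewrite m0.
Qed.

End JointQuantile.

(** * Comparison of joint distribution functions *)

Section Comparison.
Context (R : realType) d (T : measurableType d) (Q : probability T R) (Y1 Y2 : T -> R).
Hypotheses (m1 : measurable_fun setT Y1) (m2 : measurable_fun setT Y2).
Hypotheses (Y1b : forall x, -1 <= Y1 x <= 1) (Y2b : forall x, -1 <= Y2 x <= 1).

(** Pigeonhole in a cell cut into [K] steps: an increase above [1 / K] on every step would add up to
    more than 1. *)
Lemma flat_thresholds (Y : T -> R) omega K : measurable_fun setT Y -> 0 < omega ->
  (0 < K)%N -> exists s, thresholds omega s /\
  forall k, distr Q Y (s k + omega / K%:R) - distr Q Y (s k) <= K%:R^-1.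
Proof.
move=> mY o0 K0; have K0' : 0 < K%:R :> R by rewrite ltr0n.
pose g := omega / K%:R; have g0 : 0 < g by rewrite divr_gt0.
pose b (k : nat) : R := -1 + k%:R * omega.
have one k : exists y, b k <= y < b k.+1 /\ distr Q Y (y + g) - distr Q Y y <= K%:R^-1.
  apply: contrapT => /forallNP nex.
  have big (j : 'I_K) : K%:R^-1 < distr Q Y (b k + j.+1%:R * g) - distr Q Y (b k + j%:R * g).
    rewrite ltNge; apply/negP => le; apply: (nex (b k + j%:R * g)); split.
      rewrite lerDl mulr_ge0 ?(ltW g0)//= /b -(natr1 k) mulrDl mul1r addrA ltrD2l.
      rewrite /g mulrCA gtr_pMr// ltr_pdivrMr// mul1r ltr_nat; exact: ltn_ord.
    by move: le; rewrite -(natr1 j) mulrDl mul1r addrA.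
  have : \sum_(j < K) K%:R^-1 < \sum_(j < K)
      (distr Q Y (b k + j.+1%:R * g) - distr Q Y (b k + j%:R * g)).
    apply: ltr_sum => //; apply/hasP; exists (Ordinal K0) => //; exact: mem_index_enum.
  rewrite -(big_mkord xpredT (fun j => distr Q Y (b k + j.+1%:R * g) - distr Q Y (b k + j%:R * g))).
  rewrite telescope_sumr// sumr_const card_ord -[ltLHS]mulr_natl mulfV ?gt_eqF//.
  have := distr01 Q mY (b k + K%:R * g); have := distr01 Q mY (b k + 0%:R * g).
  by move=> /andP[h1 _] /andP[_ h2]; rewrite ltNge lerBlDr (le_trans h2)// lerDl.
have [s hs] := choice one.
by exists s; split=> k; have [] := hs k.
Qed.

Lemma bounded_measurable_test M phi : gg_test M phi ->
  bounded_measurable (fun x => phi (Y1 x, Y2 x) : R).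
Proof.
move=> tp; split; last by exists 1 => x; have := gg_test01 tp (Y1 x, Y2 x); rewrite ler_norml; lra.
apply: (measurableT_comp (continuous_measurable_plane (gg_test_continuous tp))
  (g := fun x => (Y1 x, Y2 x))).
exact: measurable_fun_pair.
Qed.

(** The mass where [Y1 <= s] and [Y2 > t] lies in the upper left region or in a strip of mass at
    most [rho], and symmetrically for the lower right. Since the product of the two corner masses is
    at most [eta ^ 2], one of them is at most [eta], and either suffices to bound the minimum from
    above. *)
Lemma joint_cdf_close (eta rho w s t : R) : 0 < w -> 0 <= eta ->
  distr Q Y1 (s + 3 * w) - distr Q Y1 s <= rho ->
  distr Q Y2 (t + 3 * w) - distr Q Y2 t <= rho ->
  (\int[Q]_x upper_left w s t (Y1 x, Y2 x)) *
  (\int[Q]_x lower_right w s t (Y1 x, Y2 x)) <= eta ^+ 2 ->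
  `|joint_cdf Q Y1 Y2 s t - Num.min (distr Q Y1 s) (distr Q Y2 t)| <= eta + rho.
Proof.
move=> w0 eta0 f1 f2 sync.
have wM : w^-1 <= (Num.bound w^-1)%:R by apply/ltW/archi_boundP; rewrite invr_ge0 ltW.
have bU := bounded_measurable_test (upper_left_test s t w0 wM).
have bL := bounded_measurable_test (lower_right_test s t w0 wM).
have U0 x := gg_test01 (upper_left_test s t w0 wM) x.
have L0 x := gg_test01 (lower_right_test s t w0 wM) x.
have bi1 (u : R) : bounded_measurable (fun x => (Y1 x <= u)%R%:R : R) by exact: bounded_measurable_le.
have bi2 (u : R) : bounded_measurable (fun x => (Y2 x <= u)%R%:R : R) by exact: bounded_measurable_le.
have bJ : bounded_measurable (fun x => (Y1 x <= s)%R%:R * (Y2 x <= t)%R%:R : R).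
  exact: bounded_measurableM.
have up : distr Q Y1 s + distr Q Y2 t <= joint_cdf Q Y1 Y2 s t +
    \int[Q]_x upper_left w s t (Y1 x, Y2 x) + distr Q Y2 (t + 3 * w).
  rewrite /joint_cdf /distr -!expD//; last exact: bounded_measurableD.
  apply: exp_le; [exact: bounded_measurableD| |].
    by apply: bounded_measurableD => //; exact: bounded_measurableD.
  move=> x; have /andP[u0 u1] := U0 (Y1 x, Y2 x); have [h1|h1] := leP (Y1 x) s.
    have [h2|h2] := leP (Y2 x) t.
      by rewrite (le_trans h2) ?lerDl ?mulr_ge0 ?(ltW w0)//= !mulr1; lra.
    have [h3|h3] := leP (Y2 x) (t + 3 * w); first by rewrite /= mulr0; lra.
    rewrite /upper_left/= (@ramp_eq1 _ w)//; last by lra.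
    by rewrite (@ramp_eq0 _ w) ?(ltW h3)//= !mulr0; lra.
  rewrite /= mul0r; have [h2|h2] := leP (Y2 x) t.
    by rewrite (le_trans h2) ?lerDl ?mulr_ge0 ?(ltW w0)//=; lra.
  by have : 0 <= (Y2 x <= t + 3 * w)%R%:R :> R; [exact: ler0n|rewrite /=; lra].
have lo : distr Q Y2 t + distr Q Y1 s <= joint_cdf Q Y1 Y2 s t +
    \int[Q]_x lower_right w s t (Y1 x, Y2 x) + distr Q Y1 (s + 3 * w).
  rewrite /joint_cdf /distr -!expD//; last exact: bounded_measurableD.
  apply: exp_le; [exact: bounded_measurableD| |].
    by apply: bounded_measurableD => //; exact: bounded_measurableD.
  move=> x; have /andP[u0 u1] := L0 (Y1 x, Y2 x); have [h1|h1] := leP (Y2 x) t.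
    have [h2|h2] := leP (Y1 x) s.
      by rewrite (le_trans h2) ?lerDl ?mulr_ge0 ?(ltW w0)//= !mulr1; lra.
    have [h3|h3] := leP (Y1 x) (s + 3 * w); first by rewrite /= mul0r; lra.
    rewrite /lower_right/= (@ramp_eq1 _ w (t + w))//; last by lra.
    by rewrite (@ramp_eq0 _ w) ?(ltW h3)//= mul0r; lra.
  rewrite /= mulr0; have [h2|h2] := leP (Y1 x) s.
    by rewrite (le_trans h2) ?lerDl ?mulr_ge0 ?(ltW w0)//=; lra.
  by have : 0 <= (Y1 x <= s + 3 * w)%R%:R :> R; [exact: ler0n|rewrite /=; lra].
have j1 : joint_cdf Q Y1 Y2 s t <= distr Q Y1 s.
  by apply: exp_le => // x; rewrite -natrM ler_nat; case: (Y1 x <= s); case: (Y2 x <= t).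
have j2 : joint_cdf Q Y1 Y2 s t <= distr Q Y2 t.
  by apply: exp_le => // x; rewrite -natrM ler_nat; case: (Y1 x <= s); case: (Y2 x <= t).
have [h|h] : \int[Q]_x upper_left w s t (Y1 x, Y2 x) <= eta \/
    \int[Q]_x lower_right w s t (Y1 x, Y2 x) <= eta.
  apply/orP; rewrite -[_ || _]negbK negb_or -!ltNge; apply/negP => /andP[a b].
  by move: sync; apply/negP; rewrite -ltNge expr2 ltr_pM.
all: have jm : joint_cdf Q Y1 Y2 s t <= Num.min (distr Q Y1 s) (distr Q Y2 t)
  by rewrite le_min j1.
all: have mle1 : Num.min (distr Q Y1 s) (distr Q Y2 t) <= distr Q Y1 s
  by rewrite ge_min lexx.
all: have mle2 : Num.min (distr Q Y1 s) (distr Q Y2 t) <= distr Q Y2 t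
  by rewrite ge_min lexx orbT.
all: by rewrite ler_norml; clear -f1 f2 up lo h jm mle1 mle2; lra.
Qed.

End Comparison.

(** * Choice of constants and comparison of expectations *)

Section Coupling.
Variable R : realType.
Local Notation unif := (uniform_prob (@ltr01 R)).

Lemma quantile_coupling (eps : R) : 0 < eps -> exists2 kappa : R, 0 < kappa &
  exists2 w : R, 0 < w <= 1 & forall d (T : measurableType d) (Q : probability T R)
    (Y1 Y2 : T -> R), measurable_fun setT Y1 -> measurable_fun setT Y2 ->
  (forall x, -1 <= Y1 x <= 1) -> (forall x, -1 <= Y2 x <= 1) ->
  (forall s t, (\int[Q]_x upper_left w s t (Y1 x, Y2 x)) *
    (\int[Q]_x lower_right w s t (Y1 x, Y2 x)) <= kappa) ->
  forall (f : R -> R -> R) (A B : R), 0 <= A -> 0 <= B ->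
  continuous (fun p : R * R => f p.1 p.2) -> (forall x y, `|f x y| <= A) ->
  (forall x x' y, `|f x y - f x' y| <= B * `|x - x'|) ->
  (forall x y y', `|f x y - f x y'| <= B * `|y - y'|) ->
  [/\ bounded_measurable (fun x => f (Y1 x) (Y2 x)),
    bounded_measurable (fun u : R => f (quantile Q Y1 u) (quantile Q Y2 u)) &
  `|\int[Q]_x f (Y1 x) (Y2 x) -
    \int[unif]_u f (quantile Q Y1 u) (quantile Q Y2 u)| <= eps * (A + B)].
Proof.
(* Each of the two roundings costs at most [eps * B / 2]. The [n.+1 ^ 2] grid cells cost at most
   [4 * A * (eta + K^-1)] each, and [eta] is chosen so that their total is at most [eps * A]. *)
move=> e0; pose omega := Num.min 1 (eps / 8).
have o0 : 0 < omega by rewrite lt_min ltr01 divr_gt0.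
have o1 : omega <= 1 by rewrite ge_min lexx.
have oe : omega <= eps / 8 by rewrite ge_min lexx orbT.
pose n := Num.bound (2 / omega).
have n2 : 2 <= n%:R * omega.
  by rewrite -ler_pdivrMr//; apply/ltW/archi_boundP; rewrite divr_ge0// ltW.
pose eta := eps / (8 * n.+1%:R ^+ 2).
have eta0 : 0 < eta by rewrite divr_gt0// mulr_gt0// exprn_gt0.
pose K := (Num.bound eta^-1).+1.
have Keta : K%:R^-1 <= eta.
  rewrite -[leRHS]invrK lef_pV2 ?posrE ?invr_gt0//.
  apply: (@le_trans _ _ (Num.bound eta^-1)%:R); last by rewrite ler_nat.
  by apply/ltW/archi_boundP; rewrite invr_ge0 ltW.
(* Then [3 * w] is the length of the flat stretch after each threshold. *)
pose w := omega / K%:R / 3.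
have w0 : 0 < w by rewrite divr_gt0// divr_gt0.
have w3 : 3 * w = omega / K%:R by rewrite /w mulrC divfK.
have wle : w <= 1.
  have h : omega / K%:R <= 1.
    by rewrite ler_pdivrMr// mul1r (le_trans o1)// ler1n.
  by rewrite /w ler_pdivrMr// mul1r (le_trans h)// ler1n.
exists (eta ^+ 2); first by rewrite exprn_gt0.
exists w; first by rewrite w0.
move=> d T Q Y1 Y2 m1 m2 Y1b Y2b sync f A B A0 B0 cf fA L1 L2.
have mq1 := measurable_quantile Q m1 Y1b; have mq2 := measurable_quantile Q m2 Y2b.
have [s [ths fs]] := flat_thresholds Q m1 o0 (ltn0Sn (Num.bound eta^-1)).
have [t [tht ft]] := flat_thresholds Q m2 o0 (ltn0Sn (Num.bound eta^-1)).
have [bY EY] := expectation_grid Q m1 m2 Y1b Y2b B0 o0 ths tht n2 cf fA L1 L2.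
have [bq Eq] := expectation_grid unif mq1 mq2 (quantile_range Q m1 Y1b)
  (quantile_range Q m2 Y2b) B0 o0 ths tht n2 cf fA L1 L2.
split => //.
have cell k m : `|grid_weight f s t n k m * joint_cdf Q Y1 Y2 (s k) (t m) -
    grid_weight f s t n k m * joint_cdf unif (quantile Q Y1) (quantile Q Y2) (s k) (t m)|
    <= 4 * A * (eta + K%:R^-1).
  rewrite -mulrBr normrM joint_cdf_quantile//; apply: ler_pM => //.
    exact: grid_weight_bound.
  by apply: (@joint_cdf_close _ _ _ Q Y1 Y2 m1 m2 _ _ w) => //; rewrite ?w3// ltW.
set SY := \sum_(k < n.+1) _ in EY; set Sq := \sum_(k < n.+1) _ in Eq.
have SS : `|SY - Sq| <= n.+1%:R ^+ 2 * (4 * A * (eta + K%:R^-1)).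
  rewrite /SY /Sq -sumrB; apply: le_trans (ler_norm_sum _ _ _) _.
  apply: (@le_trans _ _ (\sum_(k < n.+1) n.+1%:R * (4 * A * (eta + K%:R^-1)))); last first.
    by rewrite sumr_const card_ord -[leLHS]mulr_natl mulrA -expr2.
  apply: ler_sum => k _; rewrite -sumrB; apply: le_trans (ler_norm_sum _ _ _) _.
  apply: (@le_trans _ _ (\sum_(m < n.+1) 4 * A * (eta + K%:R^-1))).
    by apply: ler_sum => m _; exact: cell.
  by rewrite sumr_const card_ord -[leLHS]mulr_natl.
have SA : n.+1%:R ^+ 2 * (4 * A * (eta + K%:R^-1)) <= eps * A.
  apply: (@le_trans _ _ (n.+1%:R ^+ 2 * (4 * A * (eta + eta)))).
    by rewrite ler_wpM2l ?exprn_ge0// ler_wpM2l ?mulr_ge0// lerD2l.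
  have N0 : n.+1%:R != 0 :> R by rewrite pnatr_eq0.
  rewrite /eta le_eqVlt; apply/orP; left; apply/eqP; move: N0.
  by move: n.+1%:R => N N0; field.
have SB : 4 * omega * B <= eps * B / 2.
  have h : omega * B <= eps / 8 * B by rewrite ler_wpM2r.
  by move: h; clear; lra.
move: EY Eq SS SA SB; rewrite !ler_norml mulrDr; clear; lra.
Qed.

End Coupling.

(** * Lipschitz bounds from the gradient norm *)

Section Norms.
Context (R : realType).
Implicit Types (f : R -> R -> R).

Lemma bounded_derivative_lipschitz (g : R -> R) (B : R) :
  (forall x, derivable g x 1) -> (forall x, `|derive1 g x| <= B) ->
  forall x y, `|g x - g y| <= B * `|x - y|.
Proof.
move=> dg gB x y; wlog xy : x y / x <= y => [hw|].
  by have [/hw//|/ltW/hw] := leP x y; rewrite distrC [`|y - x|]distrC.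
have [||c _ e] := @MVT_segment R g (derive1 g) x y xy.
- by move=> z _; rewrite derive1E; apply: DeriveDef.
- apply: derivable_within_continuous => z _; exact: dg.
by rewrite distrC e normrM distrC ler_wpM2r.
Qed.

Lemma smooth2_continuous f : smooth2 f -> continuous (fun p : R * R => f p.1 p.2).
Proof. by move=> sf; exact: (sf 0%N). Qed.

Lemma supnorm2_bound f (x y : R) : ((`|f x y|)%:E <= supnorm2 f)%E.
Proof. by apply: ereal_sup_ubound; exists (x, y). Qed.

Lemma gradnorm2_bound f (x y : R) :
  ((Num.sqrt (pd1 f x y ^+ 2 + pd2 f x y ^+ 2))%:E <= gradnorm2 f)%E.
Proof. by apply: ereal_sup_ubound; exists (x, y). Qed.

Lemma norm_le_sqrt (a b : R) :
  `|a| <= Num.sqrt (a ^+ 2 + b ^+ 2) /\ `|b| <= Num.sqrt (a ^+ 2 + b ^+ 2).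
Proof.
by split; rewrite -sqrtr_sqr ler_wsqrtr// ?lerDl ?lerDr sqr_ge0.
Qed.

Lemma gradnorm2_lipschitz f (B : R) : smooth2 f -> gradnorm2 f = B%:E ->
  (forall x x' y, `|f x y - f x' y| <= B * `|x - x'|) /\
  (forall x y y', `|f x y - f x y'| <= B * `|y - y'|).
Proof.
move=> sf gB; have [_ [df _]] := sf 1%N.
have pB x y : `|pd1 f x y| <= B /\ `|pd2 f x y| <= B.
  have := gradnorm2_bound f x y; rewrite gB lee_fin => h.
  have [h1 h2] := norm_le_sqrt (pd1 f x y) (pd2 f x y).
  by split; apply: le_trans h.
split=> [x x' y|x y y'].
  apply: (@bounded_derivative_lipschitz (fun t => f t y)) => z.
    exact: (df z y).1.
  exact: (pB z y).1.
apply: (@bounded_derivative_lipschitz (f x)) => z.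
  exact: (df x z).2.
exact: (pB x z).2.
Qed.

End Norms.

Theorem theorem5p3 (R : realType) (lam : nat -> rat)
  (lam_range : forall n, (0 < n)%N -> 0 <= lam n <= 1)
  (lam_onto : forall q : rat, 0 <= q <= 1 -> exists2 n, (0 < n)%N & lam n = q)
  (lam_inj : forall m n, (0 < m)%N -> (0 < n)%N -> lam m = lam n -> m = n)
  (eps : R) (eps_gt0 : 0 < eps) :
  exists2 delta : R, 0 < delta &
  forall (V1 V2 : completeNormedModType R)
    (ip1 : V1 -> V1 -> R) (ip2 : V2 -> V2 -> R)
    (hip1 : is_hilbert_ip ip1) (hip2 : is_hilbert_ip ip2)
    (dO dX : measure_display) (O : measurableType dO) (X : measurableType dX)
    (P : probability O R) (G : R.-pker O ~> X)
    (s1 : X -> V1) (s2 : X -> V2)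
    (s1_ball : forall x, `|s1 x| <= 1) (s2_ball : forall x, `|s2 x| <= 1)
    (meas1 : measurable_fun setT
               (fun xy : X * X => ip1 (s1 xy.1) (s1 xy.2)))
    (meas2 : measurable_fun setT
               (fun xy : X * X => ip2 (s2 xy.1) (s2 xy.2))),
  (forall (n h1 h2 p : nat),
     (0 < n)%N -> n%:R <= delta^-1 ->
     (0 < h1)%N -> h1%:R <= delta^-1 ->
     (0 < h2)%N -> h2%:R <= delta^-1 ->
     (0 < p)%N -> p%:R <= delta^-1 ->
     forall f : 'M[R]_(n, n) * 'M[R]_(n, n) -> R,
       continuous f -> (forall z, `|f z| <= 1) ->
       let lR l l' c :=
         ratr (lam h1) * overlap ip1 s1 c l l' +
         ratr (lam h2) * overlap ip2 s2 c l l' in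
       (`| EG P G n.+1 (fun c => (f (Rle ip1 ip2 s1 s2 n c) * lR 1 n.+1 c ^+ p)%R%:E)
          - (n%:R^-1)%R%:E * EG P G n (fun c => (f (Rle ip1 ip2 s1 s2 n c))%:E)
                         * EG P G 2 (fun c => (lR 1 2 c ^+ p)%R%:E)
          - (n%:R^-1)%R%:E * \sum_(2 <= l < n.+1)
               EG P G n (fun c => (f (Rle ip1 ip2 s1 s2 n c) * lR 1 l c ^+ p)%R%:E)
       | <= delta%:E)%E) ->
  forall f : R -> R -> R, smooth2 f ->
    (`| EG P G 2 (fun c => (f (overlap ip1 s1 c 1 2) (overlap ip2 s2 c 1 2))%:E)
       - (\int[lebesgue_measure]_(u in [set u : R | (0 <= u <= 1)%R])
            (f (Finv P G ip1 s1 u) (Finv P G ip2 s2 u))%:E) |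
    <= eps%:E * (supnorm2 f + gradnorm2 f))%E.
Proof.
have [kappa kappa0 [w w01 couple]] := quantile_coupling eps_gt0.
have [delta delta0 sync] := overlaps_synchronize lam_onto kappa0 w01.
exists delta => // V1 V2 ip1 ip2 hip1 hip2 dO dX O X P G s1 s2 s1_ball s2_ball.
move=> meas1 meas2 gg f sf.
have [Q [EGQ Qsync]] := sync V1 V2 ip1 ip2 hip1 hip2 dO dX O X P G s1 s2
  s1_ball s2_ball meas1 meas2 gg.
have sup0 : (0 <= supnorm2 f)%E.
  by apply: le_trans (supnorm2_bound f 0 0); rewrite lee_fin.
have grad0 : (0 <= gradnorm2 f)%E.
  by apply: le_trans (gradnorm2_bound f 0 0); rewrite lee_fin sqrtr_ge0.
(* If either norm is infinite, so is the right-hand side, because [eps > 0] and both norms are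
   nonnegative. *)
have [supy|supf] := eqVneq (supnorm2 f) +oo%E.
  rewrite supy addye; last by case: (gradnorm2 f) grad0.
  by rewrite gt0_muley ?lte_fin// leey.
have [grady|gradf] := eqVneq (gradnorm2 f) +oo%E.
  rewrite grady addey; last by case: (supnorm2 f) sup0.
  by rewrite gt0_muley ?lte_fin// leey.
have [A supE] : exists A : R, supnorm2 f = A%:E.
  by case: (supnorm2 f) sup0 supf => [A|//|//] _ _; exists A.
have [B gradE] : exists B : R, gradnorm2 f = B%:E.
  by case: (gradnorm2 f) grad0 gradf => [B|//|//] _ _; exists B.
have A0 : 0 <= A by move: sup0; rewrite supE lee_fin.
have B0 : 0 <= B by move: grad0; rewrite gradE lee_fin.
have fA x y : `|f x y| <= A.
  by have := supnorm2_bound f x y; rewrite supE lee_fin.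
have [L1 L2] := gradnorm2_lipschitz sf gradE.
pose Y1 (c : config X) := overlap ip1 s1 c 1 2.
pose Y2 (c : config X) := overlap ip2 s2 c 1 2.
have m1 : measurable_fun setT Y1 := measurable_overlap1 meas1 1 2.
have m2 : measurable_fun setT Y2 := measurable_overlap2 meas2 1 2.
have Y1b c : -1 <= Y1 c <= 1.
  by rewrite -ler_norml; exact: (ip_unit_ball hip1).
have Y2b c : -1 <= Y2 c <= 1.
  by rewrite -ler_norml; exact: (ip_unit_ball hip2).
have [bY bq close] := couple _ _ Q Y1 Y2 m1 m2 Y1b Y2b Qsync f A B A0 B0
  (smooth2_continuous sf) fA L1 L2.
have far j (c : nat -> X) x k : (2 < j)%N -> (k <= 2)%N -> upd c j x k = c k.
  by move=> j2 k2; rewrite /upd ltn_eqF// (leq_ltn_trans k2).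
(* Both are infima of the same set for every [u], so they agree even where the infimum is a default
   value. *)
have F1 : Finv P G ip1 s1 = quantile Q Y1.
  apply/funext => u; rewrite /Finv /quantile; congr (inf _); apply/funext => t.
  rewrite /= -lee_fin /distr -EGQ; last 2 first.
  - exact: bounded_measurable_le.
  - by move=> j c x j2; rewrite /Y1 /overlap !far.
  congr (_ <= EG _ _ _ _)%E; apply/funext => c.
  by rewrite /Y1; case: (_ <= t).
have F2 : Finv P G ip2 s2 = quantile Q Y2.
  apply/funext => u; rewrite /Finv /quantile; congr (inf _); apply/funext => t.
  rewrite /= -lee_fin /distr -EGQ; last 2 first.
  - exact: bounded_measurable_le.
  - by move=> j c x j2; rewrite /Y2 /overlap !far.
  congr (_ <= EG _ _ _ _)%E; apply/funext => c.
  by rewrite /Y2; case: (_ <= t).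
rewrite F1 F2 (EGQ (fun c => f (Y1 c) (Y2 c)))//; last first.
  by move=> j c x j2; rewrite /Y1 /Y2 /overlap !far.
have -> : [set u : R | (0 <= u <= 1)%R] = `[0%R, 1%R]%classic.
  by apply/seteqP; split => u /=; rewrite in_itv.
have -> : (\int[lebesgue_measure]_(u in `[0%R, 1%R]) (f (quantile Q Y1 u) (quantile Q Y2 u))%:E =
    (\int[uniform_prob (@ltr01 R)]_u f (quantile Q Y1 u) (quantile Q Y2 u))%:E)%E.
  rewrite -(integral_uniform01 bq).
  exact: (integral_fin (probability_setT (uniform_prob (@ltr01 R))) bq).
rewrite supE gradE -(EFinD A B) -(EFinM eps).
by move: close; rewrite -lee_fin.
Qed.
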